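(* Let $f_0\in W^{1,\infty}(\mathbb{T})$ and let $f$ be the global solution, with $f(\cdot,0)=f_0$, of the one-phase Muskat equation $$\partial_t f=-G_f(f)$$ in the infinite depth domain $\{(x,y)\in\mathbb{T}\times\mathbb{R}: y<f(x,t)\}$, as described in the context. Then $$f\in L^2([0,\infty);\dot H^{1/2}(\mathbb{T})),\qquad \partial_t f\in L^2([0,\infty);H^{-1/2}(\mathbb{T})).$$ If in addition $\int_{\mathbb{T}}f_0=0$, then for any $\alpha\in(0,1)$ and any $\varepsilon>0$, the norms $\|f(t)\|_{H^\alpha(\mathbb{T})}$, $\|f(t)\|_{C^\alpha(\mathbb{T})}$ and $\|\partial_t f(t)\|_{H^{-\varepsilon}(\mathbb{T})}$ decay exponentially as $t\to\infty$.
   Context: $\mathbb{T}=\mathbb{R}/2\pi\mathbb{Z}$ is the circle; all functions are real-valued. Dirichlet-to-Neumann operator $G_f$: for a Lipschitz function $f:\mathbb{T}\to\mathbb{R}$ and $g\in H^{1/2}(\mathbb{T})$, let $\Omega=\{(x,y)\in\mathbb{T}\times\mathbb{R}: y<f(x)\}$ and let $\phi\in\dot H^1(\Omega)$ (i.e. $\nabla_{x,y}\phi\in L^2(\Omega)$) be the unique variational solution of $\Delta_{x,y}\phi=0$ in $\Omega$, $\phi(x,f(x))=g(x)$, $\nabla_{x,y}\phi\to0$ as $(x,y)\to\infty$ in $\Omega$. Then $G_f(g)=(\partial_y\phi-\partial_xf\,\partial_x\phi)|_{y=f(x)}$, which is well-defined in $H^{-1/2}(\mathbb{T})$ in the usual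 weak sense: $\langle G_f(g),\psi\rangle_{H^{-1/2},H^{1/2}}=\int_\Omega\nabla_{x,y}\phi\cdot\nabla_{x,y}w\,dx\,dy$ for every $\psi\in H^{1/2}(\mathbb{T})$ and $w\in H^1(\Omega)$ with $w(x,f(x))=\psi(x)$. In the equation, $G_f(f)$ at time $t$ means $G_{f(\cdot,t)}(f(\cdot,t))$. The solution $f$: it is a known theorem (Dong, Gancedo and Nguyen, ''Global well-posedness for the one-phase Muskat problem'') that for every $f_0\in W^{1,\infty}(\mathbb{T})$ there is a unique viscosity solution $f$ with initial data $f_0$; this is the solution meant. It has the following properties, through which it is used here: (i) $f\in C(\mathbb{T}\times[0,\infty))\cap L^\infty([0,\infty);W^{1,\infty}(\mathbb{T}))$ and $\partial_tf\in L^\infty([0,\infty);L^2(\mathbb{T}))$; (ii) the equation $\partial_tf=-G_f(f)$ is satisfied in the $L^\infty_tL^2_x$ sense; (iii) $\|f(t)\|_{L^\infty(\mathbb{T})}\le\|f_0\|_{L^\infty(\mathbb{T})}$ and $\int_{\mathbb{T}}f(x,t)dx=\int_{\mathbb{T}}f_0(x)dx$ for all $t>0$; (iv) $\|\partial_xf(t)\|_{L^\infty(\mathbb{T})}\le\|\partial_xf_0\|_{L^\infty(\mathbb{T})}$ for a.e. $t>0$. $\dot H^{1/2}(\mathbb{T})$ has seminorm $\|u\|_{\dot H^{1/2}}^2=\sum_{k\in\mathbb{Z}}|k||\widehat u(k)|^2$. ''A norm $N(t)$ decays exponentially'' means there exist constants $A,\lambda>0$ independent of $t$ (possibly depending on $f_0$,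 $\alpha$, $\varepsilon$) such that $N(t)\le Ae^{-\lambda t}$ for $t>0$ (for a.e. $t>0$ in the case of $\partial_tf$, which is defined for a.e. $t$). *)

(* Defs.v *)
From HB Require Import structures.
From mathcomp Require Import all_boot all_order all_algebra.
From mathcomp Require Import all_classical all_reals all_analysis.
From mathcomp Require Import ess_sup_inf.

Set Implicit Arguments.
Unset Strict Implicit.
Unset Printing Implicit Defensive.

Import Order.TTheory GRing.Theory Num.Theory.
Import numFieldNormedType.Exports.

Local Open Scope classical_set_scope.
Local Open Scope ring_scope.

(* A function on the circle T = R/2piZ is a 2pi-periodic function R -> R and is
   integrated over [0, 2pi].  A function on a subset of T x R is a function of
   p = (x, y), 2pi-periodic in x, and is integrated over 0 <= x <= 2pi.  The
   second coordinate is either the depth y or the time t. *)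

Section Circle.
Context {R : realType}.
Implicit Types (u v g : R -> R) (s : R).

Definition circ : set R := `[0, 2 * pi]%classic.

Definition periodic u := forall x, u (x + 2 * pi) = u x.

Definition int_circ u : R := \int[lebesgue_measure]_(x in circ) u x.

Definition L1_circ u :=
  periodic u /\ lebesgue_measure.-integrable circ (EFin \o u).

Definition L2sq_circ u : \bar R :=
  (\int[lebesgue_measure]_(x in circ) ((u x) ^+ 2)%:E)%E.

Definition L2_circ u :=
  [/\ periodic u, measurable_fun circ u & (L2sq_circ u < +oo)%E].

(* By periodicity the essential supremum over R is the one over T. *)
Definition Linf_norm u : \bar R :=
  ess_sup lebesgue_measure (fun x => `|u x|%:E).

Definition test_circ (eta : R -> R) :=
  [/\ periodic eta, forall x, derivable eta x 1 & continuous (derive1 eta)].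

Definition is_weak_deriv u v :=
  L1_circ v /\ forall eta, test_circ eta ->
    int_circ (fun x => u x * derive1 eta x) = - int_circ (fun x => v x * eta x).

(* A chosen representative; weak derivatives are unique almost everywhere. *)
Definition weak_deriv u : R -> R := get [set v | is_weak_deriv u v].

Definition W1inf_norm u : \bar R := (Linf_norm u + Linf_norm (weak_deriv u))%E.

Definition W1inf u :=
  [/\ L1_circ u, (exists v, is_weak_deriv u v) & (W1inf_norm u < +oo)%E].

(* hat u (k) = (fourier_cos u k) - i (fourier_sin u k), for u in L^1(T).
   Distributions of negative order occur below only as elements of L^2(T), so
   these coefficients also serve for the norms of H^s(T) with s < 0. *)
Definition fourier_cos u (k : int) : R :=
  (2 * pi)^-1 * int_circ (fun x => u x * cos (k%:~R * x)).

Definition fourier_sin u (k : int) : R :=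
  (2 * pi)^-1 * int_circ (fun x => u x * sin (k%:~R * x)).

Definition fourier_sqmod u (k : int) : R :=
  fourier_cos u k ^+ 2 + fourier_sin u k ^+ 2.

Definition weighted_norm (w : int -> R) u : \bar R :=
  ((\esum_(k in [set: int]) (w k * fourier_sqmod u k)%:E) `^ (2^-1))%E.

Definition hs_weight s (k : int) : R := (1 + k%:~R ^+ 2) `^ s.

Definition hs_norm s u : \bar R := weighted_norm (hs_weight s) u.

Definition homog_half_weight (k : int) : R := `|k%:~R|.

Definition homog_half_norm u : \bar R := weighted_norm homog_half_weight u.

Definition H_half u := L2_circ u /\ (hs_norm (2^-1) u < +oo)%E.

(* For a periodic u, the Hoelder quotient is largest when |x - y| is the
   distance on T, so x and y may range over R. *)
Definition holder_norm (alpha : R) u : \bar R :=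
  (ereal_sup [set `|u x|%:E | x in [set: R]] +
   ereal_sup [set (`|u p.1 - u p.2| / `|p.1 - p.2| `^ alpha)%:E
             | p in [set p : R * R | p.1 != p.2]])%E.

End Circle.

Section Cylinder.
Context {R : realType}.
Implicit Types (U : set (R * R)) (phi u v eta : R * R -> R) (f g : R -> R).

Local Notation leb2 := (@lebesgue_measure R \x @lebesgue_measure R)%E.

Definition cell : set (R * R) := [set p | circ p.1].

Definition xperiodic U u :=
  forall x y, U (x, y) -> u (x + 2 * pi, y) = u (x, y).

Definition partial1 u (p : R * R) : R :=
  derive1 (fun x : R => u (x, p.2)) p.1.
Definition partial2 u (p : R * R) : R :=
  derive1 (fun y : R => u (p.1, y)) p.2.

Definition C1_cyl u :=
  [/\ xperiodic setT u,
      forall p, derivable (fun x : R => u (x, p.2)) p.1 1,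
      forall p, derivable (fun y : R => u (p.1, y)) p.2 1,
      continuous (partial1 u) &
      continuous (partial2 u)].

(* C^1 functions whose support is a compact subset of U, in T x R. *)
Definition test_on U eta :=
  [/\ C1_cyl eta,
      closure [set p | eta p != 0] `<=` U &
      exists M : R, forall p, eta p != 0 -> `|p.2| <= M].

Definition int_on U u : R := \int[leb2]_(p in U `&` cell) u p.

Definition L2sq_on U u : \bar R :=
  (\int[leb2]_(p in U `&` cell) ((u p) ^+ 2)%:E)%E.

Definition L1loc_on U u :=
  [/\ xperiodic U u, measurable_fun U u &
      forall K, compact K -> K `<=` U -> leb2.-integrable K (EFin \o u)].

Definition L2_on U u :=
  [/\ xperiodic U u, measurable_fun U u & (L2sq_on U u < +oo)%E].

Definition is_weak_partial1 U u v := forall eta, test_on U eta ->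
  int_on U (fun p => u p * partial1 eta p) = - int_on U (fun p => v p * eta p).

Definition is_weak_partial2 U u v := forall eta, test_on U eta ->
  int_on U (fun p => u p * partial2 eta p) = - int_on U (fun p => v p * eta p).

Definition subgraph f : set (R * R) := [set p | p.2 < f p.1].

(* phi lies in the homogeneous space H^1(subgraph f), with gradient (d1, d2). *)
Definition hdot1 f phi d1 d2 :=
  [/\ L1loc_on (subgraph f) phi,
      is_weak_partial1 (subgraph f) phi d1,
      is_weak_partial2 (subgraph f) phi d2,
      L2_on (subgraph f) d1 & L2_on (subgraph f) d2].

Definition h1 f phi d1 d2 := hdot1 f phi d1 d2 /\ L2_on (subgraph f) phi.

(* The trace phi(x, f x) = g x: the trace operator is the extension by
   continuity of the restriction to the graph, from functions C^1 up to the
   boundary to H^1 of the bounded Lipschitz domains {-M < y < f x}. *)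
Definition has_trace f phi d1 d2 g :=
  L2_circ g /\
  exists u_ : nat -> R * R -> R,
    [/\ forall n, C1_cyl (u_ n),
        forall M : R, let D := subgraph f `&` [set p | - M < p.2] in
          [/\ L2sq_on D (fun p => u_ n p - phi p) @[n --> \oo] --> 0%E,
              L2sq_on D (fun p => partial1 (u_ n) p - d1 p) @[n --> \oo] --> 0%E &
              L2sq_on D (fun p => partial2 (u_ n) p - d2 p) @[n --> \oo] --> 0%E] &
        L2sq_circ (fun x => u_ n (x, f x) - g x) @[n --> \oo] --> 0%E].

Definition grad_vanishes_at_infinity f (d1 d2 : R * R -> R) :=
  forall e : R, 0 < e -> exists M : R,
    {ae leb2, forall p, subgraph f p -> p.2 < - M ->
       d1 p ^+ 2 + d2 p ^+ 2 <= e ^+ 2}.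

Definition harmonic_extension f g phi d1 d2 :=
  [/\ hdot1 f phi d1 d2,
      has_trace f phi d1 d2 g,
      (forall eta, test_on (subgraph f) eta ->
        int_on (subgraph f)
          (fun p => d1 p * partial1 eta p + d2 p * partial2 eta p) = 0) &
      grad_vanishes_at_infinity f d1 d2].

(* The graph of the Dirichlet-to-Neumann operator: G_f(g) = G, an element of
   H^{-1/2}(T) being given by its action on H^{1/2}(T). *)
Definition is_DN f g (G : (R -> R) -> R) :=
  exists phi d1 d2, harmonic_extension f g phi d1 d2 /\
    forall psi, H_half psi ->
    forall w w1 w2, h1 f w w1 w2 -> has_trace f w w1 w2 psi ->
      G psi = int_on (subgraph f) (fun p => d1 p * w1 p + d2 p * w2 p).

End Cylinder.

Section Muskat.
Context {R : realType}.
Implicit Types (F : R * R -> R) (N : R -> \bar R).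

(* Space-time functions take the pair (x, t). *)
Definition slice F (t : R) : R -> R := fun x => F (x, t).

Definition positive_times : set (R * R) := [set p | 0 < p.2].
Definition nonneg_times : set (R * R) := [set p | 0 <= p.2].

Definition time_axis : set R := `[0, +oo[%classic.

Definition ae_time (P : R -> Prop) :=
  {ae (@lebesgue_measure R), forall t : R, 0 < t -> P t}.

(* The viscosity solution f with initial data f0 enters only through these
   properties; ft is the time derivative of f.  The equation in the L^oo_t L^2_x
   sense says that, for almost every t, the H^{-1/2} functional G_f(f) is
   integration against the L^2 function - ft(t). *)
Record muskat_solution (f0 : R -> R) (f ft : R * R -> R) : Prop := MuskatSolution {
  ms_periodic : xperiodic nonneg_times f;
  ms_initial : slice f 0 = f0;
  ms_continuous : {within nonneg_times, continuous f};
  ms_W1inf : exists M : R, ae_time (fun t =>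
    W1inf (slice f t) /\ (W1inf_norm (slice f t) <= M%:E)%E);
  ms_dt : is_weak_partial2 positive_times f ft;
  ms_dt_periodic : xperiodic positive_times ft;
  ms_dt_measurable : measurable_fun positive_times ft;
  ms_dt_L2 : exists M : R, ae_time (fun t =>
    L2_circ (slice ft t) /\ (L2sq_circ (slice ft t) <= M%:E)%E);
  ms_equation : ae_time (fun t =>
    is_DN (slice f t) (slice f t)
      (fun psi => int_circ (fun x => - slice ft t x * psi x)));
  ms_max_principle : forall t, 0 < t ->
    (Linf_norm (slice f t) <= Linf_norm f0)%E;
  ms_mean : forall t, 0 < t -> int_circ (slice f t) = int_circ f0;
  ms_slope : ae_time (fun t =>
    (Linf_norm (weak_deriv (slice f t)) <= Linf_norm (weak_deriv f0))%E)
}.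

(* L^2([0, oo); X) for the space X of functions normed by weighted_norm w.
   As X is separable and the Fourier modes are total in its dual, strong
   measurability in time is measurability of every Fourier coefficient. *)
Definition L2_time (w : int -> R) F :=
  [/\ (forall k, measurable_fun time_axis
                   (fun t => fourier_cos (slice F t) k)),
      (forall k, measurable_fun time_axis
                   (fun t => fourier_sin (slice F t) k)) &
      (\int[lebesgue_measure]_(t in time_axis)
          (weighted_norm w (slice F t) `^ 2) < +oo)%E].

Definition decays_exponentially N :=
  exists A lambda : R, [/\ 0 < A, 0 < lambda &
    forall t, 0 < t -> (N t <= (A * expR (- (lambda * t)))%:E)%E].

Definition ae_decays_exponentially N :=
  exists A lambda : R, [/\ 0 < A, 0 < lambda &
    ae_time (fun t => (N t <= (A * expR (- (lambda * t)))%:E)%E)].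

End Muskat.

(* Main.v *)
From HB Require Import structures.
From mathcomp Require Import all_boot all_order all_algebra.
From mathcomp Require Import all_classical all_reals all_analysis.
From mathcomp Require Import measurable_realfun ess_sup_inf ring lra.
Require Import Defs.

(** Exponential decay comes from a single Lyapunov function, the square deviation
    y(t) = int (f(t) - c)^2 from the conserved mean c; every norm of the statement
    is reached from y by interpolation with a quantity that stays bounded.

    Fix a time at which the equation holds. Let u be the slice of f, phi its
    harmonic extension below the graph and E the Dirichlet energy of phi. The
    weak formulation of the Dirichlet-to-Neumann operator gives three facts,
    collected in [good_dissipation].
    - Testing with phi itself, cut off between the depths N and 2N below the
      graph, gives E <= - int ft u ([energy_le]). The error of the cut-off pairs
      the vertical derivative of phi, whose energy far below is small, with
      phi / N on a strip of height N; that product is bounded in mean square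
      because the mean square of phi on the strip is at most quadratic in N
      ([trace_growth]).
    - Testing with psi(x) times a cut-off gives, for every k > 0, a bound of
      int ft psi by a multiple of k E plus a constant over k ([DN_test_le]); for
      psi = 1 the cut-off can be pushed to infinite depth, so int ft = 0
      ([DN_one]).
    - A Poincare inequality for the trace, int (u - c)^2 <= C E
      ([trace_poincare]), holds with C depending only on the supremum of |u|,
      which the maximum principle keeps bounded: points of the graph are joined by
      paths straight down to a common horizontal line and along it.

    Formally y' = 2 int ft (f - c) <= - 2 E, hence y' <= - 2 l y with l > 0. As
    the time derivative is only a weak one, this is read off increments:
    y(t) - y(s) is the integral over s <= tau <= t of the pairing of ft(tau) with
    f(t) + f(s) - 2 c. Since f is Lipschitz in time with values in L^2
    ([time_lip]), replacing f(t) + f(s) by 2 f(tau) costs O((t - s)^2) in total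
    ([deviation_increment]), and a function whose increments are at most
    quadratic is nonincreasing ([quadratic_increments]). This is applied to
    y(t) exp(l t) and yields [deviation_decay].

    The slope bound keeps the H^1 norm bounded. Splitting the frequencies at a
    level growing exponentially in time gives the decay in H^alpha and, whatever
    the mean, in the homogeneous H^{1/2} seminorm ([sum_decay]). A Lipschitz
    function small in L^2 is uniformly small ([sup_of_L2]), and the uniform norm
    interpolates with the Lipschitz bound to the Hoelder norms ([holder_le]).
    Since E <= - int ft (f - c) and ft is bounded in L^2, the energy E decays for
    almost every time; taking k exponentially large in the second fact makes each
    Fourier mode of ft decay at a cost polynomial in the frequency
    ([dt_sqmod_le]), and the bounded L^2 norm of ft takes care of the high
    frequencies in every negative norm ([dt_decay]). Exponential decay outside a
    null set of times gives square integrability in time ([decay_L2]). *)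

Set Implicit Arguments.
Unset Strict Implicit.
Unset Printing Implicit Defensive.
Import Order.TTheory GRing.Theory Num.Theory.
Import numFieldNormedType.Exports.
Local Open Scope classical_set_scope.
Local Open Scope ring_scope.

Local Notation ig mu D f := (integrable mu D (EFin \o f)).
(** The sigma-algebras on which Lebesgue measure and its square are defined; they
    are named because inference from the type of points alone chooses another
    instance. *)
Local Notation meas1 A := (@measurable _ (measurableTypeR _) A).
Local Notation meas2 A :=
  (@measurable _ (measurableTypeR _ * measurableTypeR _)%type A).
Local Notation mfun1 D f := (@measurable_fun _ _ (measurableTypeR _) _ D f).
Local Notation mfun2 D f :=
  (@measurable_fun _ _ (measurableTypeR _ * measurableTypeR _)%type _ D f).

(** * Square-integrable functions *)

Lemma norm_mul_le (R : realFieldType) (a b : R) : `|a * b| <= a ^+ 2 + b ^+ 2.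
Proof.
have h1 := sqr_ge0 (a + b); have h2 := sqr_ge0 (a - b).
have e1 : a ^+ 2 + b ^+ 2 + a * b = ((a + b) ^+ 2 + a ^+ 2 + b ^+ 2) / 2 by field.
have e2 : a ^+ 2 + b ^+ 2 - a * b = ((a - b) ^+ 2 + a ^+ 2 + b ^+ 2) / 2 by field.
rewrite ler_norml -[X in _ && X]subr_ge0 -[X in X && _]subr_ge0 opprK.
rewrite (addrC (a * b)) e1 e2 !mulr_ge0 ?addr_ge0 ?sqr_ge0//.
Qed.

Lemma sqr_add_le (R : realFieldType) (a b : R) :
  (a + b) ^+ 2 <= 2 * a ^+ 2 + 2 * b ^+ 2.
Proof.
rewrite -subr_ge0; have -> : 2 * a ^+ 2 + 2 * b ^+ 2 - (a + b) ^+ 2 =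
  (a - b) ^+ 2 by ring.
exact: sqr_ge0.
Qed.

Section SquareIntegrable.
Context d (T : measurableType d) (R : realType) (mu : {measure set T -> \bar R}).
Implicit Types (D : set T) (f g : T -> R) (k : R).

Lemma ig_meas D f : ig mu D f -> measurable_fun D f.
Proof. by move=> /integrableP[/measurable_EFinP]. Qed.

Lemma ig_le D f g : measurable D -> measurable_fun D f -> ig mu D g ->
  (forall x, D x -> `|f x| <= g x) -> ig mu D f.
Proof.
move=> mD mf ig_g fg; apply: (le_integrable mD _ _ ig_g).
  exact/measurable_EFinP.
by move=> x Dx /=; rewrite lee_fin (le_trans (fg x Dx)) ?ler_norm.
Qed.

Lemma eq_ig D f g : measurable D -> (forall x, D x -> f x = g x) ->
  ig mu D f -> ig mu D g.
Proof.
by move=> mD fg; apply: eq_integrable => // x /set_mem Dx /=; rewrite fg.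
Qed.

Lemma igD D f g : measurable D -> ig mu D f -> ig mu D g ->
  ig mu D (fun x => f x + g x).
Proof.
by move=> mD i1 i2; have := integrableD mD i1 i2; apply: eq_integrable.
Qed.

Lemma igB D f g : measurable D -> ig mu D f -> ig mu D g ->
  ig mu D (fun x => f x - g x).
Proof.
by move=> mD i1 i2; have := integrableB mD i1 i2; apply: eq_integrable.
Qed.

Lemma igZ D f k : measurable D -> ig mu D f -> ig mu D (fun x => k * f x).
Proof.
by move=> mD i1; have := integrableZl mD k i1; apply: eq_integrable.
Qed.

Lemma igN D f : measurable D -> ig mu D f -> ig mu D (fun x => - f x).
Proof.
move=> mD /(igZ (-1) mD); apply: eq_ig => // x _; exact: mulN1r.
Qed.

Lemma ig_cst D k : measurable D -> (mu D < +oo)%E -> ig mu D (fun=> k).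
Proof.
move=> mD muD; apply: (@measurable_bounded_integrable _ _ _ mu) => //.
exists `|k|; split => // M kM x Dx /=; exact: ltW.
Qed.

Lemma ig_bounded D f k : measurable D -> (mu D < +oo)%E -> measurable_fun D f ->
  (forall x, D x -> `|f x| <= k) -> ig mu D f.
Proof. by move=> mD /(ig_cst k mD) ik mf; apply: ig_le mf ik. Qed.

Lemma igM_bounded D f g k : measurable D -> measurable_fun D f ->
  (forall x, D x -> `|f x| <= k) -> ig mu D g -> ig mu D (fun x => f x * g x).
Proof.
move=> mD mf fk ig_g; apply: (@ig_le D _ (fun x => k * `|g x|)) => //.
- exact: measurable_funM mf (ig_meas ig_g).
- apply: igZ => //; exact: integrable_norm.
- by move=> x Dx; rewrite normrM ler_wpM2r ?fk.
Qed.

Lemma igS D D' f : measurable D -> measurable D' -> D' `<=` D ->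
  ig mu D f -> ig mu D' f.
Proof. by move=> mD mD' sub; apply: integrableS. Qed.

Lemma RintN D f : measurable D -> ig mu D f ->
  \int[mu]_(x in D) (- f x) = - \int[mu]_(x in D) f x.
Proof.
move=> mD i1; rewrite -[RHS]mulN1r -RintegralZl//.
by apply: eq_Rintegral => x _; rewrite mulN1r.
Qed.

Lemma Rint_bound D f g : measurable D -> ig mu D f -> ig mu D g ->
  (forall x, D x -> `|f x| <= g x) ->
  `|\int[mu]_(x in D) f x| <= \int[mu]_(x in D) g x.
Proof.
move=> mD i1 i2 fg; apply: le_trans (le_normr_Rintegral mD i1) _.
by apply: le_Rintegral => //; exact: integrable_norm.
Qed.

Lemma Rint_le_set D D' f : measurable D -> measurable D' -> D' `<=` D ->
  ig mu D f -> (forall x, D x -> 0 <= f x) ->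
  \int[mu]_(x in D') f x <= \int[mu]_(x in D) f x.
Proof.
move=> mD mD' sub i1 f0; rewrite /Rintegral fine_le//.
- exact: integrable_fin_num (igS mD mD' sub i1).
- exact: integrable_fin_num.
- by apply: ge0_subset_integral => //; case/integrableP: i1.
Qed.

Definition sqi D f := measurable_fun D f /\ ig mu D (fun x => f x ^+ 2).

Lemma sqi_meas D f : sqi D f -> measurable_fun D f. Proof. by case. Qed.

Lemma sqi_le D f g k : measurable D -> measurable_fun D f -> sqi D g ->
  (forall x, D x -> `|f x| <= k * `|g x|) -> sqi D f.
Proof.
move=> mD mf [mg ig_g] fg; split => //.
apply: (@ig_le D _ (fun x => k ^+ 2 * g x ^+ 2)) => //.
- exact: measurable_funX.
- exact: igZ.
- move=> x Dx; rewrite ger0_norm ?sqr_ge0// -[f x ^+ 2]real_normK ?num_real//.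
  rewrite -[g x ^+ 2]real_normK ?num_real// -exprMn ler_sqr ?nnegrE ?fg//.
  by rewrite (le_trans _ (fg x Dx)).
Qed.

Lemma sqiM D f g : measurable D -> sqi D f -> sqi D g ->
  ig mu D (fun x => f x * g x).
Proof.
move=> mD [mf if2] [mg ig2].
apply: (@ig_le D _ (fun x => f x ^+ 2 + g x ^+ 2)) => //.
- exact: measurable_funM.
- exact: igD.
- by move=> x _; exact: norm_mul_le.
Qed.

Lemma sqiD D f g : measurable D -> sqi D f -> sqi D g ->
  sqi D (fun x => f x + g x).
Proof.
move=> mD [mf if2] [mg ig2]; split; first exact: measurable_funD.
apply: (@ig_le D _ (fun x => 2 * f x ^+ 2 + 2 * g x ^+ 2)) => //.
- by apply: measurable_funX; exact: measurable_funD.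
- by apply: igD => //; apply: igZ.
- move=> x _; rewrite ger0_norm ?sqr_ge0//; exact: sqr_add_le.
Qed.

Lemma sqiZ D f k : measurable D -> sqi D f -> sqi D (fun x => k * f x).
Proof.
move=> mD [mf if2]; split; first exact: measurable_funM.
by move: (igZ (k ^+ 2) mD if2); apply: eq_ig => // x _; rewrite exprMn.
Qed.

Lemma eq_sqi D f g : measurable D -> (forall x, D x -> f x = g x) ->
  sqi D f -> sqi D g.
Proof.
move=> mD fg [mf if2]; split.
  by apply: eq_measurable_fun mf => x /set_mem Dx; exact: fg.
by apply: eq_ig if2 => // x Dx; rewrite fg.
Qed.

Lemma sqiB D f g : measurable D -> sqi D f -> sqi D g ->
  sqi D (fun x => f x - g x).
Proof.
move=> mD qf /(sqiZ (-1) mD) qg; apply: eq_sqi (sqiD mD qf qg) => // x _.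
by rewrite mulN1r.
Qed.

Lemma sqiM_bounded D f g k : measurable D -> measurable_fun D f ->
  (forall x, D x -> `|f x| <= k) -> sqi D g -> sqi D (fun x => f x * g x).
Proof.
move=> mD mf fk qg; apply: (@sqi_le D _ g k) => //.
  exact: measurable_funM mf (sqi_meas qg).
by move=> x Dx; rewrite normrM ler_wpM2r ?fk.
Qed.

Lemma sqi_bounded D f k : measurable D -> (mu D < +oo)%E -> measurable_fun D f ->
  (forall x, D x -> `|f x| <= k) -> sqi D f.
Proof.
move=> mD muD mf fk; split => //; apply: (@ig_bounded _ _ (k ^+ 2)) => //.
  exact: measurable_funX.
move=> x Dx; rewrite normrX ler_sqr ?nnegrE ?fk//.
exact: le_trans (normr_ge0 _) (fk x Dx).
Qed.

Lemma sqi_ig D f : measurable D -> (mu D < +oo)%E -> sqi D f -> ig mu D f.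
Proof.
move=> mD muD qf; have q1 : sqi D (fun=> 1).
  by apply: (@sqi_bounded D _ 1) => // x _; rewrite normr1.
by apply: eq_ig (sqiM mD qf q1) => // x _; rewrite mulr1.
Qed.

Lemma sqiS D D' f : measurable D -> measurable D' -> D' `<=` D ->
  sqi D f -> sqi D' f.
Proof.
move=> mD mD' sub [mf if2]; split; first exact: measurable_funS mf.
exact: igS if2.
Qed.

(** Young's inequality stands in for Cauchy-Schwarz throughout: a free weight
    [k] chosen at the end replaces the square roots. *)
Lemma Rint_young D f g k : measurable D -> 0 < k -> sqi D f -> sqi D g ->
  `|\int[mu]_(x in D) (f x * g x)| <=
  k * \int[mu]_(x in D) (f x ^+ 2) + k^-1 * \int[mu]_(x in D) (g x ^+ 2).
Proof.
move=> mD k0 qf qg.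
have [_ if2] := qf; have [_ ig2] := qg.
rewrite -!RintegralZl// -RintegralD//; [|exact: igZ|exact: igZ].
apply: Rint_bound => //; first exact: sqiM.
  by apply: igD => //; exact: igZ.
move=> x _; have kk : k * k^-1 = 1 by rewrite divff// gt_eqF.
have k'0 : 0 < k^-1 by rewrite invr_gt0.
have h1 : 0 <= k^-1 * (k * f x - g x) ^+ 2.
  by rewrite mulr_ge0 ?sqr_ge0// ltW.
have h2 : 0 <= k^-1 * (k * f x + g x) ^+ 2.
  by rewrite mulr_ge0 ?sqr_ge0// ltW.
have e1 : k^-1 * (k * f x - g x) ^+ 2 =
    k * f x ^+ 2 + k^-1 * g x ^+ 2 - 2 * (f x * g x) by field; rewrite gt_eqF.
have e2 : k^-1 * (k * f x + g x) ^+ 2 =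
    k * f x ^+ 2 + k^-1 * g x ^+ 2 + 2 * (f x * g x) by field; rewrite gt_eqF.
have h3 : 0 <= k * f x ^+ 2 + k^-1 * g x ^+ 2.
  by rewrite addr_ge0// mulr_ge0 ?sqr_ge0// ltW.
rewrite ler_norml; apply/andP; split; lra.
Qed.

Lemma Rint_sqD D f g : measurable D -> sqi D f -> sqi D g ->
  \int[mu]_(x in D) ((f x + g x) ^+ 2) <=
  2 * \int[mu]_(x in D) (f x ^+ 2) + 2 * \int[mu]_(x in D) (g x ^+ 2).
Proof.
move=> mD qf qg; have [_ if2] := qf; have [_ ig2] := qg.
rewrite -!RintegralZl// -RintegralD//; [|exact: igZ|exact: igZ].
apply: le_Rintegral => //.
- by have [] := sqiD mD qf qg.
- by apply: igD => //; exact: igZ.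
- move=> x _; exact: sqr_add_le.
Qed.

Lemma Rint_sq_ge0 D f : 0 <= \int[mu]_(x in D) (f x ^+ 2).
Proof. by apply: Rintegral_ge0 => x _; exact: sqr_ge0. Qed.

Lemma sqi_lty D f : measurable D -> measurable_fun D f ->
  (\int[mu]_(x in D) ((f x) ^+ 2)%:E < +oo)%E -> sqi D f.
Proof.
move=> mD mf foo; split => //; apply/integrableP; split.
  by apply/measurable_EFinP; exact: measurable_funX.
rewrite (_ : (\int[mu]_(x in D) _ = \int[mu]_(x in D) ((f x) ^+ 2)%:E)%E)//.
by apply: eq_integral => x _ /=; rewrite ger0_norm ?sqr_ge0.
Qed.

Lemma sqi_EFin D f : measurable D -> sqi D f ->
  (\int[mu]_(x in D) ((f x) ^+ 2)%:E)%E = (\int[mu]_(x in D) (f x ^+ 2))%:E.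
Proof.
move=> mD [mf if2]; rewrite /Rintegral fineK//.
exact: integrable_fin_num if2.
Qed.

End SquareIntegrable.

(** * Smooth switches and integrals on intervals *)

Lemma continuous_sq (R : realType) (T : topologicalType) (f : T -> R) :
  continuous f -> continuous (fun x => f x ^+ 2).
Proof.
move=> cf x; rewrite (_ : (fun x => f x ^+ 2) = (fun x => f x * f x)).
  by apply: cvgM; exact: cf.
by apply/funext => y; rewrite expr2.
Qed.


Section OneVariable.
Context {R : realType}.
Implicit Types (f g F : R -> R) (a b x y s k : R).
Local Notation leb := (@lebesgue_measure R).

(** Derivatives of piecewise quadratic functions come from one estimate,
    with no case distinction at the breakpoints. *)
Lemma quad_is_derive F x d C :
  (forall h, `|F (x + h) - F x - h * d| <= C * h ^+ 2) -> is_derive x 1 F d.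
Proof.
move=> H; have C0 : 0 <= C.
  by have := H 1; rewrite expr1n mulr1; apply: le_trans.
have cv : h^-1 *: ((F \o shift x) (h *: (1 : R)) - F x) @[h --> 0^'] --> d.
  apply/cvgrPdist_le => e e0; near=> h.
  have h0 : h != 0 by near: h; exact: nbhs_dnbhs_neq.
  have hn : 0 < `|h| by rewrite normr_gt0.
  rewrite /= /shift /= [h *: 1]mulr1 [_ *: _]/(h^-1 * _).
  rewrite -(ler_pM2l hn) -normrM.
  have -> : h * (d - h^-1 * (F (h + x) - F x)) = - (F (x + h) - F x - h * d).
    by rewrite (addrC h x); field.
  rewrite normrN (le_trans (H h))// -[h ^+ 2]real_normK ?num_real//.
  rewrite expr2 mulrCA ler_wpM2l//.
  rewrite mulrC (le_trans (_ : _ <= `|h| * (C + 1)))//.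
    by rewrite ler_wpM2l// lerDl.
  rewrite -ler_pdivlMr ?ltr_pwDr//; near: h; apply: dnbhs0_le.
  by rewrite divr_gt0// ltr_pwDr.
apply: DeriveDef; first by apply/cvg_ex; exists d.
exact: cvg_lim cv.
Unshelve. all: by end_near. Qed.

Definition sqpos s : R := Num.max s 0 ^+ 2.

Lemma sqpos_quad x h :
  `|Num.max (x + h) 0 ^+ 2 - Num.max x 0 ^+ 2 - h * (2 * Num.max x 0)| <= h ^+ 2.
Proof.
have sq : 0 <= (x + h) ^+ 2 by exact: sqr_ge0.
have [h1|h1] := leP (x + h) 0; have [h2|h2] := leP x 0.
- by rewrite !(expr0n, mulr0, subr0) normr0 sqr_ge0.
- by rewrite ler_norml; apply/andP; split; nra.
- by rewrite ler_norml; apply/andP; split; nra.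
- have -> : (x + h) ^+ 2 - x ^+ 2 - h * (2 * x) = h ^+ 2 by ring.
  by rewrite ger0_norm ?sqr_ge0.
Qed.

Lemma is_derive_sqpos c x :
  is_derive x 1 (fun s => sqpos (s - c)) (2 * Num.max (x - c) 0).
Proof.
apply: (@quad_is_derive _ _ _ 1) => h; rewrite mul1r /sqpos.
rewrite /= (addrAC x h (- c)).
exact: sqpos_quad.
Qed.

Lemma continuous_max0 : continuous (fun x : R => Num.max x 0).
Proof.
move=> x; have -> : (fun x : R => Num.max x 0) = (@idfun R) \max cst 0 by [].
by apply: continuous_max; [exact: cvg_id|exact: cvg_cst].
Qed.

(** Three translates of a half parabola whose second differences cancel
    outside [[0, 1]]: a continuously differentiable switch from 0 to 1, with the
    piecewise affine derivative [tent]. *)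
Definition step s : R :=
  2 * sqpos (s - 0) - 4 * sqpos (s - 2^-1) + 2 * sqpos (s - 1).
Definition tent s : R :=
  4 * Num.max (s - 0) 0 - 8 * Num.max (s - 2^-1) 0 + 4 * Num.max (s - 1) 0.

Lemma is_derive_step s : is_derive s 1 step (tent s).
Proof.
have h c : is_derive s 1 (fun s => sqpos (s - c)) (2 * Num.max (s - c) 0).
  exact: is_derive_sqpos.
have h0 := h 0.
have h1 := h 2^-1; have h2 := h 1.
rewrite /step; apply: is_derive_eq.
by rewrite /tent /GRing.scale /=; ring.
Qed.

Lemma step_le0 s : s <= 0 -> step s = 0.
Proof.
move=> s0; rewrite /step /sqpos subr0; have -> : Num.max s 0 = 0 by apply/max_idPr.
have -> : Num.max (s - 2^-1) 0 = 0 by apply/max_idPr; lra.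
have -> : Num.max (s - 1) 0 = 0 by apply/max_idPr; lra.
by ring.
Qed.

Lemma step_ge1 s : 1 <= s -> step s = 1.
Proof.
move=> s0; rewrite /step /sqpos subr0; have -> : Num.max s 0 = s by apply/max_idPl; lra.
have -> : Num.max (s - 2^-1) 0 = s - 2^-1 by apply/max_idPl; lra.
have -> : Num.max (s - 1) 0 = s - 1 by apply/max_idPl; lra.
by field.
Qed.

Lemma step_itv s : 0 <= step s <= 1.
Proof.
rewrite /step /sqpos subr0; apply/andP.
by have [h1|h1] := leP s 0; have [h2|h2] := leP (s - 2^-1) 0;
  have [h3|h3] := leP (s - 1) 0; split; nra.
Qed.

Lemma tent_ge0 s : 0 <= tent s.
Proof.
rewrite /tent subr0.
by have [h1|h1] := leP s 0; have [h2|h2] := leP (s - 2^-1) 0;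
  have [h3|h3] := leP (s - 1) 0; lra.
Qed.

Lemma tent_le2 s : tent s <= 2.
Proof.
rewrite /tent subr0.
by have [h1|h1] := leP s 0; have [h2|h2] := leP (s - 2^-1) 0;
  have [h3|h3] := leP (s - 1) 0; lra.
Qed.

Lemma tent_eq0 s : s <= 0 \/ 1 <= s -> tent s = 0.
Proof.
rewrite /tent subr0.
by have [h1|h1] := leP s 0; have [h2|h2] := leP (s - 2^-1) 0;
  have [h3|h3] := leP (s - 1) 0; lra.
Qed.

Lemma continuous_tent : continuous tent.
Proof.
have h c : continuous (fun s : R => Num.max (s - c) 0).
  move=> s; apply: (@continuous_comp _ _ _ (fun s => s - c) (fun s => Num.max s 0)).
    by apply: cvgB; [exact: cvg_id|exact: cvg_cst].
  exact: continuous_max0.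
move=> s; rewrite /tent; apply: cvgD; first apply: cvgB.
- by apply: cvgMr; exact: h.
- by apply: cvgMr; exact: h.
- by apply: cvgMr; exact: h.
Qed.

Lemma mitv a b : meas1 (`[a, b]%classic : set R).
Proof. exact: measurable_itv. Qed.

Lemma leb_itv_lty a b : (leb `[a, b]%classic < +oo)%E.
Proof.
by rewrite lebesgue_measure_itv/=; case: ifP => // _; rewrite -EFinB ltry.
Qed.

Lemma leb_itv a b : a <= b -> fine (leb `[a, b]%classic) = b - a.
Proof.
move=> ab; rewrite lebesgue_measure_itv/= lte_fin.
by case: ltP => // ba; rewrite (@le_anti _ _ a b) ?ab ?ba// subrr.
Qed.

Lemma continuous_ig f a b : continuous f -> ig leb `[a, b]%classic f.
Proof.
move=> cf; apply: continuous_compact_integrable; first exact: segment_compact.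
exact: continuous_subspaceT.
Qed.

Lemma ftc_C1 F f a b : a <= b -> (forall x, is_derive x 1 F (f x)) ->
  continuous f -> \int[leb]_(x in `[a, b]%classic) f x = F b - F a.
Proof.
rewrite le_eqVlt => /predU1P[<-|ab] dF cf.
  by rewrite set_itv1 Rintegral_set1 subrr.
have cF x : {for x, continuous F}.
  by apply: differentiable_continuous; apply/derivable1_diffP; have [] := dF x.
rewrite /Rintegral (@continuous_FTC2 _ f F a b)//.
- exact: continuous_subspaceT.
- split.
  + by move=> x _; have [] := dF x.
  + by apply: cvg_at_right_filter; exact: cF.
  + by apply: cvg_at_left_filter; exact: cF.
- by move=> x _; rewrite derive1E; exact: derive_val.
Qed.

Lemma continuous_mfun1 D f : continuous f -> mfun1 D f.
Proof. by move=> /continuous_measurable_fun; exact: measurable_funTS. Qed.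

End OneVariable.

(** * Measurability, continuity and Fubini in the plane *)

Section Plane.
Context {R : realType}.
Implicit Types (u v : R * R -> R) (D A : set (R * R)).
Local Notation leb := (@lebesgue_measure R).
Local Notation leb2 := (@lebesgue_measure R \x @lebesgue_measure R)%E.

(** The plane has a countable base of boxes with rational centres and radii,
    so the product sigma-algebra contains the open sets. *)
Lemma open2_measurable A : open A -> meas2 A.
Proof.
move=> oA; pose B (q1 q2 r : rat) : set (R * R) :=
  (ball (ratr q1 : R) (ratr r)) `*` (ball (ratr q2 : R) (ratr r)).
have -> : A = \bigcup_q1 \bigcup_q2 \bigcup_r
    (if `[< B q1 q2 r `<=` A >] then B q1 q2 r else set0).
  apply/seteqP; split=> [[x y] Axy|p [q1 _ [q2 _ [r _]]]]; last first.
    by case: ifPn => // /asboolP; apply.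
  have /nbhs_ballP[e /= e0 eA] : nbhs (x, y) A by exact: open_nbhs_nbhs.
  have e2 : 0 < e / 2 by rewrite divr_gt0.
  have [r /andP[r0 re]] : exists r : rat, 0 < (ratr r : R) < e / 2.
    by have [r] := rat_in_itvoo e2; rewrite in_itv/=; exists r.
  have [q1 /andP[q1l q1r]] : exists q : rat, x - ratr r < (ratr q : R) < x + ratr r.
    have h : x - ratr r < x + ratr r :> R by lra.
    by have [q] := rat_in_itvoo h; rewrite in_itv/=; exists q.
  have [q2 /andP[q2l q2r]] : exists q : rat, y - ratr r < (ratr q : R) < y + ratr r.
    have h : y - ratr r < y + ratr r :> R by lra.
    by have [q] := rat_in_itvoo h; rewrite in_itv/=; exists q.
  exists q1 => //; exists q2 => //; exists r => //; rewrite asboolT.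
    by split => /=; rewrite /ball /= ltr_norml; apply/andP; split; lra.
  move=> [a b] [/= + +]; rewrite /ball /= !ltr_norml => /andP[? ?] /andP[? ?].
  by apply: eA; split; rewrite /ball /= ltr_norml; apply/andP; split; lra.
apply: bigcupT_measurable_rat => q1; apply: bigcupT_measurable_rat => q2.
apply: bigcupT_measurable_rat => r; case: ifPn => // _.
by apply: measurableX; apply: open_measurable; exact: ball_open.
Qed.

Lemma closed2_measurable A : closed A -> meas2 A.
Proof. by move/closed_openC/open2_measurable/measurableC; rewrite setCK. Qed.

Lemma continuous2_meas u : continuous u -> mfun2 setT u.
Proof.
move=> /continuousP cf; apply: (measurability _ (RGenOpens.measurableE R)).
move=> _ [_ [a [b ->] <-]]; rewrite setTI; apply: open2_measurable.
exact/cf/interval_open.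
Qed.

Lemma continuous2_measD D u : continuous u -> mfun2 D u.
Proof. by move=> /continuous2_meas; exact: measurable_funTS. Qed.

Lemma mvt_bound (F dF : R -> R) (a b B : R) :
  (forall z : R, is_derive z (1 : R) F (dF z)) ->
  (forall z, Num.min a b <= z <= Num.max a b -> `|dF z| <= B) ->
  `|F b - F a| <= B * `|b - a|.
Proof.
move=> dFz; wlog ab : a b / a <= b => [hw|].
  have [/hw//|/hw h] := orP (le_total a b).
  by rewrite minC maxC distrC (distrC b) => /h.
have -> : Num.min a b = a by apply/min_idPl.
have -> : Num.max a b = b by apply/max_idPr.
move=> H; have cF : {within `[a, b], continuous F}.
  apply: continuous_subspaceT => x; apply: differentiable_continuous.
  by apply/derivable1_diffP; have [] := dFz x.
have [c cab ->] := MVT_segment ab (fun x _ => dFz x) cF.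
by rewrite normrM ler_wpM2r//; apply: H; move: cab; rewrite in_itv.
Qed.

Lemma between_dist (a b z r : R) : Num.min a b <= z <= Num.max a b ->
  `|a - b| < r -> `|a - z| < r.
Proof.
rewrite ge_min le_max !ltr_norml => /andP[/orP[?|?] /orP[?|?]] /andP[? ?];
  apply/andP; split; lra.
Qed.

Lemma partial1P u p : derivable (fun x : R => u (x, p.2)) p.1 1 ->
  is_derive p.1 1 (fun x : R => u (x, p.2)) (partial1 u p).
Proof. by move=> du; rewrite /partial1 derive1E; exact: DeriveDef. Qed.

Lemma partial2P u p : derivable (fun y : R => u (p.1, y)) p.2 1 ->
  is_derive p.2 1 (fun y : R => u (p.1, y)) (partial2 u p).
Proof. by move=> du; rewrite /partial2 derive1E; exact: DeriveDef. Qed.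

(** Both partial derivatives being bounded near a point, the mean value
    inequality along the two sides of a rectangle gives joint continuity. *)
Lemma C1_continuous u : C1_cyl u -> continuous u.
Proof.
move=> [_ d1 d2 c1 c2] [x0 y0]; apply/cvgrPdist_le => e e0.
pose B := `|partial1 u (x0, y0)| + `|partial2 u (x0, y0)| + 1.
have B0 : 0 < B by rewrite ltr_wpDl ?addr_ge0.
have /nbhs_ballP[r1 /= r10 H1] : \forall p \near (x0, y0), `|partial1 u p| <= B.
  have /cvgrPdist_le/(_ _ ltr01) := c1 (x0, y0); apply: filterS => p h.
  have := ler_normB (partial1 u (x0, y0)) (partial1 u (x0, y0) - partial1 u p).
  rewrite subKr /B; have := normr_ge0 (partial2 u (x0, y0)); lra.
have /nbhs_ballP[r2 /= r20 H2] : \forall p \near (x0, y0), `|partial2 u p| <= B.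
  have /cvgrPdist_le/(_ _ ltr01) := c2 (x0, y0); apply: filterS => p h.
  have := ler_normB (partial2 u (x0, y0)) (partial2 u (x0, y0) - partial2 u p).
  rewrite subKr /B; have := normr_ge0 (partial1 u (x0, y0)); lra.
pose r := Num.min (Num.min r1 r2) (e / (2 * B)).
have r0 : 0 < r by rewrite !lt_min r10 r20 divr_gt0// mulr_gt0.
have rr1 : r <= r1 by rewrite /r !ge_min lexx.
have rr2 : r <= r2 by rewrite /r !ge_min lexx orbT.
have rrB : r <= e / (2 * B) by rewrite /r !ge_min lexx !orbT.
have := @nbhsx_ballx R (R * R)%type (x0, y0) r r0; apply: filterS => -[x y] [/= hx hy].
have hB : B * r <= e / 2.
  move: rrB; rewrite ler_pdivlMr ?mulr_gt0// => h; rewrite ler_pdivlMr//; lra.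
have b1 : `|u (x, y0) - u (x0, y0)| <= B * `|x - x0|.
  apply: (@mvt_bound (fun x => u (x, y0)) (fun x => partial1 u (x, y0))).
    by move=> z; exact: (@partial1P u (z, y0)).
  move=> z hz; apply: H1; split => /=; last exact: ballxx.
  exact: lt_le_trans (between_dist hz hx) rr1.
have b2 : `|u (x, y) - u (x, y0)| <= B * `|y - y0|.
  apply: (@mvt_bound (fun y => u (x, y)) (fun y => partial2 u (x, y))).
    by move=> z; exact: (@partial2P u (x, z)).
  move=> z hz; apply: H2; split => /=; first exact: lt_le_trans rr2.
  exact: lt_le_trans (between_dist hz hy) rr2.
move: hx hy; rewrite /ball /= distrC => hx; rewrite distrC => hy.
rewrite distrC; have := ler_distD (u (x, y0)) (u (x, y)) (u (x0, y0)).
move=> /le_trans; apply.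
have h1 : B * `|x - x0| <= B * r by rewrite ler_wpM2l// ltW.
have h2 : B * `|y - y0| <= B * r by rewrite ler_wpM2l// ltW.
lra.
Qed.

End Plane.

Section FubiniPlane.
Context {R : realType}.
Implicit Types (f u v : R * R -> R) (D : set (R * R)) (A B : set R).
Local Notation leb := (@lebesgue_measure R).
Local Notation leb2 := (@lebesgue_measure R \x @lebesgue_measure R)%E.

Lemma ae_imp (P Q : R -> Prop) : (forall y, P y -> Q y) ->
  {ae leb, forall y, P y} -> {ae leb, forall y, Q y}.
Proof.
move=> PQ [N [mN N0 sub]]; exists N; split => // y nQ.
by apply: sub => /= Py; apply: nQ; exact: PQ.
Qed.

Lemma ae_and (P Q : R -> Prop) : {ae leb, forall y, P y} ->
  {ae leb, forall y, Q y} -> {ae leb, forall y, P y /\ Q y}.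
Proof.
move=> [N [mN N0 sub]] [N' [mN' N0' sub']]; exists (N `|` N'); split.
- exact: measurableU.
- by rewrite measureU0.
- move=> y /= /not_andP[h|h]; [left; exact: sub|right; exact: sub'].
Qed.

(** Passes from extended-real inner integrals, finite only almost everywhere, to
    real ones. *)
Lemma fine_Rint (F : R -> \bar R) : leb.-integrable setT F ->
  ig leb setT (fine \o F) /\
  (\int[leb]_x F x)%E = (\int[leb]_x (fine (F x))%:E)%E.
Proof.
move=> iF; have mF := measurable_int _ iF.
have mf : mfun1 setT (EFin \o (fine \o F)).
  by apply/measurable_EFinP; exact: measurableT_comp.
have ae : ae_eq leb setT F (EFin \o (fine \o F)).
  have := integrable_ae measurableT iF; apply: filterS => x h _ /=.
  by rewrite fineK//; exact: h.
split; last exact: ae_eq_integral.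
apply/integrableP; split => //.
case/integrableP: iF => _; apply: le_lt_trans.
apply: ge0_le_integral => //; do ?exact: measurableT_comp.
by move=> x _ /=; case: (F x) => [r| |] //=; rewrite normr0 leey.
Qed.

(** Extension by zero turns integrals over subsets into integrals over the whole
    plane, the form in which Fubini's theorem is applied. *)
Lemma patch_ig D f : meas2 D -> ig leb2 D f -> ig leb2 setT (f \_ D).
Proof.
by move=> mD i1; have := (integrable_mkcond _ mD).1 i1; rewrite restrict_EFin.
Qed.

Lemma integrable_inner_y (F : R * R -> \bar R) : leb2.-integrable setT F ->
  leb.-integrable setT (fubini_G leb F).
Proof.
move=> iF; have mF := measurable_int _ iF; apply/integrableP; split.
  exact: (measurable_fubini_G iF).
apply: le_lt_trans ((integrable21ltyP _ _ mF).1 iF).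
have mG := measurable_fubini_G iF.
apply: ge0_le_integral => //.
- exact: measurableT_comp.
- have mA : mfun2 setT (abse \o F) by exact: measurableT_comp.
  have := measurable_fun_fubini_tonelli_G (m1 := leb) _ mA.
  by apply => p; rewrite /=.
- by move=> y _; apply: le_abse_integral => //; exact: measurableT_comp.
Qed.

Lemma fubini_x D f : meas2 D -> ig leb2 D f ->
  ig leb setT (fun x => \int[leb]_y (f \_ D) (x, y)) /\
  \int[leb2]_(p in D) f p = \int[leb]_x \int[leb]_y (f \_ D) (x, y).
Proof.
move=> mD i0; have i1 := patch_ig mD i0; have iF := integrable_fubini_F i1.
have [iF' eF] := fine_Rint iF; split; first exact: iF'.
rewrite Rintegral_mkcond {1}/Rintegral -(integral12_prod_meas1 i1) eF.
by [].
Qed.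

Lemma fubini_y D f : meas2 D -> ig leb2 D f ->
  ig leb setT (fun y => \int[leb]_x (f \_ D) (x, y)) /\
  \int[leb2]_(p in D) f p = \int[leb]_y \int[leb]_x (f \_ D) (x, y).
Proof.
move=> mD i0; have i1 := patch_ig mD i0; have iF := integrable_inner_y i1.
have [iF' eF] := fine_Rint iF; split; first exact: iF'.
rewrite Rintegral_mkcond {1}/Rintegral -(integral21_prod_meas1 i1) eF.
by [].
Qed.

Lemma patch_box A B f x y :
  (f \_ (A `*` B)) (x, y) = ((fun x => ((fun y => f (x, y)) \_ B) y) \_ A) x.
Proof.
rewrite !patchE; have [xA|xA] := boolP (x \in A); have [yB|yB] := boolP (y \in B).
- by rewrite mem_set//; split; exact/set_mem.
- by rewrite memNset// => -[_ /mem_set]; exact/negP.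
- by rewrite memNset// => -[/mem_set + _]; exact/negP.
- by rewrite memNset// => -[/mem_set + _]; exact/negP.
Qed.

Lemma fubini_box_x A B f : meas1 A -> meas1 B -> ig leb2 (A `*` B) f ->
  ig leb A (fun x => \int[leb]_(y in B) f (x, y)) /\
  \int[leb2]_(p in A `*` B) f p = \int[leb]_(x in A) \int[leb]_(y in B) f (x, y).
Proof.
move=> mA mB; have mAB : meas2 (A `*` B) by exact: measurableX.
have e : (fun x => \int[leb]_y (f \_ (A `*` B)) (x, y)) =
    (fun x => \int[leb]_(y in B) f (x, y)) \_ A.
  apply/funext => x; rewrite patchE.
  under eq_Rintegral do rewrite patch_box patchE.
  case: ifP => xA; first by rewrite -Rintegral_mkcond.
  by rewrite Rintegral_cst// mul0r.
move=> i0; have [] := fubini_x mAB i0; rewrite e => i1 ->; split.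
  by apply: (integrable_mkcond _ mA).2; rewrite restrict_EFin.
by rewrite [RHS]Rintegral_mkcond.
Qed.

Lemma fubini_box_y A B f : meas1 A -> meas1 B -> ig leb2 (A `*` B) f ->
  ig leb B (fun y => \int[leb]_(x in A) f (x, y)) /\
  \int[leb2]_(p in A `*` B) f p = \int[leb]_(y in B) \int[leb]_(x in A) f (x, y).
Proof.
move=> mA mB; have mAB : meas2 (A `*` B) by exact: measurableX.
have e : (fun y => \int[leb]_x (f \_ (A `*` B)) (x, y)) =
    (fun y => \int[leb]_(x in A) f (x, y)) \_ B.
  apply/funext => y; rewrite patchE.
  case: ifP => yB.
    rewrite [RHS]Rintegral_mkcond; apply: eq_Rintegral => x _.
    by rewrite patch_box !patchE yB.
  rewrite (_ : \int[leb]_x _ = \int[leb]_(x in setT) (cst 0) x).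
    by rewrite Rintegral_cst// mul0r.
  apply: eq_Rintegral => x _; rewrite patch_box !patchE yB; by case: ifP.
move=> i0; have [] := fubini_y mAB i0; rewrite e => i1 ->; split.
  by apply: (integrable_mkcond _ mB).2; rewrite restrict_EFin.
by rewrite [RHS]Rintegral_mkcond.
Qed.

Lemma patch_meas D f : meas2 D -> mfun2 D f ->
  mfun2 setT (EFin \o (f \_ D)).
Proof.
move=> mD mf; apply/measurable_EFinP.
by apply: (measurable_restrictT _ mD).1.
Qed.

(** Tonelli on a box, in the form used to recognise integrable functions. *)
Lemma tonelli_box A B f (k : R) : meas1 A -> meas1 B ->
  (leb B < +oo)%E -> mfun2 (A `*` B) f ->
  (forall p, (A `*` B) p -> 0 <= f p) -> 0 <= k ->
  {ae leb, forall y, B y -> (\int[leb]_(x in A) (f (x, y))%:E <= k%:E)%E} ->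
  ig leb2 (A `*` B) f.
Proof.
move=> mA mB Bfin mf f0 k0 fk; have mAB : meas2 (A `*` B) by exact: measurableX.
apply: (integrable_mkcond _ mAB).2; rewrite restrict_EFin.
have mg := patch_meas mAB mf.
have g0 p : (0 <= (EFin \o (f \_ (A `*` B))) p)%E.
  rewrite /= patchE lee_fin; case: ifP => // /set_mem; exact: f0.
apply/integrableP; split => //.
rewrite (_ : (\int[leb2]_p _)%E = (\int[leb2]_p (EFin \o (f \_ (A `*` B))) p)%E); last first.
  by apply: eq_integral => p _; rewrite gee0_abs.
rewrite (fubini_tonelli2 _ mg g0)//.
have e y : fubini_G leb (EFin \o f \_ (A `*` B)) y =
    ((fun y => \int[leb]_(x in A) (f (x, y))%:E)%E \_ B) y.
  rewrite /fubini_G !patchE; case: ifP => yB.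
    rewrite [RHS]integral_mkcond; apply: eq_integral => x _ /=.
    by rewrite patch_box !patchE yB; case: ifP.
  rewrite (_ : (\int[leb]_x _)%E = (\int[leb]_(x in setT) (cst 0) x)%E).
    by rewrite integral_cst// mul0e.
  by apply: eq_integral => x _ /=; rewrite patch_box !patchE yB; case: ifP.
apply: (@le_lt_trans _ _ (\int[leb]_(y in B) (cst k%:E) y)%E); last first.
  by rewrite integral_cst// lte_mul_pinfty.
rewrite [leRHS]integral_mkcond; apply: ae_ge0_le_integral => //.
- by move=> y _; apply: integral_ge0.
- exact: (measurable_fun_fubini_tonelli_G _ mg g0).
- by move=> y _; rewrite patchE; case: ifP; rewrite ?lee_fin.
- apply/(measurable_restrictT _ _).1 => //; exact: measurable_cst.
apply: ae_imp fk => y h _; rewrite [leLHS](e y) !patchE; case: ifP => // /set_mem By.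
exact: h.
Qed.

End FubiniPlane.

(** * Mean squares on the circle *)

Section Circle1.
Context {R : realType}.
Implicit Types (f g h F : R -> R) (a b : R).
Local Notation leb := (@lebesgue_measure R).

Lemma circ_lty : (leb (circ : set R) < +oo)%E.
Proof. exact: leb_itv_lty. Qed.

Lemma mcirc : meas1 (circ : set R).
Proof. exact: mitv. Qed.

Lemma pi2_gt0 : 0 < 2 * pi :> R.
Proof. by rewrite mulr_gt0// pi_gt0. Qed.

Lemma circ_mass : fine (leb (circ : set R)) = 2 * pi.
Proof. by rewrite leb_itv ?subr0// ltW// pi2_gt0. Qed.

Lemma Rint_sq_le h a b : a <= b -> sqi leb `[a, b]%classic h ->
  (\int[leb]_(x in `[a, b]%classic) h x) ^+ 2 <=
  (b - a) * \int[leb]_(x in `[a, b]%classic) (h x ^+ 2).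
Proof.
rewrite le_eqVlt => /predU1P[<-|ab] qh.
  by rewrite set_itv1 !Rintegral_set1 expr0n subrr mul0r.
have mab := mitv a b; have ih := sqi_ig mab (leb_itv_lty a b) qh.
have [_ ih2] := qh.
set I := \int[leb]_(x in _) h x; set Q := \int[leb]_(x in _) (h x ^+ 2).
have ba : 0 < b - a by rewrite subr_gt0.
pose m := I / (b - a).
have icst : ig leb `[a, b]%classic (fun=> m ^+ 2) by apply: ig_cst => //; exact: leb_itv_lty.
have : 0 <= \int[leb]_(x in `[a, b]%classic) ((h x - m) ^+ 2) by exact: Rint_sq_ge0.
have -> : \int[leb]_(x in `[a, b]%classic) ((h x - m) ^+ 2) =
    Q - 2 * m * I + m ^+ 2 * (b - a).
  rewrite (_ : \int[leb]_(x in _) _ = \int[leb]_(x in `[a, b]%classic)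
      (h x ^+ 2 - 2 * m * h x + m ^+ 2)); last first.
    by apply: eq_Rintegral => x _; ring.
  rewrite RintegralD//; last by apply: igB => //; exact: igZ.
  rewrite RintegralB//; last exact: igZ.
  by rewrite RintegralZl// Rintegral_cst// leb_itv// ltW.
have mI : m * (b - a) = I by rewrite /m divfK// gt_eqF.
have -> : Q - 2 * m * I + m ^+ 2 * (b - a) = Q - m * I.
  by rewrite -mI; ring.
rewrite subr_ge0 => h1.
have -> : I ^+ 2 = (b - a) * (m * I) by rewrite mulrA (mulrC (b - a)) mI expr2.
by rewrite ler_wpM2l// ltW.
Qed.

Lemma diff_sq_le F f a b : a <= b -> (forall x : R, is_derive x (1 : R) F (f x)) ->
  continuous f ->
  (F b - F a) ^+ 2 <= (b - a) * \int[leb]_(x in `[a, b]%classic) (f x ^+ 2).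
Proof.
move=> ab dF cf; rewrite -(ftc_C1 ab dF cf); apply: Rint_sq_le => //; split.
  exact: continuous_mfun1.
by apply: continuous_ig; exact: continuous_sq.
Qed.

(** Lets a convenient constant, here a value of the function at some point,
    stand for the mean. *)
Lemma variance_le g (m : R) : sqi leb circ g ->
  \int[leb]_(x in circ) ((g x - (2 * pi)^-1 * int_circ g) ^+ 2) <=
  \int[leb]_(x in circ) ((g x - m) ^+ 2).
Proof.
move=> qg; have ig1 := sqi_ig mcirc circ_lty qg; have [_ ig2] := qg.
have expand c : \int[leb]_(x in circ) ((g x - c) ^+ 2) =
    \int[leb]_(x in circ) (g x ^+ 2) - 2 * c * int_circ g + c ^+ 2 * (2 * pi).
  have ic : ig leb circ (fun=> c ^+ 2) by apply: ig_cst; [exact: mcirc|exact: circ_lty].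
  rewrite (_ : \int[leb]_(x in _) _ = \int[leb]_(x in circ)
      (g x ^+ 2 - 2 * c * g x + c ^+ 2)); last first.
    by apply: eq_Rintegral => x _; ring.
  have mc := mcirc; rewrite RintegralD//; last by apply: igB => //; exact: igZ.
  rewrite RintegralB//; last exact: igZ.
  by rewrite RintegralZl// Rintegral_cst// circ_mass.
rewrite !expand; have p0 := pi2_gt0; set I := int_circ g.
have e : (2 * pi) * ((2 * pi)^-1 * I) = I by rewrite mulrA divff ?mul1r ?gt_eqF.
set c := (2 * pi)^-1 * I in e *; rewrite -subr_ge0 -e.
have -> : forall Q p, (Q - 2 * m * (p * c) + m ^+ 2 * p) -
  (Q - 2 * c * (p * c) + c ^+ 2 * p) = p * (m - c) ^+ 2 by move=> ??; ring.
by rewrite mulr_ge0 ?sqr_ge0// ltW.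
Qed.

End Circle1.

(** * Slabs of the region below a graph *)

Section PlaneSets.
Context {R : realType}.
Implicit Types (h v : R * R -> R) (u : R -> R) (K M a b : R).
Local Notation leb := (@lebesgue_measure R).
Local Notation leb2 := (@lebesgue_measure R \x @lebesgue_measure R)%E.

Definition slab u K : set (R * R) := (subgraph u `&` [set p | - K < p.2]) `&` cell.

Lemma open_subgraph u : continuous u -> open (subgraph u).
Proof.
move=> cu; rewrite (_ : subgraph u = (fun p : R * R => u p.1 - p.2) @^-1` [set x | 0 < x]).
  apply: (@open_comp _ _ (fun p : R * R => u p.1 - p.2)); last exact: open_gt.
  move=> p _; apply: cvgB; last exact: cvg_snd.
  by apply: (@continuous_comp _ _ _ fst u); [exact: cvg_fst|exact: cu].
by apply/seteqP; split => p /=; rewrite /subgraph /= subr_gt0.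
Qed.

Lemma meas_subgraph u : continuous u -> meas2 (subgraph u).
Proof. by move=> /open_subgraph/open2_measurable. Qed.

Lemma meas_cell : meas2 (cell : set (R * R)).
Proof.
rewrite (_ : cell = circ `*` setT).
  by apply: measurableX => //; exact: mcirc.
by apply/seteqP; split => p //= [].
Qed.

Lemma meas_above K : meas2 [set p : R * R | - K < p.2].
Proof.
apply: open2_measurable.
rewrite (_ : [set p | _] = (fun p : R * R => p.2) @^-1` [set x | - K < x])//.
apply: (@open_comp _ _ (fun p : R * R => p.2)).
  by move=> p _; exact: cvg_snd.
exact: open_gt.
Qed.

Lemma meas_slab u K : continuous u -> meas2 (slab u K).
Proof.
move=> cu; apply: measurableI; last exact: meas_cell.
by apply: measurableI; [exact: meas_subgraph|exact: meas_above].
Qed.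

Lemma box_lty a b c d : (leb2 (`[a, b]%classic `*` `[c, d]%classic) < +oo)%E.
Proof.
rewrite product_measure1E; [|exact: mitv|exact: mitv].
by rewrite lte_mul_pinfty// ?leb_itv_lty// ge0_fin_numE ?leb_itv_lty.
Qed.

Lemma meas_box a b c d : meas2 (`[a, b]%classic `*` `[c, d]%classic : set (R * R)).
Proof. by apply: measurableX; exact: mitv. Qed.

Lemma compact_box a b c d : compact (`[a, b]%classic `*` `[c, d]%classic : set (R * R)).
Proof. by apply: compact_setX; exact: segment_compact. Qed.

Lemma compact_bnd (T : topologicalType) (A : set T) (h : T -> R) : compact A ->
  {within A, continuous h} -> exists B : R, forall p, A p -> `|h p| <= B.
Proof.
move=> cA ch; have /compact_bounded [B [_ HB]] := continuous_compact ch cA.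
exists (B + 1) => p Ap; apply: (HB (B + 1)); first by rewrite ltrDl.
by exists p.
Qed.

Lemma continuous_bnd (T : topologicalType) (A : set T) (h : T -> R) : compact A ->
  continuous h -> exists B : R, forall p, A p -> `|h p| <= B.
Proof. by move=> cA ch; apply: compact_bnd => //; exact: continuous_subspaceT. Qed.

Lemma compact_in_box (A : set (R * R)) : compact A ->
  exists B : R, A `<=` `[- B, B]%classic `*` `[- B, B]%classic.
Proof.
move=> cA; have c1 : continuous (fst : R * R -> R) by move=> p; exact: cvg_fst.
have c2 : continuous (snd : R * R -> R) by move=> p; exact: cvg_snd.
have [B1 H1] := continuous_bnd cA c1; have [B2 H2] := continuous_bnd cA c2.
exists (Num.max B1 B2) => p Ap; split; rewrite /= in_itv /= -ler_norml.
  by rewrite le_max H1.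
by rewrite le_max H2 ?orbT.
Qed.

Lemma meas_compact (A : set (R * R)) : compact A -> meas2 A.
Proof.
move=> cA; apply: closed2_measurable; apply: compact_closed => //.
Qed.

Lemma compact_lty (A : set (R * R)) : compact A -> (leb2 A < +oo)%E.
Proof.
move=> cA; have [B AB] := compact_in_box cA.
apply: le_lt_trans (box_lty (- B) B (- B) B); apply: le_measure => //.
- by rewrite inE; exact: meas_compact.
- by rewrite inE; exact: meas_box.
Qed.

Lemma ig_compact (A : set (R * R)) h : compact A -> continuous h -> ig leb2 A h.
Proof.
move=> cA ch; have [B HB] := continuous_bnd cA ch.
apply: (@ig_bounded _ _ _ _ _ _ B) => //; first exact: meas_compact.
- exact: compact_lty.
- exact: continuous2_measD.
Qed.

Section Slab.
Variables (u : R -> R) (M : R).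
Hypothesis cu : continuous u.
Hypothesis uM : forall x, `|u x| <= M.

Lemma slab_box K : slab u K `<=` circ `*` `[- K, M]%classic.
Proof.
move=> [x y] [[]]; rewrite /subgraph /cell /= => yu yK cx; split => //=.
by rewrite in_itv /= ltW//= (le_trans (ltW yu))// (le_trans (ler_norm _)).
Qed.

Lemma slab_lty K : (leb2 (slab u K) < +oo)%E.
Proof.
apply: le_lt_trans (box_lty 0 (2 * pi) (- K) M); apply: le_measure => //.
- by rewrite inE; exact: meas_slab.
- by rewrite inE; exact: meas_box.
- exact: slab_box.
Qed.

Lemma slab_bnd K h : continuous h -> exists B : R, forall p, slab u K p -> `|h p| <= B.
Proof.
move=> ch; have [B HB] := continuous_bnd (@compact_box 0 (2 * pi) (- K) M) ch.
by exists B => p /slab_box; exact: HB.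
Qed.

Lemma slab_sqi K h : continuous h -> sqi leb2 (slab u K) h.
Proof.
move=> ch; have [B HB] := slab_bnd K ch.
apply: (@sqi_bounded _ _ _ _ _ _ B) => //; first exact: meas_slab.
- exact: slab_lty.
- exact: continuous2_measD.
Qed.

Lemma slab_ig K h : continuous h -> ig leb2 (slab u K) h.
Proof.
move=> ch; have [B HB] := slab_bnd K ch.
apply: (@ig_bounded _ _ _ _ _ _ B) => //; first exact: meas_slab.
- exact: slab_lty.
- exact: continuous2_measD.
Qed.

Lemma continuous_col h x : continuous h -> continuous (fun y => h (x, y)).
Proof.
move=> ch y; apply: (@continuous_comp _ _ _ (fun y : R => (x, y)) h); last exact: ch.
exact: (cvg_pair (f := fun=> x) (g := fun y : R => y) (@cvg_cst _ _ _ _ _) cvg_id).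
Qed.

Lemma continuous_row h y : continuous h -> continuous (fun x => h (x, y)).
Proof.
move=> ch x; apply: (@continuous_comp _ _ _ (fun x : R => (x, y)) h); last exact: ch.
exact: (cvg_pair (f := fun x : R => x) (g := fun=> y) cvg_id (@cvg_cst _ _ _ _ _)).
Qed.

Lemma slab_fubini K h : continuous h ->
  ig leb circ (fun x => \int[leb]_(y in `[- K, u x]%classic) h (x, y)) /\
  \int[leb2]_(p in slab u K) h p =
  \int[leb]_(x in circ) \int[leb]_(y in `[- K, u x]%classic) h (x, y).
Proof.
move=> ch; have mS := meas_slab K cu.
have e : (fun x => \int[leb]_y (h \_ (slab u K)) (x, y)) =
    (fun x => \int[leb]_(y in `[- K, u x]%classic) h (x, y)) \_ circ.
  apply/funext => x; rewrite patchE; case: ifP => xA; last first.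
    rewrite (_ : \int[leb]_y _ = \int[leb]_(x in setT) (cst 0) x).
      by rewrite Rintegral_cst// mul0r.
    apply: eq_Rintegral => y _; rewrite patchE memNset// => -[_].
    by rewrite /cell /= => /mem_set; rewrite xA.
  have i1 : ig leb `[- K, u x]%classic (fun y => h (x, y)).
    by apply: continuous_ig; exact: continuous_col.
  have i2 : ig leb `[- K, u x[%classic (fun y => h (x, y)).
    apply: igS i1; [exact: mitv|exact: measurable_itv|].
    by apply: subset_itvl; rewrite bnd_simp.
  have i3 : ig leb `]- K, u x[%classic (fun y => h (x, y)).
    apply: igS i1; [exact: mitv|exact: measurable_itv|].
    by apply: subset_itv; rewrite bnd_simp.
  rewrite -(Rintegral_itv_bndo_bndc i2) -(Rintegral_itv_obnd_cbnd i3).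
  rewrite [RHS]Rintegral_mkcond; apply: eq_Rintegral => y _.
  rewrite !patchE; congr (if _ then _ else _); apply: asbool_equiv_eq.
  rewrite /slab /subgraph /cell /= in_itv /=; split.
    by move=> [[-> ->]].
  by move=> /andP[-> ->]; split => //; exact/set_mem.
have [] := fubini_x mS (slab_ig K ch); rewrite e => i1 ->; split.
  by apply: (integrable_mkcond _ mcirc).2; rewrite restrict_EFin.
by rewrite [RHS]Rintegral_mkcond.
Qed.

End Slab.
End PlaneSets.

(** * Trace and growth estimates for smooth functions *)

Section C1Estimates.
Context {R : realType}.
Local Notation leb := (@lebesgue_measure R).
Local Notation leb2 := (@lebesgue_measure R \x @lebesgue_measure R)%E.
Variables (u : R -> R) (M : R) (v : R * R -> R).
Hypothesis cu : continuous u.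
Hypothesis uM : forall x, `|u x| <= M.
Hypothesis C1v : C1_cyl v.

Let cv : continuous v. Proof. exact: C1_continuous. Qed.
Let cd1 : continuous (partial1 v). Proof. by case: C1v. Qed.
Let cd2 : continuous (partial2 v). Proof. by case: C1v. Qed.

Let M0 : 0 <= M. Proof. exact: le_trans (normr_ge0 _) (uM 0). Qed.
Let uge x : - M <= u x. Proof. by have := uM x; rewrite ler_norml => /andP[]. Qed.
Let ule x : u x <= M. Proof. by have := uM x; rewrite ler_norml => /andP[]. Qed.

Lemma col_derive (x y : R) :
  is_derive y (1 : R) (fun y : R => v (x, y)) (partial2 v (x, y)).
Proof. by apply: (@partial2P _ v (x, y)); case: C1v. Qed.

Lemma row_derive (x y : R) :
  is_derive x (1 : R) (fun x : R => v (x, y)) (partial1 v (x, y)).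
Proof. by apply: (@partial1P _ v (x, y)); case: C1v. Qed.

Lemma trace_continuous : continuous (fun x => v (x, u x)).
Proof.
move=> x; apply: (@continuous_comp _ _ _ (fun x : R => (x, u x)) v); last exact: cv.
have h1 : (fun x : R => x) @ x --> x by exact: cvg_id.
have h2 : u @ x --> u x by exact: cu.
exact: (cvg_pair h1 h2).
Qed.

Let q K x := \int[leb]_(y in `[- K, u x]%classic) (partial2 v (x, y) ^+ 2).
Let Q K := \int[leb2]_(p in slab u K) (partial2 v p ^+ 2).
Let P K := \int[leb2]_(p in slab u K) (partial1 v p ^+ 2).

Let csq1 : continuous (fun p => partial1 v p ^+ 2).
Proof. exact: continuous_sq cd1. Qed.
Let csq2 : continuous (fun p => partial2 v p ^+ 2).
Proof. exact: continuous_sq cd2. Qed.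

Let q_ig K : ig leb circ (q K).
Proof. by have [] := slab_fubini cu uM K csq2. Qed.

Let q_int K : \int[leb]_(x in circ) q K x = Q K.
Proof. by have [_ <-] := slab_fubini cu uM K csq2. Qed.

(** Fundamental theorem of calculus along a vertical segment, and
    Cauchy-Schwarz. *)
Lemma trace_col_le (x y K : R) : - K <= y <= - M ->
  (v (x, u x) - v (x, y)) ^+ 2 <= (M + K) * q K x.
Proof.
move=> /andP[Ky yM]; have yu : y <= u x by exact: le_trans (uge x).
have cc : continuous (fun y => partial2 v (x, y)) by exact: continuous_col.
apply: le_trans (diff_sq_le yu (col_derive x) cc) _.
apply: ler_pM => //.
- by rewrite subr_ge0.
- exact: Rint_sq_ge0.
- by have := ule x; lra.
- apply: Rint_le_set.
  + exact: mitv.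
  + exact: mitv.
  + by apply: subset_itvr; rewrite bnd_simp.
  + by apply: continuous_ig; exact: continuous_sq.
  + by move=> z _; exact: sqr_ge0.
Qed.

Lemma row_le (x y : R) : circ x -> (v (x, y) - v (0, y)) ^+ 2 <=
  2 * pi * \int[leb]_(x in circ) (partial1 v (x, y) ^+ 2).
Proof.
rewrite /circ /= in_itv /= => /andP[x0 xp].
have cc : continuous (fun x => partial1 v (x, y)) by exact: continuous_row.
apply: le_trans (diff_sq_le x0 (fun x => row_derive x y) cc) _.
apply: ler_pM => //.
- by rewrite subr0.
- exact: Rint_sq_ge0.
- by rewrite subr0.
- apply: Rint_le_set.
  + exact: mitv.
  + exact: mitv.
  + by apply: subset_itvl; rewrite bnd_simp.
  + by apply: continuous_ig; exact: continuous_sq.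
  + by move=> z _; exact: sqr_ge0.
Qed.

Definition trace_const := 2 * (2 * M + 3) + 2 * (2 * pi) ^+ 2.

(** The deviation of the trace from a constant is controlled by going straight
    down to a horizontal line below the graph, then along that line; averaging
    over the height of the line turns the second cost into an area integral. *)
Lemma C1_trace_poincare :
  \int[leb]_(x in circ)
    ((v (x, u x) - (2 * pi)^-1 * int_circ (fun x => v (x, u x))) ^+ 2) <=
  trace_const * (P (M + 3) + Q (M + 3)).
Proof.
set W := \int[leb]_(x in circ) _; set K := M + 3.
have mc := @mcirc R; have lc := circ_lty (R := R).
have qv : sqi leb circ (fun x => v (x, u x)).
  split; first exact: continuous_mfun1 trace_continuous.
  by apply: continuous_ig; apply: continuous_sq; exact: trace_continuous.
pose r y := \int[leb]_(x in circ) (partial1 v (x, y) ^+ 2).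
(* A horizontal line of height y below the graph: down each column, then along the line. *)
have line y : - M - 2 <= y <= - M - 1 ->
    W <= 2 * (2 * M + 3) * Q K + 2 * (2 * pi) ^+ 2 * r y.
  move=> /andP[y1 y2]; apply: le_trans (variance_le (v (0, y)) qv) _.
  apply: (@le_trans _ _ (\int[leb]_(x in circ)
      (2 * (2 * M + 3) * q K x + 2 * (2 * pi) * r y))).
    apply: le_Rintegral => //.
    - apply: continuous_ig; apply: continuous_sq => x.
      by apply: cvgB; [exact: trace_continuous|exact: cvg_cst].
    - by apply: igD => //; [exact: igZ|exact: ig_cst].
    - move=> x cx; have yK : - K <= y <= - M by rewrite /K; apply/andP; split; lra.
      have h1 := trace_col_le x yK; have h2 := row_le y cx.
      have := sqr_add_le (v (x, u x) - v (x, y)) (v (x, y) - v (0, y)).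
      rewrite subrKA => /le_trans; apply.
      have -> : 2 * (2 * M + 3) = 2 * (M + K) by rewrite /K; ring.
      apply: lerD; rewrite -[X in _ <= X]mulrA; apply: ler_wpM2l;
        [exact: ler0n|exact: h1|exact: ler0n|exact: h2].
  have e1 : \int[leb]_(x in circ) (2 * (2 * M + 3) * q K x) = 2 * (2 * M + 3) * Q K.
    by apply: etrans (RintegralZl _ mc (q_ig K)) _; congr (_ * _); exact: q_int.
  have e2 : \int[leb]_(x in circ) (2 * (2 * pi) * r y) = 2 * (2 * pi) * r y * (2 * pi).
    by apply: etrans (Rintegral_cst _ mc _) _; congr (_ * _); exact: circ_mass.
  have i1 : ig leb circ (fun x => 2 * (2 * M + 3) * q K x) by exact: igZ.
  have i2 : ig leb circ (fun=> 2 * (2 * pi) * r y) by exact: ig_cst.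
  rewrite le_eqVlt; apply/orP; left; apply/eqP.
  apply: etrans (RintegralD mc i1 i2) _; apply: etrans (congr2 +%R e1 e2) _; ring.
pose J : set R := `[- M - 2, - M - 1]%classic.
have mJ : meas1 J by exact: mitv.
have J1 : fine (leb J) = 1 by rewrite leb_itv; lra.
have Jfin : (leb J < +oo)%E by exact: leb_itv_lty.
have ibox : ig leb2 (circ `*` J) (fun p => partial1 v p ^+ 2).
  by apply: ig_compact; [exact: compact_box|exact: csq1].
have [ir er] := fubini_box_y mc mJ ibox.
(* Averaging over lines in a strip of height 1 turns their cost into an area integral. *)
have boxP : \int[leb]_(y in J) r y <= P K.
  rewrite -er; apply: Rint_le_set => //.
  - exact: meas_slab.
  - exact: meas_box.
  - move=> [x y] [/= cx]; rewrite /J /= in_itv /= => /andP[y1 y2].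
    split => //; split; rewrite /subgraph /= /K; have := uge x; lra.
  - exact: slab_ig uM _ _ csq1.
  - by move=> p _; exact: sqr_ge0.
have : \int[leb]_(y in J) W <=
    \int[leb]_(y in J) (2 * (2 * M + 3) * Q K + 2 * (2 * pi) ^+ 2 * r y).
  apply: le_Rintegral => //; first exact: ig_cst.
  - by apply: igD => //; [exact: ig_cst|exact: igZ].
rewrite Rintegral_cst// J1 mulr1 RintegralD//; [|exact: ig_cst|exact: igZ].
rewrite Rintegral_cst// J1 mulr1 RintegralZl// => /le_trans; apply.
have P0 : 0 <= P K by exact: Rint_sq_ge0.
have Q0 : 0 <= Q K by exact: Rint_sq_ge0.
have c1 : 0 <= 2 * (2 * M + 3) by have := M0; lra.
have c2 : 0 <= 2 * (2 * pi) ^+ 2 :> R by rewrite mulr_ge0// sqr_ge0.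
rewrite /trace_const mulrDl 2!mulrDr; have h := ler_wpM2l c2 boxP.
have h1 := mulr_ge0 c1 P0; have h2 := mulr_ge0 c2 Q0.
by move: h h1 h2; lra.
Qed.

(** Along vertical lines, finite energy lets a function grow at most like the
    square root of the depth. *)
Lemma C1_growth N : 0 < N ->
  \int[leb2]_(p in circ `*` `[- M - 2 * N, - M - N]%classic) (v p ^+ 2) <=
  N * (2 * \int[leb]_(x in circ) (v (x, u x) ^+ 2) +
       4 * (M + N) * Q (M + 2 * N)).
Proof.
move=> N0; set K := M + 2 * N; set J := `[_, _]%classic.
have mc := @mcirc R; have lc := circ_lty (R := R).
have mJ : meas1 J by exact: mitv.
have JN : fine (leb J) = N by rewrite leb_itv; lra.
have Jfin : (leb J < +oo)%E by exact: leb_itv_lty.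
have it : ig leb circ (fun x => v (x, u x) ^+ 2).
  by apply: continuous_ig; apply: continuous_sq; exact: trace_continuous.
have ibox : ig leb2 (circ `*` J) (fun p => v p ^+ 2).
  by apply: ig_compact; [exact: compact_box|exact: continuous_sq].
have [ir er] := fubini_box_y mc mJ ibox.
rewrite er; set B := 2 * _ + _.
apply: (@le_trans _ _ (\int[leb]_(y in J) B)); last first.
  by rewrite Rintegral_cst// JN mulrC.
apply: le_Rintegral => //; first exact: ig_cst.
move=> y; rewrite /J /= in_itv /= => /andP[y1 y2].
rewrite /B -q_int -!RintegralZl// -RintegralD//; [|exact: igZ|exact: igZ].
apply: le_Rintegral => //.
- by apply: continuous_ig; apply: continuous_sq; exact: continuous_row.
- by apply: igD => //; exact: igZ.
- move=> x cx; have yK : - K <= y <= - M by rewrite /K; apply/andP; split; lra.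
  have h1 := trace_col_le x yK.
  rewrite -sqrrN opprB in h1.
  have := sqr_add_le (v (x, u x)) (v (x, y) - v (x, u x)).
  rewrite subrKC => /le_trans; apply.
  have -> : 4 * (M + N) = 2 * (M + K) by rewrite /K; ring.
  by rewrite lerD2l -mulrA ler_wpM2l.
Qed.

End C1Estimates.

(** * Trace and growth estimates for functions of finite energy *)

(** Closes the arguments in which an error is only known to be smaller than a
    fixed multiple of any positive number. *)
Lemma le_eps (R : realFieldType) (x y C : R) : 0 <= C ->
  (forall e, 0 < e -> x <= y + C * e) -> x <= y.
Proof.
move=> C0 H; apply/ler_addgt0Pr => e e0.
have C1 : 0 < C + 1 by rewrite ltr_wpDl.
apply: le_trans (H (e / (C + 1)) _) _; first by rewrite divr_gt0.
by rewrite lerD2l mulrA ler_pdivrMr// mulrDr mulr1 mulrC lerDl ltW.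
Qed.

Section Trace.
Context {R : realType}.
Local Notation leb := (@lebesgue_measure R).
Local Notation leb2 := (@lebesgue_measure R \x @lebesgue_measure R)%E.
Variables (u : R -> R) (M : R).
Hypothesis cu : continuous u.
Hypothesis uM : forall x, `|u x| <= M.
Variables (phi d1 d2 : R * R -> R) (g : R -> R).
Hypothesis Hd : hdot1 u phi d1 d2.
Hypothesis Ht : has_trace u phi d1 d2 g.

Local Notation Omega := (subgraph u `&` cell).

Lemma meas_Omega : meas2 Omega.
Proof. by apply: measurableI; [exact: meas_subgraph|exact: meas_cell]. Qed.

Lemma slab_sub K : slab u K `<=` Omega.
Proof. by move=> p [[]]. Qed.

Lemma phi_meas : mfun2 (subgraph u) phi. Proof. by case: Hd => -[]. Qed.

Lemma L2_on_sqi v : L2_on (subgraph u) v -> sqi leb2 Omega v.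
Proof.
move=> [_ mv foo]; apply: sqi_lty => //; first exact: meas_Omega.
by apply: measurable_funS mv; [exact: meas_subgraph|exact: subIsetl].
Qed.

Lemma d1_sqi : sqi leb2 Omega d1.
Proof. by apply: L2_on_sqi; case: Hd. Qed.

Lemma d2_sqi : sqi leb2 Omega d2.
Proof. by apply: L2_on_sqi; case: Hd. Qed.

Lemma slab_sqiS K v : sqi leb2 Omega v -> sqi leb2 (slab u K) v.
Proof.
by apply: sqiS; [exact: meas_Omega|exact: meas_slab|exact: slab_sub].
Qed.

Lemma g_sqi : sqi leb circ g.
Proof. by case: Ht => -[_ mg fg] _; apply: sqi_lty => //; exact: mcirc. Qed.

Lemma small_sq d (T : measurableType d) (mu : {measure set T -> \bar R})
    (D : set T) (h : T -> R) (e : R) : measurable D -> measurable_fun D h ->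
  (\int[mu]_(x in D) ((h x) ^+ 2)%:E < e%:E)%E ->
  sqi mu D h /\ \int[mu]_(x in D) (h x ^+ 2) <= e.
Proof.
move=> mD mh he; have qh : sqi mu D h.
  by apply: sqi_lty => //; apply: lt_trans he _; rewrite ltry.
by split => //; move: he; rewrite sqi_EFin// lte_fin => /ltW.
Qed.

(** The estimates for smooth functions reach [phi] through the functions that
    define its trace; each estimate involves a single slab, so one approximant
    close on that slab is enough. *)
Lemma trace_approx K e : 0 < e -> exists v, [/\ C1_cyl v,
  sqi leb2 (slab u K) (fun p => v p - phi p) /\
    \int[leb2]_(p in slab u K) ((v p - phi p) ^+ 2) <= e,
  sqi leb2 (slab u K) (fun p => partial1 v p - d1 p) /\
    \int[leb2]_(p in slab u K) ((partial1 v p - d1 p) ^+ 2) <= e,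
  sqi leb2 (slab u K) (fun p => partial2 v p - d2 p) /\
    \int[leb2]_(p in slab u K) ((partial2 v p - d2 p) ^+ 2) <= e &
  sqi leb circ (fun x => v (x, u x) - g x) /\
    \int[leb]_(x in circ) ((v (x, u x) - g x) ^+ 2) <= e].
Proof.
move=> e0; have [_ [v_ [C1v Hv Hg]]] := Ht; have [c0 c1 c2] := Hv K.
have ee : (0 < e%:E :> \bar R)%E by rewrite lte_fin.
have mS := meas_slab K cu.
have /filter_ex[n [n0 n1 n2 n3]] : \forall n \near \oo, [/\
    (L2sq_on (subgraph u `&` [set p | (- K < p.2)%R]) (fun p => v_ n p - phi p)%R < e%:E)%E,
    (L2sq_on (subgraph u `&` [set p | (- K < p.2)%R]) (fun p => partial1 (v_ n) p - d1 p)%R < e%:E)%E,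
    (L2sq_on (subgraph u `&` [set p | (- K < p.2)%R]) (fun p => partial2 (v_ n) p - d2 p)%R < e%:E)%E &
    (L2sq_circ (fun x => v_ n (x, u x) - g x)%R < e%:E)%E].
  have h := open_ereal_lt' ee.
  near=> n; split; near: n; [exact: c0 h|exact: c1 h|exact: c2 h|exact: Hg h].
have C1n := C1v n; have cv := C1_continuous C1n.
have cp1 : continuous (partial1 (v_ n)) by case: C1n.
have cp2 : continuous (partial2 (v_ n)) by case: C1n.
exists (v_ n); split => //.
- apply: small_sq n0 => //; apply: measurable_funB; first exact: continuous2_measD.
  apply: measurable_funS phi_meas; first exact: meas_subgraph.
  by move=> p [[]].
- apply: small_sq n1 => //; apply: measurable_funB; first exact: continuous2_measD.
  exact: sqi_meas (slab_sqiS K d1_sqi).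
- apply: small_sq n2 => //; apply: measurable_funB; first exact: continuous2_measD.
  exact: sqi_meas (slab_sqiS K d2_sqi).
- apply: small_sq n3; first exact: mcirc.
  apply: measurable_funB; last exact: sqi_meas g_sqi.
  by apply: continuous_mfun1; exact: trace_continuous.
Unshelve. all: by end_near. Qed.

(** The definition of the homogeneous space gives only local integrability of
    [phi]; square integrability up to the boundary comes from the approximants
    of the trace. *)
Lemma phi_sqi K : sqi leb2 (slab u K) phi.
Proof.
have mS := meas_slab K cu.
have [v [/C1_continuous cv [q _] _ _ _]] := trace_approx K ltr01.
apply: eq_sqi (sqiB mS (slab_sqi cu uM K cv) q) => // p _.
by rewrite subKr.
Qed.

Lemma approx_le d (T : measurableType d) (mu : {measure set T -> \bar R})
    (D : set T) (h k : T -> R) (e : R) : measurable D -> sqi mu D k ->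
  sqi mu D (fun x => h x - k x) /\
    \int[mu]_(x in D) ((h x - k x) ^+ 2) <= e ->
  \int[mu]_(x in D) (h x ^+ 2) <= 2 * \int[mu]_(x in D) (k x ^+ 2) + 2 * e.
Proof.
move=> mD qk [qhk he]; have := Rint_sqD mD qhk qk.
rewrite (_ : \int[mu]_(x in D) _ = \int[mu]_(x in D) (h x ^+ 2)); last first.
  by apply: eq_Rintegral => x _; rewrite subrK.
move=> /le_trans; apply; rewrite addrC lerD2l ler_wpM2l//.
Qed.

Lemma trace_poincare :
  \int[leb]_(x in circ) ((g x - (2 * pi)^-1 * int_circ g) ^+ 2) <=
  4 * trace_const M * \int[leb2]_(p in Omega) (d1 p ^+ 2 + d2 p ^+ 2).
Proof.
have M0 : 0 <= M by exact: le_trans (normr_ge0 _) (uM 0).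
have C0 : 0 <= trace_const M.
  by rewrite /trace_const addr_ge0// mulr_ge0// ?sqr_ge0//; lra.
set K := M + 3; have mS := meas_slab K cu; have mO := meas_Omega.
have mc := @mcirc R; have lc := circ_lty (R := R).
set D1 := \int[leb2]_(p in slab u K) (d1 p ^+ 2).
set D2 := \int[leb2]_(p in slab u K) (d2 p ^+ 2).
have DE : D1 + D2 <= \int[leb2]_(p in Omega) (d1 p ^+ 2 + d2 p ^+ 2).
  have [_ i1] := d1_sqi; have [_ i2] := d2_sqi.
  rewrite RintegralD// lerD//; apply: Rint_le_set => //; do ?exact: slab_sub;
    by move=> p _; exact: sqr_ge0.
apply: (@le_trans _ _ (4 * trace_const M * (D1 + D2))); last first.
  by rewrite ler_wpM2l// mulr_ge0.
apply: (@le_eps _ _ _ (2 + 8 * trace_const M)); first by rewrite addr_ge0// mulr_ge0.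
move=> e e0; have [v [C1v _ a1 a2 [qg ag]]] := trace_approx K e0.
have h1 := approx_le mS (slab_sqiS K d1_sqi) a1.
have h2 := approx_le mS (slab_sqiS K d2_sqi) a2.
have hv := C1_trace_poincare cu uM C1v.
set m := (2 * pi)^-1 * int_circ (fun x => v (x, u x)) in hv.
apply: le_trans (variance_le m g_sqi) _.
have qm : sqi leb circ (fun x => v (x, u x) - m).
  apply: (@eq_sqi _ _ _ leb circ (fun x => (v (x, u x) - g x) + (g x - m))) => //.
    by move=> x _; rewrite subrKA.
  apply: sqiD => //; apply: sqiB => //; first exact: g_sqi.
  apply: (@sqi_bounded _ _ _ _ _ _ `|m|) => //; exact: measurable_cst.
have qg' : sqi leb circ (fun x => g x - v (x, u x)).
  apply: eq_sqi (sqiZ (-1) mc qg) => // x _; by rewrite mulN1r opprB.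
have := Rint_sqD mc qg' qm.
rewrite (_ : \int[leb]_(x in circ) _ = \int[leb]_(x in circ) ((g x - m) ^+ 2)); last first.
  by apply: eq_Rintegral => x _; rewrite subrKA.
move=> /le_trans; apply.
have ag' : \int[leb]_(x in circ) ((g x - v (x, u x)) ^+ 2) <= e.
  apply: le_trans ag; rewrite le_eqVlt; apply/orP; left; apply/eqP.
  by apply: eq_Rintegral => x _; rewrite -sqrrN opprB.
have h3 := ler_wpM2l C0 (lerD h1 h2).
apply: (@le_trans _ _ (2 * e + 2 * (trace_const M * (2 * D1 + 2 * e + (2 * D2 + 2 * e))))).
  by apply: lerD; rewrite ler_wpM2l// (le_trans hv).
by rewrite le_eqVlt; apply/orP; left; apply/eqP; ring.
Qed.

Lemma trace_growth N : 0 < N ->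
  \int[leb2]_(p in circ `*` `[- M - 2 * N, - M - N]%classic) (phi p ^+ 2) <=
  8 * N * \int[leb]_(x in circ) (g x ^+ 2) +
  16 * N * (M + N) * \int[leb2]_(p in Omega) (d2 p ^+ 2).
Proof.
move=> N0; have M0 : 0 <= M by exact: le_trans (normr_ge0 _) (uM 0).
set K := M + 2 * N + 1; set K' := M + 2 * N.
have mS := meas_slab K cu; have mS' := meas_slab K' cu; have mO := meas_Omega.
have mc := @mcirc R; have lc := circ_lty (R := R).
set Bx := _ `*` _; have mB : meas2 Bx by exact: meas_box.
have BS : Bx `<=` slab u K.
  move=> [x y] [/= cx]; rewrite in_itv /= => /andP[y1 y2].
  have : - M <= u x by have := uM x; rewrite ler_norml => /andP[].
  by split => //; split; rewrite /subgraph /= /K; lra.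
have S'S : slab u K' `<=` slab u K.
  move=> p [[p1 p2] pc]; split => //; split => //; move: p2; rewrite /= /K /K'; lra.
set E := \int[leb2]_(p in Omega) (d2 p ^+ 2).
set G := \int[leb]_(x in circ) (g x ^+ 2).
have E0 : 0 <= E by exact: Rint_sq_ge0.
apply: (@le_eps _ _ _ (2 + 8 * N + 16 * N * (M + N))).
  by rewrite !addr_ge0// ?mulr_ge0 ?addr_ge0 ?mulr_ge0// ltW.
move=> e e0; have [v [C1v [q0 a0] _ [q2 a2] ag]] := trace_approx K e0.
have hv := C1_growth cu uM C1v N0.
have h1 := approx_le mc g_sqi ag.
have a2' : \int[leb2]_(p in slab u K') ((partial2 v p - d2 p) ^+ 2) <= e.
  apply: le_trans a2; apply: Rint_le_set => //; first by case: q2.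
  by move=> p _; exact: sqr_ge0.
have h2 := approx_le mS' (slab_sqiS K' d2_sqi) (conj (sqiS mS mS' S'S q2) a2').
have h2' : \int[leb2]_(p in slab u K') (d2 p ^+ 2) <= E.
  apply: Rint_le_set => //; [exact: slab_sub|by case: d2_sqi|].
  by move=> p _; exact: sqr_ge0.
have a0' : \int[leb2]_(p in Bx) ((phi p - v p) ^+ 2) <= e.
  apply: le_trans a0.
  rewrite (_ : \int[leb2]_(p in Bx) _ = \int[leb2]_(p in Bx) ((v p - phi p) ^+ 2)); last first.
    by apply: eq_Rintegral => x _; rewrite -sqrrN opprB.
  apply: Rint_le_set => //; first by case: q0.
  by move=> p _; exact: sqr_ge0.
have qv : sqi leb2 Bx v.
  by apply: (sqiS mS mB BS); apply: (slab_sqi cu uM); exact: C1_continuous.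
have q0' : sqi leb2 Bx (fun p => phi p - v p).
  apply: eq_sqi (sqiZ (-1) mB (sqiS mS mB BS q0)) => // x _.
  by rewrite mulN1r opprB.
have := approx_le mB qv (conj q0' a0'); move=> /le_trans; apply.
have NM : 0 <= 4 * (M + N) by rewrite mulr_ge0// addr_ge0// ltW.
have h3 : \int[leb2]_(p in Bx) (v p ^+ 2) <=
    N * (2 * (2 * G + 2 * e) + 4 * (M + N) * (2 * E + 2 * e)).
  apply: le_trans hv _; rewrite ler_wpM2l ?(ltW N0)// lerD//.
    by rewrite ler_wpM2l.
  rewrite ler_wpM2l//; apply: le_trans h2 _.
  by rewrite lerD2r ler_wpM2l.
apply: (@le_trans _ _ (2 * (N * (2 * (2 * G + 2 * e) + 4 * (M + N) * (2 * E + 2 * e))) + 2 * e)).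
  by rewrite lerD2r ler_wpM2l.
by rewrite le_eqVlt; apply/orP; left; apply/eqP; ring.
Qed.

End Trace.

(** * Products with smooth functions in weak derivatives *)

Section C1Algebra.
Context {R : realType}.
Implicit Types (a b eta : R * R -> R) (psi chi : R -> R).

Lemma C1_mulE1 a b p : C1_cyl a -> C1_cyl b ->
  is_derive p.1 (1 : R) (fun x : R => a (x, p.2) * b (x, p.2))
    (a p * partial1 b p + partial1 a p * b p).
Proof.
case: p => x y; move=> [_ da _ _ _] [_ db _ _ _].
have h := is_deriveM (@partial1P _ a (x, y) (da (x, y))) (@partial1P _ b (x, y) (db (x, y))).
by apply: (is_derive_eq h); rewrite /GRing.scale /= (mulrC (b _)).
Qed.

Lemma C1_mulE2 a b p : C1_cyl a -> C1_cyl b ->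
  is_derive p.2 (1 : R) (fun y : R => a (p.1, y) * b (p.1, y))
    (a p * partial2 b p + partial2 a p * b p).
Proof.
case: p => x y; move=> [_ _ da _ _] [_ _ db _ _].
have h := is_deriveM (@partial2P _ a (x, y) (da (x, y))) (@partial2P _ b (x, y) (db (x, y))).
by apply: (is_derive_eq h); rewrite /GRing.scale /= (mulrC (b _)).
Qed.

Lemma partial1M a b : C1_cyl a -> C1_cyl b ->
  partial1 (fun p => a p * b p) = (fun p => a p * partial1 b p + partial1 a p * b p).
Proof.
move=> Ca Cb; apply/funext => p; rewrite /partial1 derive1E.
exact: (@derive_val _ _ _ _ _ _ _ (C1_mulE1 p Ca Cb)).
Qed.

Lemma partial2M a b : C1_cyl a -> C1_cyl b ->
  partial2 (fun p => a p * b p) = (fun p => a p * partial2 b p + partial2 a p * b p).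
Proof.
move=> Ca Cb; apply/funext => p; rewrite /partial2 derive1E.
exact: (@derive_val _ _ _ _ _ _ _ (C1_mulE2 p Ca Cb)).
Qed.

Lemma continuousMD (T : topologicalType) (f g h k : T -> R) : continuous f ->
  continuous g -> continuous h -> continuous k ->
  continuous (fun p => f p * g p + h p * k p).
Proof.
by move=> cf cg ch ck p; apply: cvgD; apply: cvgM; [exact: cf|exact: cg|exact: ch|exact: ck].
Qed.

Lemma continuousM2 (T : topologicalType) (f g : T -> R) : continuous f ->
  continuous g -> continuous (fun p => f p * g p).
Proof. by move=> cf cg p; apply: cvgM; [exact: cf|exact: cg]. Qed.

Lemma C1_mul a b : C1_cyl a -> C1_cyl b -> C1_cyl (fun p => a p * b p).
Proof.
move=> Ca Cb; have ca := C1_continuous Ca; have cb := C1_continuous Cb; split.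
- by move=> x y _; case: Ca => -> // *; case: Cb => -> //.
- by move=> p; have [] := C1_mulE1 p Ca Cb.
- by move=> p; have [] := C1_mulE2 p Ca Cb.
- rewrite partial1M//; apply: continuousMD => //; first by case: Cb.
  by case: Ca.
- rewrite partial2M//; apply: continuousMD => //; first by case: Cb.
  by case: Ca.
Qed.

Lemma C1_fst psi : test_circ psi -> C1_cyl (fun p : R * R => psi p.1).
Proof.
move=> [per d c]; split => //=.
- by move=> x y _ /=; exact: per.
- move=> p; apply: (@continuous_comp _ _ _ fst (derive1 psi)); last exact: c.
  exact: cvg_fst.
- rewrite (_ : partial2 _ = cst 0); first exact: cst_continuous.
  by apply/funext => p; rewrite /partial2 /= derive1_cst.
Qed.

Lemma partial1_fst psi p : partial1 (fun p : R * R => psi p.1) p = derive1 psi p.1.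
Proof. by []. Qed.

Lemma partial2_fst psi p : partial2 (fun p : R * R => psi p.1) p = 0.
Proof. by rewrite /partial2 /= derive1_cst. Qed.

Lemma C1_snd chi : (forall y : R, derivable chi y 1) -> continuous (derive1 chi) ->
  C1_cyl (fun p : R * R => chi p.2).
Proof.
move=> d c; split => //=.
- rewrite (_ : partial1 _ = cst 0); first exact: cst_continuous.
  by apply/funext => p; rewrite /partial1 /= derive1_cst.
- move=> p; apply: (@continuous_comp _ _ _ snd (derive1 chi)); last exact: c.
  exact: cvg_snd.
Qed.

Lemma partial2_snd chi p : partial2 (fun p : R * R => chi p.2) p = derive1 chi p.2.
Proof. by []. Qed.

Lemma partial1_snd chi p : partial1 (fun p : R * R => chi p.2) p = 0.
Proof. by rewrite /partial1 /= derive1_cst. Qed.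

Lemma C1_cst (c : R) : C1_cyl (fun=> c).
Proof.
split => //=.
- rewrite (_ : partial1 _ = cst 0); first exact: cst_continuous.
  by apply/funext => p; rewrite /partial1 /= derive1_cst.
- rewrite (_ : partial2 _ = cst 0); first exact: cst_continuous.
  by apply/funext => p; rewrite /partial2 /= derive1_cst.
Qed.

Lemma near_zero_derive1 (f : R -> R) (x : R) :
  (\forall z \near x, f z = 0) -> derive1 f x = 0.
Proof.
move=> H; rewrite derive1E.
have -> : 'D_1 f x = 'D_1 (cst 0 : R -> R) x.
  by apply: near_eq_derive => //; exact: H.
exact: derive_cst.
Qed.

Lemma partial1_off eta p : ~ closure [set q | eta q != 0] p -> partial1 eta p = 0.
Proof.
move=> np; apply: near_zero_derive1.
have : \forall q \near p, eta q = 0.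
  have /open_nbhs_nbhs : open_nbhs p (~` closure [set q | eta q != 0]).
    by split => //; apply: closed_openC; exact: closed_closure.
  by apply: filterS => q nq; apply: contra_notP nq => /eqP h; apply: subset_closure; exact: h.
case: p {np} => x y /=.
have ch : {for x, continuous (fun z : R => (z, y))}.
  exact: (cvg_pair (f := fun x : R => x) (g := fun=> y) cvg_id (@cvg_cst _ _ _ _ _)).
exact: ch.
Qed.

Lemma partial2_off eta p : ~ closure [set q | eta q != 0] p -> partial2 eta p = 0.
Proof.
move=> np; apply: near_zero_derive1.
have : \forall q \near p, eta q = 0.
  have /open_nbhs_nbhs : open_nbhs p (~` closure [set q | eta q != 0]).
    by split => //; apply: closed_openC; exact: closed_closure.
  by apply: filterS => q nq; apply: contra_notP nq => /eqP h; apply: subset_closure; exact: h.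
case: p {np} => x y /=.
have ch : {for y, continuous (fun z : R => (x, z))}.
  exact: (cvg_pair (f := fun=> x) (g := fun y : R => y) (@cvg_cst _ _ _ _ _) cvg_id).
exact: ch.
Qed.

Lemma test_mul U a eta : C1_cyl a -> test_on U eta -> test_on U (fun p => a p * eta p).
Proof.
move=> Ca [Ce cl [B HB]]; split; first exact: C1_mul.
- apply: subset_trans cl; apply: closureS => p /=; apply: contraNN => /eqP ->.
  by rewrite mulr0.
- exists B => p ne; apply: HB; move: ne; apply: contraNN => /eqP ->.
  by rewrite mulr0.
Qed.

End C1Algebra.

Section WeakProduct.
Context {R : realType}.
Implicit Types (a b eta v h : R * R -> R) (U A : set (R * R)).
Local Notation leb := (@lebesgue_measure R).
Local Notation leb2 := (@lebesgue_measure R \x @lebesgue_measure R)%E.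

Lemma test_support U eta : test_on U eta -> exists B, forall p,
  closure [set q | eta q != 0] p -> U p /\ `|p.2| <= B.
Proof.
move=> [_ cl [B HB]]; exists B => p cp; split; first exact: cl.
have : closure [set q : R * R | `|q.2| <= B] p by apply: closureS cp => q; exact: HB.
have cl' : closed [set q : R * R | `|q.2| <= B].
  rewrite (_ : [set q | _] = (fun q : R * R => `|q.2|) @^-1` [set z | z <= B])//.
  apply: closed_comp; last exact: closed_le.
  by move=> q _; apply: cvg_norm; exact: cvg_snd.
exact: cl'.
Qed.

(** The integrand lives on a compact part of [U], so it may be integrated over
    any domain that agrees with that part. *)
Lemma patch_support A A' h : (forall p, A p -> ~ A' p -> h p = 0) ->
  (forall p, A' p -> ~ A p -> h p = 0) -> h \_ A = h \_ A'.
Proof.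
move=> H H'; apply/funext => p; rewrite !patchE.
have [/set_mem Ap|/negP Ap] := boolP (p \in A);
  have [/set_mem A'p|/negP A'p] := boolP (p \in A') => //.
- by apply: H => //; rewrite inE in A'p.
- by apply/esym; apply: H' => //; rewrite inE in Ap.
Qed.

Lemma ig_support A A' h : meas2 A -> meas2 A' -> h \_ A = h \_ A' ->
  ig leb2 A h -> ig leb2 A' h.
Proof.
move=> mA mA' e i1; apply: (integrable_mkcond _ mA').2.
by have := (integrable_mkcond _ mA).1 i1; rewrite !restrict_EFin e.
Qed.

Lemma Rint_support A A' h : h \_ A = h \_ A' ->
  \int[leb2]_(p in A) h p = \int[leb2]_(p in A') h p.
Proof. by move=> e; rewrite Rintegral_mkcond e -Rintegral_mkcond. Qed.

(** Makes the constant 1 a function of finite energy with zero gradient, hence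
    any smooth function vanishing far below an admissible test function. *)
Lemma partial1_int0 U eta : test_on U eta -> int_on U (partial1 eta) = 0.
Proof.
move=> te; have [B HB] := test_support te; have [Ce _ _] := te.
have cp : continuous (partial1 eta) by case: Ce.
pose J : set R := `[- B, B]%classic.
rewrite /int_on (_ : \int[leb2]_(p in _) _ = \int[leb2]_(p in circ `*` J) partial1 eta p).
  have ib : ig leb2 (circ `*` J) (partial1 eta).
    by apply: ig_compact => //; exact: compact_box.
  have [_ ->] := fubini_box_y (@mcirc R) (mitv _ _) ib.
  rewrite (_ : \int[leb]_(y in _) _ = \int[leb]_(y in J) (cst 0) y).
    by rewrite Rintegral_cst ?mul0r//; exact: mitv.
  apply: eq_Rintegral => y _.
  have cr : continuous (fun x => partial1 eta (x, y)) by exact: continuous_row.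
  rewrite (ftc_C1 (ltW (@pi2_gt0 R)) (fun x => row_derive Ce x y) cr).
  by case: Ce => /(_ 0 y I); rewrite add0r => -> *; rewrite subrr.
apply: Rint_support; apply: patch_support => p.
- move=> [Up cp']; move=> np; apply: partial1_off => /HB[_ pB]; apply: np.
  by split => //; rewrite /J /= in_itv /= -ler_norml.
- move=> [p1 _] np; apply: partial1_off => /HB[Up _]; apply: np.
  by split.
Qed.

Lemma partial2_int0 U eta : test_on U eta -> int_on U (partial2 eta) = 0.
Proof.
move=> te; have [B HB] := test_support te; have [Ce _ _] := te.
have cp : continuous (partial2 eta) by case: Ce.
pose J : set R := `[- (`|B| + 1), `|B| + 1]%classic.
have B1 : - (`|B| + 1) <= `|B| + 1 by have := normr_ge0 B; lra.
have eta0 p : `|B| < `|p.2| -> eta p = 0.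
  move=> pB; apply: contrapT => /eqP ne.
  have /HB[_ pB'] : closure [set q | eta q != 0] p by apply: subset_closure.
  by have := le_lt_trans (le_trans pB' (ler_norm B)) pB; rewrite ltxx.
rewrite /int_on (_ : \int[leb2]_(p in _) _ = \int[leb2]_(p in circ `*` J) partial2 eta p).
  have ib : ig leb2 (circ `*` J) (partial2 eta).
    by apply: ig_compact => //; exact: compact_box.
  have [_ ->] := fubini_box_x (@mcirc R) (mitv _ _) ib.
  rewrite (_ : \int[leb]_(x in _) _ = \int[leb]_(y in circ) (cst 0) y).
    by rewrite Rintegral_cst ?mul0r//; exact: mcirc.
  apply: eq_Rintegral => x _.
  have cc : continuous (fun y => partial2 eta (x, y)) by exact: continuous_col.
  rewrite (ftc_C1 B1 (fun y => col_derive Ce x y) cc).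
  have e z : `|B| < `|z| -> eta (x, z) = 0 by exact: (eta0 (x, z)).
  have hb : `|B| < Num.norm (`|B| + 1) by rewrite [X in _ < X]ger0_norm ?addr_ge0// ltrDl.
  by rewrite !e ?subrr ?normrN.
apply: Rint_support; apply: patch_support => p.
- move=> [Up cp']; move=> np; apply: partial2_off => /HB[_ pB]; apply: np.
  split => //; rewrite /J /= in_itv /= -ler_norml (le_trans pB)//.
  by rewrite (le_trans (ler_norm B))// lerDl.
- move=> [p1 _] np; apply: partial2_off => /HB[Up _]; apply: np.
  by split.
Qed.

Section Leibniz.
Variables (U : set (R * R)) (mU : meas2 U).
Variables (phi d : R * R -> R) (a : R * R -> R).
Hypothesis Ca : C1_cyl a.
Hypothesis phi_loc : forall K, compact K -> K `<=` U `&` cell -> ig leb2 K phi.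
Hypothesis d_loc : forall K, compact K -> K `<=` U `&` cell -> ig leb2 K d.

Let mUc : meas2 (U `&` cell).
Proof. by apply: measurableI => //; exact: meas_cell. Qed.

Lemma ig_test_product eta v h : test_on U eta ->
  (forall K, compact K -> K `<=` U `&` cell -> ig leb2 K v) ->
  continuous h -> (forall p, ~ closure [set q | eta q != 0] p -> h p = 0) ->
  ig leb2 (U `&` cell) (fun p => v p * h p).
Proof.
move=> te vloc ch hs; have [B HB] := test_support te.
pose K := closure [set q | eta q != 0] `&` (circ `*` `[- B, B]%classic).
have cK : compact K.
  rewrite /K setIC; apply: compact_closedI; first exact: compact_box.
  exact: closed_closure.
have KU : K `<=` U `&` cell by move=> p [/HB[Up _] [pc _]]; split.
have mK : meas2 K by exact: meas_compact.
have i1 := vloc K cK KU.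
have [C HC] := continuous_bnd cK ch.
have i2 : ig leb2 K (fun p => v p * h p).
  have := igM_bounded mK (continuous2_measD (D := K) ch) HC i1.
  by apply: eq_ig => // p _; exact: mulrC.
apply: ig_support i2 => //; apply: patch_support => p.
- by move=> /KU.
- move=> [Up pc] nK; rewrite hs ?mulr0// => cp; apply: nK; split => //.
  have [_ pB] := HB p cp; split => //.
  by rewrite /= in_itv /= -ler_norml.
Qed.

Lemma off_mull eta b (D : R * R -> R) p :
  (forall p, ~ closure [set q | eta q != 0] p -> D p = 0) ->
  ~ closure [set q | eta q != 0] p -> b p * D p = 0.
Proof. by move=> H /H ->; rewrite mulr0. Qed.

Lemma off_self eta p : ~ closure [set q | eta q != 0] p -> eta p = 0.
Proof. by move=> np; apply: contrapT => /eqP h; apply: np; exact: subset_closure. Qed.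

(** For a test function [eta], the product [a eta] is a test function too;
    moving the term with the derivative of [a] across is legitimate since each
    integrand is integrable on the compact support of [eta]. *)
Lemma leibniz_int eta (Da De : R * R -> R) :
  test_on U eta -> continuous Da -> continuous De ->
  (forall p, ~ closure [set q | eta q != 0] p -> De p = 0) ->
  int_on U (fun p => phi p * (a p * De p + Da p * eta p)) =
    - int_on U (fun p => d p * (a p * eta p)) ->
  int_on U (fun p => a p * phi p * De p) =
    - int_on U (fun p => (a p * d p + Da p * phi p) * eta p).
Proof.
move=> te cDa cDe sDe; have [Ce _ _] := te.
have ca := C1_continuous Ca; have ce := C1_continuous Ce.
have i1 : ig leb2 (U `&` cell) (fun p => phi p * (a p * De p)).
  apply: (@ig_test_product eta) => //; first exact: continuousM2.
  by move=> p; exact: off_mull.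
have i2 : ig leb2 (U `&` cell) (fun p => phi p * (Da p * eta p)).
  apply: (@ig_test_product eta) => //; first exact: continuousM2.
  by move=> p; apply: off_mull; exact: off_self.
have i3 : ig leb2 (U `&` cell) (fun p => d p * (a p * eta p)).
  apply: (@ig_test_product eta) => //; first exact: continuousM2.
  by move=> p; apply: off_mull; exact: off_self.
rewrite /int_on.
rewrite (_ : \int[leb2]_(p in _) (phi p * _) = \int[leb2]_(p in U `&` cell)
   (phi p * (a p * De p) + phi p * (Da p * eta p))); last first.
  by apply: eq_Rintegral => p _; rewrite mulrDr.
rewrite RintegralD// => H.
rewrite (_ : \int[leb2]_(p in _) (a p * phi p * _) = \int[leb2]_(p in U `&` cell)
   (phi p * (a p * De p))); last first.
  by apply: eq_Rintegral => p _; rewrite mulrCA mulrA.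
rewrite (_ : \int[leb2]_(p in _) ((a p * d p + _) * _) = \int[leb2]_(p in U `&` cell)
   (d p * (a p * eta p) + phi p * (Da p * eta p))); last first.
  by apply: eq_Rintegral => p _; ring.
by rewrite RintegralD// opprD -H addrK.
Qed.

Lemma weak_partial1_mul : is_weak_partial1 U phi d ->
  is_weak_partial1 U (fun p => a p * phi p) (fun p => a p * d p + partial1 a p * phi p).
Proof.
move=> H eta te; have [Ce _ _] := te; apply: leibniz_int => //.
- by case: Ca.
- by case: Ce.
- by move=> p; exact: partial1_off.
- by rewrite -(H _ (test_mul Ca te)) partial1M.
Qed.

Lemma weak_partial2_mul : is_weak_partial2 U phi d ->
  is_weak_partial2 U (fun p => a p * phi p) (fun p => a p * d p + partial2 a p * phi p).
Proof.
move=> H eta te; have [Ce _ _] := te; apply: leibniz_int => //.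
- by case: Ca.
- by case: Ce.
- by move=> p; exact: partial2_off.
- by rewrite -(H _ (test_mul Ca te)) partial2M.
Qed.

End Leibniz.
End WeakProduct.

(** * Cutting off far below the graph *)

Section ExtendedLimits.
Context {R : realType}.

Lemma cvge0P (X : nat -> \bar R) : (forall n, 0 <= X n)%E ->
  (forall e : R, 0 < e -> \forall n \near \oo, (X n <= e%:E)%E) ->
  X @ \oo --> 0%E.
Proof.
move=> X0 H; have fX : \forall n \near \oo, X n \is a fin_num.
  have := H 1 ltr01; apply: filterS => n h.
  by rewrite ge0_fin_numE// (le_lt_trans h)// ltry.
apply/fine_cvgP; split => //; apply/cvgrPdist_le => e e0.
near=> n; rewrite sub0r normrN ger0_norm ?fine_ge0//.
rewrite -lee_fin fineK; last by near: n.
by near: n; exact: H.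
Unshelve. all: by end_near. Qed.

Lemma cvge0_lt (X : nat -> \bar R) (e : R) : 0 < e -> X @ \oo --> 0%E ->
  \forall n \near \oo, (X n < e%:E)%E.
Proof.
move=> e0 cX; have ee : (0 < e%:E :> \bar R)%E by rewrite lte_fin.
exact: cX (open_ereal_lt' ee).
Qed.

End ExtendedLimits.

Section CutOff.
Context {R : realType}.
Local Notation leb := (@lebesgue_measure R).
Local Notation leb2 := (@lebesgue_measure R \x @lebesgue_measure R)%E.

Lemma partial1_periodic (a : R * R -> R) x y : xperiodic setT a ->
  partial1 a (x + 2 * pi, y) = partial1 a (x, y).
Proof.
move=> per; rewrite /partial1 /derive1 /=.
rewrite (_ : (fun h : R => h^-1 *: (a (h + (x + 2 * pi), y) - a (x + 2 * pi, y))) =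
  (fun h : R => h^-1 *: (a (h + x, y) - a (x, y))))//.
by apply/funext => h; rewrite addrA !per.
Qed.

Lemma partial2_periodic (a : R * R -> R) x y : xperiodic setT a ->
  partial2 a (x + 2 * pi, y) = partial2 a (x, y).
Proof.
move=> per; rewrite /partial2 /=.
rewrite (_ : (fun z : R => a (x + 2 * pi, z)) = (fun z : R => a (x, z)))//.
by apply/funext => z; rewrite per.
Qed.

Lemma Rint_sqM_bounded d (T : measurableType d) (mu : {measure set T -> \bar R})
    (D : set T) (a h : T -> R) (B : R) : measurable D -> measurable_fun D a ->
  (forall p, D p -> `|a p| <= B) -> sqi mu D h ->
  \int[mu]_(p in D) ((a p * h p) ^+ 2) <= B ^+ 2 * \int[mu]_(p in D) (h p ^+ 2).
Proof.
move=> mD ma aB qh; have [_ ih] := qh; have [_ i2] := sqiM_bounded mD ma aB qh.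
rewrite -RintegralZl//; apply: le_Rintegral => //; first exact: igZ.
move=> p Dp; rewrite exprMn ler_wpM2r ?sqr_ge0// -[a p ^+ 2]real_normK ?num_real//.
by rewrite ler_sqr ?nnegrE ?aB// (le_trans _ (aB p Dp)).
Qed.

Variables (u : R -> R) (M : R).
Hypothesis cu : continuous u.
Hypothesis uM : forall x, `|u x| <= M.
Hypothesis pu : periodic u.
Variables (phi d1 d2 : R * R -> R) (g : R -> R).
Hypothesis Hd : hdot1 u phi d1 d2.
Hypothesis Ht : has_trace u phi d1 d2 g.
Variables (a : R * R -> R) (K0 : R).
Hypothesis Ca : C1_cyl a.
Hypothesis a0 : forall p, p.2 <= - K0 -> a p = 0.

Local Notation Omega := (subgraph u `&` cell).
Let w p := a p * phi p.
Let w1 p := a p * d1 p + partial1 a p * phi p.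
Let w2 p := a p * d2 p + partial2 a p * phi p.

Let ca : continuous a. Proof. exact: C1_continuous. Qed.
Let ca1 : continuous (partial1 a). Proof. by case: Ca. Qed.
Let ca2 : continuous (partial2 a). Proof. by case: Ca. Qed.
Let pa : xperiodic setT a. Proof. by case: Ca. Qed.
Let mU : meas2 (subgraph u). Proof. exact: meas_subgraph. Qed.
Let mO : meas2 Omega. Proof. exact: meas_Omega. Qed.
Let mS K : meas2 (slab u K). Proof. exact: meas_slab. Qed.

Let off_closure p : p.2 < - K0 -> ~ closure [set q | a q != 0] p.
Proof.
move=> pK cp; have : [set q : R * R | - K0 <= q.2] p.
  have cl : closed [set q : R * R | - K0 <= q.2].
    rewrite (_ : [set q | _] = (fun q : R * R => q.2) @^-1` [set z | - K0 <= z])//.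
    apply: closed_comp; last exact: closed_ge.
    by move=> q _; exact: cvg_snd.
  have : closure [set q : R * R | - K0 <= q.2] p.
    apply: closureS cp => q /= aq.
    by rewrite leNgt; apply: contraNN aq => /ltW /a0 ->.
  exact: cl.
by rewrite /= leNgt pK.
Qed.

Let a1_0 p : p.2 < - K0 -> partial1 a p = 0.
Proof. by move=> /off_closure; exact: partial1_off. Qed.

Let a2_0 p : p.2 < - K0 -> partial2 a p = 0.
Proof. by move=> /off_closure; exact: partial2_off. Qed.

Let K1 := K0 + 1.

Lemma off_slab p : Omega p -> ~ slab u K1 p -> p.2 < - K0.
Proof.
move=> [Up cp] np; rewrite ltNge; apply/negP => h; apply: np; split => //.
split => //=; rewrite /K1; apply: lt_le_trans h; lra.
Qed.

Lemma sqi_extend (v : R * R -> R) : mfun2 Omega v -> sqi leb2 (slab u K1) v ->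
  (forall p, p.2 < - K0 -> v p = 0) -> sqi leb2 Omega v.
Proof.
move=> mv [_ i2] v0; split => //; apply: ig_support i2 => //.
apply: patch_support => p; first by move=> /slab_sub.
by move=> Op np; rewrite v0 ?expr0n//; exact: off_slab.
Qed.

Let mphi : mfun2 (subgraph u) phi. Proof. exact: phi_meas Hd. Qed.
Let md1 : mfun2 (subgraph u) d1. Proof. by case: Hd => _ _ _ []. Qed.
Let md2 : mfun2 (subgraph u) d2. Proof. by case: Hd => _ _ _ _ []. Qed.

Let q_phi K : sqi leb2 (slab u K) phi. Proof. exact: phi_sqi Hd Ht K. Qed.
Let q_d1 K : sqi leb2 (slab u K) d1.
Proof. by apply: (slab_sqiS cu); exact: d1_sqi Hd. Qed.
Let q_d2 K : sqi leb2 (slab u K) d2.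
Proof. by apply: (slab_sqiS cu); exact: d2_sqi Hd. Qed.

Lemma slab_sqiM K (h v : R * R -> R) : continuous h -> sqi leb2 (slab u K) v ->
  sqi leb2 (slab u K) (fun p => h p * v p).
Proof.
move=> ch qv; have [B HB] := slab_bnd uM K ch.
exact: (sqiM_bounded (mS K) (continuous2_measD ch) HB qv).
Qed.

Lemma L2_on_product (h k v z : R * R -> R) :
  continuous h -> continuous k -> mfun2 (subgraph u) v -> mfun2 (subgraph u) z ->
  (forall p, p.2 < - K0 -> h p = 0) -> (forall p, p.2 < - K0 -> k p = 0) ->
  sqi leb2 (slab u K1) v -> sqi leb2 (slab u K1) z ->
  mfun2 (subgraph u) (fun p => h p * v p + k p * z p) /\
  (L2sq_on (subgraph u) (fun p => (h p * v p + k p * z p)%R) < +oo)%E.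
Proof.
move=> ch ck mv mz h0 k0 qv qz.
have mw : mfun2 (subgraph u) (fun p => h p * v p + k p * z p).
  by apply: measurable_funD; apply: measurable_funM => //; exact: continuous2_measD.
split => //; rewrite /L2sq_on sqi_EFin ?ltry//.
apply: sqi_extend.
- by apply: measurable_funS mw => //; exact: subIsetl.
- by apply: sqiD => //; exact: slab_sqiM.
- by move=> p pK; rewrite h0// k0// !mul0r addr0.
Qed.

Let phi_loc K : compact K -> K `<=` Omega -> ig leb2 K phi.
Proof.
move=> cK KO; case: Hd => -[_ _ H] _ _ _ _; apply: H => //.
by apply: subset_trans KO _; exact: subIsetl.
Qed.

Let sqi_loc v K : sqi leb2 Omega v -> compact K -> K `<=` Omega -> ig leb2 K v.
Proof.
move=> qv cK KO; have mK := meas_compact cK.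
by apply: sqi_ig => //; [exact: compact_lty|exact: (sqiS mO mK KO qv)].
Qed.

(** Above the depth where [a] vanishes the function [phi] is square integrable,
    so the product has finite full norm, not only finite energy. *)
Lemma cut_h1 : h1 u w w1 w2.
Proof.
have [[pphi _ phiK] wp1 wp2 [pd1 _ _] [pd2 _ _]] := Hd.
have nK0 p : p.2 < - K0 -> a p = 0 by move=> /ltW /a0.
have [m1 L1] := L2_on_product ca ca1 md1 mphi nK0 a1_0 (q_d1 K1) (q_phi K1).
have [m2 L2] := L2_on_product ca ca2 md2 mphi nK0 a2_0 (q_d2 K1) (q_phi K1).
have mw : mfun2 (subgraph u) w.
  by apply: measurable_funM => //; exact: continuous2_measD.
have pw : xperiodic (subgraph u) w.
  by move=> x y Uxy; rewrite /w pa// pphi.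
split; first split.
- split => // K cK KU; have mK := meas_compact cK.
  have [B HB] := continuous_bnd cK ca.
  exact: (igM_bounded mK (continuous2_measD ca) HB (phiK K cK KU)).
- by apply: weak_partial1_mul => // K; apply: sqi_loc; exact: d1_sqi Hd.
- by apply: weak_partial2_mul => // K; apply: sqi_loc; exact: d2_sqi Hd.
- split; [|exact: m1|exact: L1].
  move=> x y Uxy; rewrite /w1 (pa I) (pd1 _ _ Uxy) (pphi _ _ Uxy).
  by rewrite (partial1_periodic x y pa).
- split; [|exact: m2|exact: L2].
  move=> x y Uxy; rewrite /w2 (pa I) (pd2 _ _ Uxy) (pphi _ _ Uxy).
  by rewrite (partial2_periodic x y pa).
- split; [exact: pw|exact: mw|].
  rewrite /L2sq_on sqi_EFin; [exact: ltry|exact: mO|]; apply: sqi_extend.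
  + by apply: measurable_funS mw => //; exact: subIsetl.
  + exact: slab_sqiM.
  + by move=> p pK; rewrite /w nK0// mul0r.
Qed.

Let q_g : sqi leb circ g. Proof. exact: g_sqi Ht. Qed.

Let ctr : continuous (fun x => a (x, u x)). Proof. exact: trace_continuous. Qed.

(** Products with [a] of the approximants of [phi] approximate the product,
    because [a] and its derivatives are bounded on each slab. *)
Lemma cut_trace : has_trace u w w1 w2 (fun x => a (x, u x) * g x).
Proof.
have mc := @mcirc R; have [[pg mg _] [v_ [C1v Hv Hg]]] := Ht.
have [Bt HBt] := continuous_bnd (segment_compact (a := 0) (b := 2 * pi)) ctr.
split.
  split; first by move=> x; rewrite pg pu pa.
    by apply: measurable_funM => //; exact: continuous_mfun1.
  rewrite /L2sq_circ sqi_EFin ?ltry//.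
  exact: (sqiM_bounded mc (continuous_mfun1 ctr) HBt q_g).
exists (fun n p => a p * v_ n p); split.
- by move=> n; exact: C1_mul.
- move=> K /=; have [c0 c1 c2] := Hv K.
  have [B0 HB0] := slab_bnd uM K ca.
  have [B1 HB1] := slab_bnd uM K ca1.
  have [B2 HB2] := slab_bnd uM K ca2.
  have qv n : sqi leb2 (slab u K) (fun p => v_ n p - phi p).
    by apply: sqiB => //; apply: (slab_sqi cu uM); exact: C1_continuous.
  have qv1 n : sqi leb2 (slab u K) (fun p => partial1 (v_ n) p - d1 p).
    by apply: sqiB => //; apply: (slab_sqi cu uM); case: (C1v n).
  have qv2 n : sqi leb2 (slab u K) (fun p => partial2 (v_ n) p - d2 p).
    by apply: sqiB => //; apply: (slab_sqi cu uM); case: (C1v n).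
  have key (h k : R * R -> R) (Bh Bk : R) (y z : nat -> R * R -> R) :
      continuous h -> continuous k ->
      (forall p, slab u K p -> `|h p| <= Bh) ->
      (forall p, slab u K p -> `|k p| <= Bk) ->
      (forall n, sqi leb2 (slab u K) (y n)) -> (forall n, sqi leb2 (slab u K) (z n)) ->
      L2sq_on (subgraph u `&` [set p | - K < p.2]) (y n) @[n --> \oo] --> 0%E ->
      L2sq_on (subgraph u `&` [set p | - K < p.2]) (z n) @[n --> \oo] --> 0%E ->
      L2sq_on (subgraph u `&` [set p | - K < p.2])
        (fun p => h p * y n p + k p * z n p) @[n --> \oo] --> 0%E.
    move=> ch ck hB kB qy qz cy cz; apply: cvge0P.
      by move=> n; apply: integral_ge0 => p _; rewrite lee_fin sqr_ge0.
    move=> e e0; pose C := 2 * Bh ^+ 2 + 2 * Bk ^+ 2 + 1.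
    have C0 : 0 < C by rewrite ltr_wpDl// addr_ge0// mulr_ge0// sqr_ge0.
    have eC : 0 < e / C by rewrite divr_gt0.
    near=> n.
    have /ltW hy : (L2sq_on (subgraph u `&` [set p | (- K < p.2)%R]) (y n) < (e / C)%:E)%E.
      by near: n; exact: cvge0_lt.
    have /ltW hz : (L2sq_on (subgraph u `&` [set p | (- K < p.2)%R]) (z n) < (e / C)%:E)%E.
      by near: n; exact: cvge0_lt.
    have qyz := sqiD (mS K) (slab_sqiM ch (qy n)) (slab_sqiM ck (qz n)).
    rewrite /L2sq_on (sqi_EFin (mS K) qyz).
    rewrite /L2sq_on (sqi_EFin (mS K) (qy n)) in hy.
    rewrite /L2sq_on (sqi_EFin (mS K) (qz n)) in hz.
    move: hy hz.
    rewrite !lee_fin => hy hz.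
    apply: le_trans (Rint_sqD (mS K) (slab_sqiM ch (qy n)) (slab_sqiM ck (qz n))) _.
    have s1 := Rint_sqM_bounded (mS K) (continuous2_measD ch) hB (qy n).
    have s2 := Rint_sqM_bounded (mS K) (continuous2_measD ck) kB (qz n).
    have s1' := le_trans s1 (ler_wpM2l (sqr_ge0 Bh) hy).
    have s2' := le_trans s2 (ler_wpM2l (sqr_ge0 Bk) hz).
    apply: le_trans (lerD (ler_wpM2l (ler0n _ 2) s1') (ler_wpM2l (ler0n _ 2) s2')) _.
    rewrite (_ : _ + _ = (2 * Bh ^+ 2 + 2 * Bk ^+ 2) * (e / C)); last by ring.
    by rewrite mulrCA ler_piMr ?(ltW e0)// ler_pdivrMr// mul1r lerDl.
  split.
  + rewrite (_ : (fun n => _) = (fun n => L2sq_on (subgraph u `&` [set p | - K < p.2])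
        (fun p => a p * (v_ n p - phi p) + 0 * (v_ n p - phi p)))); last first.
      apply/funext => n; congr L2sq_on; apply/funext => p; rewrite /w; ring.
    by apply: (@key a (cst 0) B0 0) => //; [exact: cst_continuous|move=> p _; rewrite normr0].
  + rewrite (_ : (fun n => _) = (fun n => L2sq_on (subgraph u `&` [set p | - K < p.2])
        (fun p => a p * (partial1 (v_ n) p - d1 p) + partial1 a p * (v_ n p - phi p)))); last first.
      apply/funext => n; congr L2sq_on; apply/funext => p; rewrite /w1 partial1M//; ring.
    exact: (@key a (partial1 a) B0 B1).
  + rewrite (_ : (fun n => _) = (fun n => L2sq_on (subgraph u `&` [set p | - K < p.2])
        (fun p => a p * (partial2 (v_ n) p - d2 p) + partial2 a p * (v_ n p - phi p)))); last first.
      apply/funext => n; congr L2sq_on; apply/funext => p; rewrite /w2 partial2M//; ring.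
    exact: (@key a (partial2 a) B0 B2).
- apply: cvge0P.
    by move=> n; apply: integral_ge0 => p _; rewrite lee_fin sqr_ge0.
  move=> e e0; pose C := Bt ^+ 2 + 1.
  have C0 : 0 < C by rewrite ltr_wpDl// sqr_ge0.
  have eC : 0 < e / C by rewrite divr_gt0.
  have qt n : sqi leb circ (fun x => v_ n (x, u x) - g x).
    apply: sqiB => //.
    have ct : continuous (fun x => v_ n (x, u x)) by exact: trace_continuous.
    split; first exact: continuous_mfun1.
    by apply: continuous_ig; exact: continuous_sq.
  near=> n.
  have /ltW hy : (L2sq_circ (fun x => v_ n (x, u x) - g x)%R < (e / C)%:E)%E.
    by near: n; exact: cvge0_lt.
  have e2 : L2sq_circ (fun x => a (x, u x) * v_ n (x, u x) - a (x, u x) * g x) =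
      (\int[leb]_(x in circ) ((a (x, u x) * (v_ n (x, u x) - g x)) ^+ 2)%:E)%E.
    by apply: eq_integral => x _; rewrite mulrBr.
  rewrite e2 sqi_EFin//; last exact: (sqiM_bounded mc (continuous_mfun1 ctr) HBt (qt n)).
  move: hy; rewrite /L2sq_circ sqi_EFin// !lee_fin => hy.
  apply: le_trans (Rint_sqM_bounded mc (continuous_mfun1 ctr) HBt (qt n)) _.
  apply: le_trans (ler_wpM2l (sqr_ge0 Bt) hy) _.
  by rewrite mulrCA ler_piMr ?(ltW e0)// ler_pdivrMr// mul1r lerDl.
Unshelve. all: by end_near. Qed.

End CutOff.

Section Cut.
Context {R : realType}.
Local Notation leb := (@lebesgue_measure R).
Local Notation leb2 := (@lebesgue_measure R \x @lebesgue_measure R)%E.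

(** Equal to 1 above depth [M + N] and to 0 below depth [M + 2 N], so its slope
    is of order [1 / N]: the graph of a function bounded by [M] lies where the
    cut-off is 1. *)
Definition cut (M N : R) (y : R) : R := step ((y + (M + 2 * N)) / N).

Section CutProps.
Variables (M N : R).
Hypothesis N0 : 0 < N.

Lemma cut_derive y :
  is_derive y (1 : R) (cut M N) (tent ((y + (M + 2 * N)) / N) / N).
Proof.
have h1 : is_derive y (1 : R) (fun y => (y + (M + 2 * N)) / N) N^-1.
  by apply: is_derive_eq; rewrite /GRing.scale /= addr0 mulr1 ?mulr0 ?add0r ?addr0.
have h2 := is_derive_step ((y + (M + 2 * N)) / N).
have h3 := @is_derive1_comp R step (fun y => (y + (M + 2 * N)) / N) y _ _ h2 h1.
by apply: (is_derive_eq h3).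
Qed.


Lemma cut_derivable (y : R) : derivable (cut M N) y 1.
Proof. by have [] := cut_derive y. Qed.

Lemma derive1_cut y : derive1 (cut M N) y = tent ((y + (M + 2 * N)) / N) / N.
Proof. by rewrite derive1E; exact: (@derive_val _ _ _ _ _ _ _ (cut_derive y)). Qed.

Lemma continuous_dcut : continuous (derive1 (cut M N)).
Proof.
rewrite (_ : derive1 _ = fun y => tent ((y + (M + 2 * N)) / N) / N); last first.
  by apply/funext => y; exact: derive1_cut.
move=> y; apply: cvgM; last exact: cvg_cst.
apply: (@continuous_comp _ _ _ (fun y => (y + (M + 2 * N)) / N) tent).
  apply: cvgM; last exact: cvg_cst.
  by apply: cvgD; [exact: cvg_id|exact: cvg_cst].
exact: continuous_tent.
Qed.

Lemma cut_C1 : C1_cyl (fun p : R * R => cut M N p.2).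
Proof. by apply: C1_snd; [exact: cut_derivable|exact: continuous_dcut]. Qed.

Lemma cut_itv y : 0 <= cut M N y <= 1. Proof. exact: step_itv. Qed.

Lemma cut1 y : - M - N <= y -> cut M N y = 1.
Proof. by move=> h; apply: step_ge1; rewrite ler_pdivlMr//; lra. Qed.

Lemma cut0 y : y <= - (M + 2 * N) -> cut M N y = 0.
Proof. by move=> h; apply: step_le0; rewrite ler_pdivrMr// mul0r; lra. Qed.

Lemma dcut_bound y : `|derive1 (cut M N) y| <= 2 / N.
Proof.
rewrite derive1_cut ger0_norm; last by rewrite divr_ge0 ?tent_ge0// ltW.
by rewrite ler_pM2r ?invr_gt0// tent_le2.
Qed.

Lemma dcut0 y : ~ (- M - 2 * N <= y <= - M - N) -> derive1 (cut M N) y = 0.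
Proof.
move=> h; rewrite derive1_cut tent_eq0 ?mul0r//.
have [hy|hy] := leP y (- M - 2 * N).
  by left; rewrite ler_pdivrMr// mul0r; lra.
right; rewrite ler_pdivlMr// mul1r; have : ~~ (y <= - M - N).
  by apply/negP => hy'; apply: h; rewrite ltW.
rewrite -ltNge; lra.
Qed.

End CutProps.

(** Dominated convergence for the restrictions to lower and lower half planes,
    which tend to zero pointwise. *)
Lemma tail_small (D : set (R * R)) (h : R * R -> R) (e : R) : meas2 D ->
  ig leb2 D h -> (forall p, D p -> 0 <= h p) -> 0 < e ->
  exists n0 : nat, forall K : R, n0%:R <= K ->
    \int[leb2]_(p in D `&` [set p | p.2 <= - K]) h p <= e.
Proof.
move=> mD ih h0 e0.
have mT K : meas2 [set p : R * R | p.2 <= - K].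
  rewrite (_ : [set p | _] = ~` [set p : R * R | - K < p.2]).
    by apply: measurableC; exact: meas_above.
  by apply/seteqP; split => p /=; rewrite leNgt => /negP.
pose A K := D `&` [set p : R * R | p.2 <= - K].
have mA K : meas2 (A K) by exact: measurableI.
pose F (n : nat) p := ((h \_ (A n%:R)) p)%:E.
have cv : (\int[leb2]_(p in D) F n p)%E @[n --> \oo] --> (\int[leb2]_(p in D) (cst 0%E) p)%E.
  apply: (@dominated_cvg _ _ _ leb2 D mD F (cst 0%E) (EFin \o h)) => //.
  - move=> n; apply: (measurable_funS measurableT) => //; apply: patch_meas => //.
    by apply: measurable_funS (ig_meas ih) => // p [].
  - move=> p Dp; apply: (@cvg_near_cst _ _ _ _ _ (eventually_filter)).
    near=> n; rewrite /F patchE memNset// => -[_ /=].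
    apply/negP; rewrite -ltNge ltrNl.
    by near: n; exact: nbhs_infty_gtr.
  - move=> n p Dp; rewrite /F lee_fin patchE; case: ifP => _; last by rewrite normr0 h0.
    by rewrite ger0_norm// h0.
rewrite integral_cst// mul0e in cv.
have : \forall n \near \oo, (\int[leb2]_(p in D) F n p < e%:E)%E.
  exact: cvge0_lt.
move=> [n0 _ H]; exists n0 => K nK.
apply: (@le_trans _ _ (\int[leb2]_(p in A n0%:R) h p)).
  have iA : ig leb2 (A n0%:R) h by apply: igS ih => //; exact: subIsetl.
  have sub : A K `<=` A n0%:R.
    by move=> p [Dp /= pK]; split => //=; apply: le_trans pK _; rewrite lerN2.
  by apply: (Rint_le_set (mA n0%:R) (mA K) sub iA) => p [Dp _]; exact: h0.
have := H n0 (leqnn n0); rewrite /F.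
rewrite (_ : \int[leb2]_(p in D) _ = (\int[leb2]_(p in A n0%:R) h p)%:E)%E.
  by rewrite lte_fin => /ltW.
have iP : ig leb2 D (h \_ (A n0%:R)).
  have mP : mfun2 D (h \_ (A n0%:R)).
    apply: (measurable_funS measurableT) => //; apply/measurable_EFinP; apply: patch_meas => //.
    by apply: measurable_funS (ig_meas ih) => // p [].
  apply: (ig_le mD mP ih).
  by move=> p Dp; rewrite patchE; case: ifP => _; rewrite ?normr0 ?ger0_norm ?h0.
have -> : \int[leb2]_(p in A n0%:R) h p = \int[leb2]_(p in D) (h \_ (A n0%:R)) p.
  rewrite -Rintegral_mkcondr; congr (Rintegral _ _ _).
  by rewrite /A setIA setIid.
by rewrite /Rintegral fineK//; exact: (integrable_fin_num mD iP).
Unshelve. all: by end_near. Qed.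

End Cut.

(** * The energy and the pairing with boundary data *)

Section Energy.
Context {R : realType}.
Local Notation leb := (@lebesgue_measure R).
Local Notation leb2 := (@lebesgue_measure R \x @lebesgue_measure R)%E.
Variables (u : R -> R) (M : R).
Hypothesis cu : continuous u.
Hypothesis uM : forall x, `|u x| <= M.
Hypothesis pu : periodic u.
Hypothesis Hu : H_half u.
Variables (phi d1 d2 : R * R -> R) (G : (R -> R) -> R).
Hypothesis Hd : hdot1 u phi d1 d2.
Hypothesis Ht : has_trace u phi d1 d2 u.
Hypothesis HG : forall psi, H_half psi ->
  forall w w1 w2, h1 u w w1 w2 -> has_trace u w w1 w2 psi ->
  G psi = int_on (subgraph u) (fun p => d1 p * w1 p + d2 p * w2 p).

Local Notation Omega := (subgraph u `&` cell).
Let M0 : 0 <= M. Proof. exact: le_trans (normr_ge0 _) (uM 0). Qed.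
Let mO : meas2 Omega. Proof. exact: meas_Omega. Qed.
Let q1 : sqi leb2 Omega d1. Proof. exact: d1_sqi Hd. Qed.
Let q2 : sqi leb2 Omega d2. Proof. exact: d2_sqi Hd. Qed.

Definition dirichlet := \int[leb2]_(p in Omega) (d1 p ^+ 2 + d2 p ^+ 2).

Let iE : ig leb2 Omega (fun p => d1 p ^+ 2 + d2 p ^+ 2).
Proof. by apply: igD => //; [case: q1|case: q2]. Qed.

Let E1 : \int[leb2]_(p in Omega) (d1 p ^+ 2) <= dirichlet.
Proof.
apply: le_Rintegral => //; first by case: q1.
by move=> p _; rewrite lerDl sqr_ge0.
Qed.

Let E2 : \int[leb2]_(p in Omega) (d2 p ^+ 2) <= dirichlet.
Proof.
apply: le_Rintegral => //; first by case: q2.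
by move=> p _; rewrite lerDr sqr_ge0.
Qed.

(** Testing with the solution itself, truncated far below: the truncation
    error pairs [d2] with [phi / N] on a strip of height [N], where the first
    tends to zero in mean square and the second stays bounded. *)
Lemma energy_le : dirichlet <= G u.
Proof.
set E := dirichlet; have E0 : 0 <= E.
  by apply: Rintegral_ge0 => p _; rewrite addr_ge0// sqr_ge0.
set g2 := \int[leb]_(x in circ) (u x ^+ 2).
have g20 : 0 <= g2 by exact: Rint_sq_ge0.
pose C := 32 * g2 + 64 * (M + 1) * E.
have C0 : 0 <= C by rewrite /C addr_ge0// !mulr_ge0// addr_ge0.
apply: (@le_eps _ _ _ (C + 2)); first by rewrite addr_ge0.
move=> e e0; have e1 : 0 < Num.min e (e ^+ 2) by rewrite lt_min e0 exprn_gt0.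
have [n0 Hn] := tail_small mO iE (fun p _ => addr_ge0 (sqr_ge0 (d1 p)) (sqr_ge0 (d2 p))) e1.
pose N : R := n0%:R + 1; have N1 : 1 <= N by rewrite /N lerDr.
have N0 : 0 < N by rewrite (lt_le_trans _ N1).
have nMN : n0%:R <= M + N by rewrite /N addrCA lerDl addr_ge0.
pose P : set (R * R) := [set p | p.2 <= - (M + N)].
have mP : meas2 P.
  rewrite (_ : P = ~` [set p : R * R | - (M + N) < p.2]).
    by apply: measurableC; exact: meas_above.
  by apply/seteqP; split => p; rewrite /P /= leNgt => /negP.
set T := \int[leb2]_(p in Omega `&` P) (d1 p ^+ 2 + d2 p ^+ 2).
(* The square of e pays for the factor 1 / e of the inequality of Young. *)
have [Te Te2] : T <= e /\ T <= e ^+ 2.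
  have := Hn _ nMN; rewrite -/P -/T le_min => /andP[]; by split.
pose chi (p : R * R) := cut M N p.2.
have Cchi : C1_cyl chi by exact: cut_C1.
have chi0 p : p.2 <= - (M + 2 * N) -> chi p = 0 by exact: cut0.
have := HG Hu (cut_h1 cu uM Hd Ht Cchi chi0).
have tr := cut_trace cu uM pu Hd Ht Cchi.
rewrite (_ : (fun x => chi (x, u x) * u x) = u) in tr; last first.
  apply/funext => x; rewrite /chi cut1 ?mul1r//=.
  have : - M <= u x by have := uM x; rewrite ler_norml => /andP[].
  by move: N0; lra.
move=> /(_ tr) ->; rewrite /int_on.
pose T1 p := chi p * (d1 p ^+ 2 + d2 p ^+ 2).
pose T2 p := (partial2 chi p * phi p) * d2 p.
rewrite (_ : \int[leb2]_(p in _) _ = \int[leb2]_(p in Omega) (T1 p + T2 p)); last first.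
  apply: eq_Rintegral => p _; rewrite (partial1_snd (cut M N) p) /T1 /T2 -/chi.
  by ring.
have cchi : continuous chi by exact: C1_continuous.
have cdchi : continuous (partial2 chi) by case: Cchi.
have i1 : ig leb2 Omega T1.
  apply: (@igM_bounded _ _ _ _ _ _ _ 1) => //; first exact: continuous2_measD.
  move=> p _; have /andP[h1 h2] := cut_itv M N p.2.
  by rewrite /chi ger0_norm.
pose J : set R := `[- M - 2 * N, - M - N]%classic.
pose S : set (R * R) := circ `*` J.
have mS : meas2 S by exact: meas_box.
have SP : S `<=` Omega `&` P.
  move=> [x y] [/= cx]; rewrite /J /= in_itv /= => /andP[y1 y2].
  have ux : - M <= u x by have := uM x; rewrite ler_norml => /andP[].
  split; last by rewrite /P /=; move: y2; lra.
  by split => //; rewrite /subgraph /=; move: y2 ux N0; lra.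
have SO : S `<=` Omega by move=> p /SP[].
have Ssl : S `<=` slab u (M + 2 * N + 1).
  move=> p Sp; have [Up cp] := SO _ Sp; split => //; split => //=.
  by move: Sp => [_]; rewrite /J /= in_itv /= => /andP[+ _]; lra.
have qphi : sqi leb2 S phi.
  exact: (sqiS (meas_slab _ cu) mS Ssl (phi_sqi cu uM Hd Ht _)).
have dchiB p : `|partial2 chi p| <= 2 / N by exact: dcut_bound.
have qx : sqi leb2 S (fun p => partial2 chi p * phi p).
  exact: (sqiM_bounded mS (continuous2_measD cdchi) (fun p _ => dchiB p) qphi).
have q2S : sqi leb2 S d2 by exact: (sqiS mO mS SO q2).
have sup : T2 \_ S = T2 \_ Omega.
  apply: patch_support => p; first by move=> /SO.
  move=> [_ cp] nS; rewrite /T2 (_ : partial2 chi p = 0) ?mul0r//.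
  by apply: dcut0 => // h; apply: nS; split => //; rewrite /J /= in_itv.
have i2 : ig leb2 Omega T2 by apply: (ig_support mS mO sup); exact: sqiM.
rewrite RintegralD// -(Rint_support sup).
have b1 : E - T <= \int[leb2]_(p in Omega) T1 p.
  have iEP : ig leb2 Omega ((fun p => d1 p ^+ 2 + d2 p ^+ 2) \_ P).
    have mEP : mfun2 Omega ((fun p => d1 p ^+ 2 + d2 p ^+ 2) \_ P).
      apply: (measurable_restrict _ mP mO).1.
      by apply: (measurable_funS mO _ (ig_meas iE)); exact: subIsetl.
    apply: (ig_le mO mEP iE) => p _; rewrite patchE; case: ifP => _.
      by rewrite ger0_norm// addr_ge0 ?sqr_ge0.
    by rewrite normr0 addr_ge0 ?sqr_ge0.
  have eT : T = \int[leb2]_(p in Omega) (((fun p => d1 p ^+ 2 + d2 p ^+ 2) \_ P) p).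
    exact: (@Rintegral_mkcondr _ _ _ leb2 Omega P (fun p => d1 p ^+ 2 + d2 p ^+ 2)).
  rewrite lerBlDr eT -(RintegralD mO i1 iEP) /E /dirichlet.
  apply: le_Rintegral => //; first exact: igD.
  move=> p _; rewrite patchE /T1; case: ifPn => pP.
    have /andP[hc _] := cut_itv M N p.2.
    rewrite lerDr; apply: mulr_ge0; first exact: hc.
    by rewrite addr_ge0 ?sqr_ge0.
  rewrite /chi cut1 ?mul1r ?addr0//.
  by move: pP; rewrite notin_setE /P /= => /negP; rewrite -ltNge => /ltW; lra.
have Nn : N != 0 by rewrite gt_eqF.
(* The slope 2 / N of the cut-off compensates the quadratic growth of the mean square of phi. *)
have growth : \int[leb2]_(p in S) ((partial2 chi p * phi p) ^+ 2) <= C.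
  apply: le_trans (Rint_sqM_bounded mS (continuous2_measD cdchi) (fun p _ => dchiB p) qphi) _.
  have tg := trace_growth cu uM Hd Ht N0.
  apply: le_trans (ler_wpM2l (sqr_ge0 _) tg) _.
  have NM : 0 <= 16 * N * (M + N) by rewrite !mulr_ge0 ?addr_ge0 ?(ltW N0).
  have := ler_wpM2l NM E2; rewrite -(lerD2l (8 * N * g2)) => h.
  apply: le_trans (ler_wpM2l (sqr_ge0 _) h) _.
  have -> : (2 / N) ^+ 2 * (8 * N * g2 + 16 * N * (M + N) * dirichlet) =
      32 * (g2 / N) + 64 * ((M / N + 1) * E) by rewrite /E; field.
  rewrite /C -!mulrA lerD// ler_wpM2l// ?ler_wpM2r// ?lerD2r.
    by rewrite ler_pdivrMr// ler_peMr.
  by rewrite ler_pdivrMr// ler_peMr.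
have b2 : - (e * C + e) <= \int[leb2]_(p in S) T2 p.
  have := Rint_young mS e0 qx q2S.
  rewrite ler_norml => /andP[+ _]; apply: le_trans; rewrite lerN2.
  rewrite lerD// ?ler_wpM2l ?(ltW e0)//.
  rewrite mulrC ler_pdivrMr// -expr2; apply: le_trans Te2.
  have mOP : meas2 (Omega `&` P) by exact: measurableI.
  have iOP : ig leb2 (Omega `&` P) (fun p => d1 p ^+ 2 + d2 p ^+ 2).
    by apply: igS iE => //; exact: subIsetl.
  apply: (@le_trans _ _ (\int[leb2]_(p in S) (d1 p ^+ 2 + d2 p ^+ 2))).
    apply: le_Rintegral => //; first by case: q2S.
      by apply: igS iOP.
    by move=> p _; rewrite lerDr sqr_ge0.
  by apply: Rint_le_set => // p _; rewrite addr_ge0 ?sqr_ge0.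
move: b1 b2 Te; rewrite -/E; set X := \int[leb2]_(p in Omega) _; set Y := \int[leb2]_(p in S) _.
rewrite mulrDl mulrC; move: (e * C) => eC; lra.
Qed.

(** The constant 1 enters as a function on which the multiplication lemmas
    produce all the smooth compactly supported competitors. *)
Lemma unit_hdot1 : hdot1 u (cst 1) (cst 0) (cst 0).
Proof.
have mU := meas_subgraph cu; split.
- split; [by []|exact: measurable_cst|].
  move=> K cK _; apply: ig_cst; first exact: meas_compact.
  exact: compact_lty.
- move=> eta te; have := partial1_int0 te; rewrite /int_on.
  rewrite (_ : \int[leb2]_(p in _) (cst 1 p * _) = \int[leb2]_(p in Omega) partial1 eta p).
    move=> ->; rewrite (_ : \int[leb2]_(p in _) _ = \int[leb2]_(p in Omega) (cst 0 p)).
      by rewrite Rintegral_cst// mul0r oppr0.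
    by apply: eq_Rintegral => p _; rewrite mul0r.
  by apply: eq_Rintegral => p _; rewrite mul1r.
- move=> eta te; have := partial2_int0 te; rewrite /int_on.
  rewrite (_ : \int[leb2]_(p in _) (cst 1 p * _) = \int[leb2]_(p in Omega) partial2 eta p).
    move=> ->; rewrite (_ : \int[leb2]_(p in _) _ = \int[leb2]_(p in Omega) (cst 0 p)).
      by rewrite Rintegral_cst// mul0r oppr0.
    by apply: eq_Rintegral => p _; rewrite mul0r.
  by apply: eq_Rintegral => p _; rewrite mul1r.
- split; [by []|exact: measurable_cst|].
  by rewrite /L2sq_on integral0_eq ?ltry// => p _; rewrite expr0n.
- split; [by []|exact: measurable_cst|].
  by rewrite /L2sq_on integral0_eq ?ltry// => p _; rewrite expr0n.
Qed.

Lemma unit_trace : has_trace u (cst 1) (cst 0) (cst 0) (cst 1).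
Proof.
split.
  split; [by []|exact: measurable_cst|].
  rewrite /L2sq_circ sqi_EFin ?ltry//; first exact: mcirc.
  apply: (@sqi_bounded _ _ _ _ _ _ 1); [exact: mcirc|exact: circ_lty|exact: measurable_cst|].
  by move=> x _; rewrite normr1.
exists (fun _ => cst 1); split.
- by move=> _; exact: C1_cst.
- move=> K /=; split.
  + rewrite (_ : (fun n => _) = cst 0%E); first exact: cvg_cst.
    apply/funext => n; apply: integral0_eq => p _.
    by rewrite subrr expr0n.
  + rewrite (_ : (fun n => _) = cst 0%E); first exact: cvg_cst.
    apply/funext => n; apply: integral0_eq => p _.
    by rewrite /partial1 derive1_cst subrr expr0n.
  + rewrite (_ : (fun n => _) = cst 0%E); first exact: cvg_cst.
    apply/funext => n; apply: integral0_eq => p _.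
    by rewrite /partial2 derive1_cst subrr expr0n.
- rewrite (_ : (fun n => _) = cst 0%E); first exact: cvg_cst.
  apply/funext => n; apply: integral0_eq => p _.
  by rewrite subrr expr0n.
Qed.

Lemma slab_mass K : 0 <= M + K -> fine (leb2 (slab u K)) <= 2 * pi * (M + K).
Proof.
move=> MK; have mS := meas_slab K cu.
have : (leb2 (slab u K) <= (2 * pi * (M + K))%:E)%E.
  apply: (@le_trans _ _ (leb2 (circ `*` `[- K, M]%classic))).
    apply: le_measure; rewrite ?inE//; last exact: slab_box.
    exact: meas_box.
  rewrite product_measure1E; [|exact: mcirc|exact: mitv].
  have f1 : leb circ = (2 * pi)%:E.
    by rewrite -circ_mass fineK// ge0_fin_numE// circ_lty.
  have KM : - K <= M by rewrite -subr_ge0 opprK.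
  have f2 : leb `[- K, M]%classic = (M + K)%:E.
    have := leb_itv KM; rewrite opprK => <-.
    by rewrite fineK// ge0_fin_numE// leb_itv_lty.
  rewrite (_ : (_ * _)%E = ((2 * pi)%:E * (M + K)%:E)%E)//.
  by congr (_ * _)%E; [exact: f1|exact: f2].
move=> h; rewrite -lee_fin fineK// ge0_fin_numE//.
exact: slab_lty.
Qed.

Lemma slab_sq_le K (h : R * R -> R) (B : R) : 0 <= M + K -> continuous h ->
  (forall p, `|h p| <= B) -> (forall p, Omega p -> ~ slab u K p -> h p = 0) ->
  sqi leb2 Omega h /\
  \int[leb2]_(p in Omega) (h p ^+ 2) <= B ^+ 2 * (2 * pi * (M + K)).
Proof.
move=> MK ch hB h0; have mS := meas_slab K cu; have qs := slab_sqi cu uM K ch.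
have sup : (fun p => h p ^+ 2) \_ (slab u K) = (fun p => h p ^+ 2) \_ Omega.
  apply: patch_support => p; first by move=> /slab_sub.
  by move=> Op nS; rewrite h0// expr0n.
split.
  split; first exact: continuous2_measD.
  by case: qs => _; exact: ig_support.
rewrite -(Rint_support sup).
apply: (@le_trans _ _ (\int[leb2]_(p in slab u K) (cst (B ^+ 2) p))).
  apply: le_Rintegral => //; first by case: qs.
    by apply: ig_cst => //; exact: slab_lty.
  move=> p _; rewrite -[h p ^+ 2]real_normK ?num_real//.
  by rewrite ler_sqr ?nnegrE ?hB// (le_trans _ (hB p)).
rewrite Rintegral_cst// ler_wpM2l ?sqr_ge0//; exact: slab_mass.
Qed.

(** The test function is [psi x] times the cut-off in [y], seen as a multiple of
    the constant function 1, which has finite energy; Young's inequality with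
    weight [k] replaces Cauchy-Schwarz. *)
Lemma DN_test_le psi (A A' N k : R) : test_circ psi -> H_half psi ->
  (forall x, `|psi x| <= A) -> (forall x, `|derive1 psi x| <= A') -> 0 < N -> 0 < k ->
  `|G psi| <= 2 * k * dirichlet +
    k^-1 * ((A' ^+ 2 + (A * (2 / N)) ^+ 2) * (2 * pi * (M + (M + 2 * N + 1)))).
Proof.
move=> tpsi Hpsi psiA dpsiA N0 k0.
have A0 : 0 <= A by exact: le_trans (psiA 0).
have A'0 : 0 <= A' by exact: le_trans (dpsiA 0).
pose a (p : R * R) := psi p.1 * cut M N p.2.
have Cpsi := C1_fst tpsi; have Ccut := cut_C1 M N.
have Ca : C1_cyl a by exact: C1_mul.
have a0 p : p.2 <= - (M + 2 * N) -> a p = 0 by move=> h; rewrite /a cut0// mulr0.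
have pa1 p : partial1 a p = derive1 psi p.1 * cut M N p.2.
  by rewrite /a partial1M// partial1_fst partial1_snd mulr0 add0r.
have pa2 p : partial2 a p = psi p.1 * derive1 (cut M N) p.2.
  by rewrite /a partial2M// partial2_fst partial2_snd mul0r addr0.
have := HG Hpsi (cut_h1 cu uM unit_hdot1 unit_trace Ca a0).
have tr := cut_trace cu uM pu unit_hdot1 unit_trace Ca.
rewrite (_ : (fun x => a (x, u x) * cst 1 x) = psi) in tr; last first.
  apply/funext => x; rewrite /a cut1 ?mulr1//=.
  have : - M <= u x by have := uM x; rewrite ler_norml => /andP[].
  by move: N0; lra.
move=> /(_ tr) ->; rewrite /int_on; set K := M + 2 * N + 1.
have MK : 0 <= M + K by rewrite /K; move: M0 N0; lra.
rewrite (_ : \int[leb2]_(p in _) _ = \int[leb2]_(p in Omega)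
    (d1 p * partial1 a p + d2 p * partial2 a p)); last first.
  by apply: eq_Rintegral => p _; rewrite !mulr0 !add0r !mulr1.
have offS p : Omega p -> ~ slab u K p -> p.2 <= - (M + 2 * N + 1).
  move=> [Up cp] nS; rewrite leNgt; apply/negP => h; apply: nS; split => //.
have c1 : continuous (partial1 a) by case: Ca.
have c2 : continuous (partial2 a) by case: Ca.
have [qa1 Ia1] : sqi leb2 Omega (partial1 a) /\
    \int[leb2]_(p in Omega) (partial1 a p ^+ 2) <= A' ^+ 2 * (2 * pi * (M + K)).
  apply: slab_sq_le => // p.
    rewrite pa1 normrM -[A']mulr1 ler_pM//.
    by have /andP[h1 h2] := cut_itv M N p.2; rewrite ger0_norm.
  move=> Op /(offS p Op) h; rewrite pa1 cut0 ?mulr0//; lra.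
have [qa2 Ia2] : sqi leb2 Omega (partial2 a) /\
    \int[leb2]_(p in Omega) (partial2 a p ^+ 2) <= (A * (2 / N)) ^+ 2 * (2 * pi * (M + K)).
  apply: slab_sq_le => // p.
    by rewrite pa2 normrM ler_pM//; exact: dcut_bound.
  move=> Op /(offS p Op) h; rewrite pa2 dcut0 ?mulr0// => /andP[h' _]; lra.
have i1 := sqiM mO q1 qa1; have i2 := sqiM mO q2 qa2.
rewrite RintegralD//; apply: le_trans (ler_normD _ _) _.
have y1 := Rint_young mO k0 q1 qa1; have y2 := Rint_young mO k0 q2 qa2.
have k'0 : 0 <= k^-1 by rewrite invr_ge0 ltW.
have s1 : k * \int[leb2]_(p in Omega) (d1 p ^+ 2) <= k * dirichlet by rewrite ler_wpM2l// ltW.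
have s2 : k * \int[leb2]_(p in Omega) (d2 p ^+ 2) <= k * dirichlet by rewrite ler_wpM2l// ltW.
have t1 := ler_wpM2l k'0 Ia1; have t2 := ler_wpM2l k'0 Ia2.
apply: le_trans (lerD (le_trans y1 (lerD s1 t1)) (le_trans y2 (lerD s2 t2))) _.
by rewrite le_eqVlt; apply/orP; left; apply/eqP; ring.
Qed.

(** Only the slope of the cut-off contributes: it has size [1 / N] on a region of
    area of order [N], so its mean square vanishes as [N] grows. *)
Lemma DN_one : H_half (cst 1 : R -> R) -> G (cst 1) = 0.
Proof.
move=> H1; have E0 : 0 <= dirichlet.
  by apply: Rintegral_ge0 => p _; rewrite addr_ge0// sqr_ge0.
apply/eqP; rewrite -normr_le0.
have t1 : test_circ (cst 1 : R -> R).
  split => //; rewrite (_ : derive1 _ = cst 0); first exact: cst_continuous.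
  by apply/funext => x; rewrite derive1_cst.
pose C := 4 * (2 * pi * (2 * M + 3)).
have C0 : 0 <= C.
  rewrite /C mulr_ge0// mulr_ge0 ?(ltW pi2_gt0)// addr_ge0// mulr_ge0//.
apply: (@le_eps _ _ _ (2 * dirichlet + C)).
  by apply: addr_ge0 => //; apply: mulr_ge0.
(* The weight k = e and a depth of order 1 / e^2 make both terms of the bound small. *)
move=> e e0; pose N := 1 + (e ^+ 2)^-1.
have e20 : 0 < e ^+ 2 by rewrite exprn_gt0.
have N1 : 1 <= N by rewrite /N lerDl invr_ge0 ltW.
have N0 : 0 < N by rewrite (lt_le_trans _ N1).
have b1 x : `|(cst 1 : R -> R) x| <= 1 by rewrite normr1.
have b0 x : `|derive1 (cst 1 : R -> R) x| <= 0 by rewrite derive1_cst normr0.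
apply: le_trans (DN_test_le t1 H1 b1 b0 N0 e0) _.
have NV : N^-1 <= e ^+ 2.
  by rewrite invf_ple ?posrE// /N lerDr.
have h1 : (2 / N) ^+ 2 * (2 * pi * (M + (M + 2 * N + 1))) <= C / N.
  rewrite -subr_ge0.
  have -> : C / N - (2 / N) ^+ 2 * (2 * pi * (M + (M + 2 * N + 1))) =
    4 * (2 * pi) * (2 * M + 1) * (N - 1) / N ^+ 2 by rewrite /C; field; rewrite gt_eqF.
  have M1 : 0 <= 2 * M + 1 by rewrite addr_ge0// mulr_ge0.
  have Nm : 0 <= N - 1 by rewrite subr_ge0.
  have p0 : 0 <= 4 * (2 * pi) :> R by rewrite mulr_ge0// ltW// pi2_gt0.
  by rewrite mulr_ge0 ?invr_ge0 ?sqr_ge0// mulr_ge0// mulr_ge0.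
have h2 := le_trans h1 (ler_wpM2l C0 NV).
have e'0 : 0 <= e^-1 by rewrite invr_ge0 ltW.
have h3 := ler_wpM2l e'0 h2.
rewrite add0r expr0n add0r mul1r (_ : (2 * dirichlet + C) * e =
  2 * e * dirichlet + e^-1 * (C * e ^+ 2)); last by field; rewrite gt_eqF.
by rewrite lerD2l.
Qed.

End Energy.

(** * Bessel's inequality *)

Section Bessel.
Context d (T : measurableType d) (R : realType) (mu : {measure set T -> \bar R}).
Variables (D : set T) (mD : measurable D) (e : nat -> T -> R).
Hypothesis qe : forall i, sqi mu D (e i).
Hypothesis orth : forall i j, i != j -> \int[mu]_(x in D) (e i x * e j x) = 0.
Let N i := \int[mu]_(x in D) (e i x ^+ 2).
Hypothesis N0 : forall i, 0 < N i.
Variable v : T -> R.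
Hypothesis qv : sqi mu D v.
Let c i := \int[mu]_(x in D) (v x * e i x).

(** What remains of [v] after subtracting its projections on the first [n]
    orthogonal functions. *)
Fixpoint residual n : T -> R :=
  if n is m.+1 then fun x => residual m x - c m / N m * e m x else v.

Lemma residual_sqi n : sqi mu D (residual n).
Proof. by elim: n => //= n IH; apply: sqiB => //; exact: sqiZ. Qed.

Lemma residual_coef n j : (n <= j)%N ->
  \int[mu]_(x in D) (residual n x * e j x) = c j.
Proof.
elim: n => //= n IH nj.
rewrite (_ : \int[mu]_(x in D) _ = \int[mu]_(x in D)
    (residual n x * e j x - c n / N n * (e n x * e j x))); last first.
  by apply: eq_Rintegral => x _; ring.
rewrite RintegralB//; last 2 first.
- by apply: sqiM => //; exact: residual_sqi.
- by apply: igZ => //; exact: sqiM.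
rewrite RintegralZl//; last exact: sqiM.
by rewrite orth ?mulr0 ?subr0 ?IH// ?ltn_eqF// ltnW.
Qed.

Lemma residual_sq n : \int[mu]_(x in D) (residual n x ^+ 2) =
  \int[mu]_(x in D) (v x ^+ 2) - \sum_(i < n) c i ^+ 2 / N i.
Proof.
elim: n => [|n IH]; first by rewrite big_ord0 subr0.
have qr := residual_sqi n; have [_ ir] := qr; have [_ ie] := qe n.
rewrite big_ord_recr /= opprD addrA -IH.
rewrite (_ : \int[mu]_(x in D) _ = \int[mu]_(x in D)
    (residual n x ^+ 2 - 2 * (c n / N n) * (residual n x * e n x)
     + (c n / N n) ^+ 2 * e n x ^+ 2)); last first.
  by apply: eq_Rintegral => x _; ring.
have ire : ig mu D (fun x => residual n x * e n x) by exact: sqiM.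
rewrite RintegralD//; last 2 first.
- by apply: igB => //; exact: igZ.
- exact: igZ.
rewrite RintegralB//; last exact: igZ.
rewrite RintegralZl// RintegralZl// (residual_coef (leqnn n)) -/(N n).
by field; rewrite gt_eqF.
Qed.

Lemma bessel n : \sum_(i < n) c i ^+ 2 / N i <= \int[mu]_(x in D) (v x ^+ 2).
Proof. by rewrite -subr_ge0 -residual_sq; exact: Rint_sq_ge0. Qed.

End Bessel.

Section Trigonometric.
Context {R : realType}.
Local Notation leb := (@lebesgue_measure R).
Implicit Types (k x : R) (n : nat).

Lemma is_derive_mulx k x : is_derive x (1 : R) (fun x => k * x) k.
Proof. by apply: is_derive_eq; rewrite ?/GRing.scale /= ?mulr1 ?mulr0 ?addr0 ?add0r. Qed.

Lemma is_derive_cosk k x : is_derive x (1 : R) (fun x => cos (k * x)) (- k * sin (k * x)).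
Proof.
have h := @is_derive1_comp R cos (fun x => k * x) x _ _ (is_derive_cos (k * x)) (is_derive_mulx k x).
by apply: (is_derive_eq h); rewrite mulrC mulNr mulrN.
Qed.

Lemma is_derive_sink k x : is_derive x (1 : R) (fun x => sin (k * x)) (k * cos (k * x)).
Proof.
have h := @is_derive1_comp R sin (fun x => k * x) x _ _ (is_derive_sin (k * x)) (is_derive_mulx k x).
by apply: (is_derive_eq h); rewrite mulrC.
Qed.

Lemma continuous_mulx k : continuous (fun x => k * x).
Proof. by move=> x; apply: cvgM; [exact: cvg_cst|exact: cvg_id]. Qed.

Lemma continuous_cosk k : continuous (fun x => cos (k * x)).
Proof.
move=> x; apply: (@continuous_comp _ _ _ (fun x => k * x) cos).
  exact: continuous_mulx.
exact: continuous_cos.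
Qed.

Lemma continuous_sink k : continuous (fun x => sin (k * x)).
Proof.
move=> x; apply: (@continuous_comp _ _ _ (fun x => k * x) sin).
  exact: continuous_mulx.
exact: continuous_sin.
Qed.

Lemma sin_cos_2pin n : sin (n%:R * (2 * pi) : R) = 0 /\ cos (n%:R * (2 * pi) : R) = 1.
Proof.
have s2 : sin (2 * pi : R) = 0 by rewrite mulr_natl sin2pi.
have c2 : cos (2 * pi : R) = 1 by rewrite mulr_natl cos2pi.
elim: n => [|n [IHs IHc]]; first by rewrite mul0r sin0 cos0.
rewrite -natr1 mulrDl mul1r sinD cosD IHs IHc s2 c2.
by rewrite !(mul0r, mulr0, mulr1, addr0, subr0).
Qed.

Lemma int_cos0 k : k != 0 -> sin (k * (2 * pi)) = 0 ->
  \int[leb]_(x in circ) cos (k * x) = 0.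
Proof.
move=> k0 sk; have p0 := ltW (@pi2_gt0 R).
have d x : is_derive x (1 : R) (fun x => k^-1 * sin (k * x)) (cos (k * x)).
  have h := is_derive_sink k x.
  have h2 : is_derive x (1 : R) (fun x => k^-1 *: sin (k * x)) (k^-1 *: (k * cos (k * x))).
    exact: is_deriveZ.
  by apply: (is_derive_eq h2); rewrite /GRing.scale /= mulrA mulVf// mul1r.
rewrite (ftc_C1 p0 d); last exact: continuous_cosk.
by rewrite sk !(mulr0, sin0) subrr.
Qed.

Lemma cos_sqi k : sqi leb circ (fun x => cos (k * x)).
Proof.
split; first by apply: continuous_mfun1; exact: continuous_cosk.
by apply: continuous_ig; apply: continuous_sq; exact: continuous_cosk.
Qed.

Lemma sin_sqi k : sqi leb circ (fun x => sin (k * x)).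
Proof.
split; first by apply: continuous_mfun1; exact: continuous_sink.
by apply: continuous_ig; apply: continuous_sq; exact: continuous_sink.
Qed.

Lemma ig_cosk k : ig leb circ (fun x => cos (k * x)).
Proof. by apply: continuous_ig; exact: continuous_cosk. Qed.

Lemma sin_period (i j : nat) :
  sin ((i%:R - j%:R) * (2 * pi) : R) = 0 /\ sin ((i%:R + j%:R) * (2 * pi) : R) = 0.
Proof.
have [si ci] := sin_cos_2pin i; have [sj cj] := sin_cos_2pin j.
split.
  by rewrite mulrBl sinB si ci sj cj !(mul0r, mulr0, mulr1, subrr).
by rewrite mulrDl sinD si ci sj cj !(mul0r, mulr0, mulr1, addr0).
Qed.

Lemma natr_sub_neq0 (i j : nat) : i != j -> i%:R - j%:R != 0 :> R.
Proof. by rewrite subr_eq0 eqr_nat. Qed.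

Lemma orth_cos (i j : nat) : i != j ->
  \int[leb]_(x in circ) (cos (i%:R * x) * cos (j%:R * x)) = 0.
Proof.
move=> ij; have [s1 s2] := sin_period i j; have mc := @mcirc R.
rewrite (_ : \int[leb]_(x in circ) _ = \int[leb]_(x in circ)
   (2^-1 * (cos ((i%:R - j%:R) * x) + cos ((i%:R + j%:R) * x)))); last first.
  apply: eq_Rintegral => x _; rewrite mulrBl [in X in _ = X]mulrDl.
  by rewrite cosB cosD; field.
rewrite RintegralZl//; last by apply: igD => //; exact: ig_cosk.
rewrite RintegralD//; [|exact: ig_cosk|exact: ig_cosk].
rewrite !int_cos0 ?addr0 ?mulr0// ?natr_sub_neq0//.
rewrite -natrD pnatr_eq0 addn_eq0; apply/negP => /andP[/eqP i0 /eqP j0].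
by rewrite i0 j0 eqxx in ij.
Qed.

Lemma orth_sin (i j : nat) : i != j ->
  \int[leb]_(x in circ) (sin (i%:R * x) * sin (j%:R * x)) = 0.
Proof.
move=> ij; have [s1 s2] := sin_period i j; have mc := @mcirc R.
rewrite (_ : \int[leb]_(x in circ) _ = \int[leb]_(x in circ)
   (2^-1 * (cos ((i%:R - j%:R) * x) - cos ((i%:R + j%:R) * x)))); last first.
  apply: eq_Rintegral => x _; rewrite mulrBl [in X in _ = X]mulrDl.
  by rewrite cosB cosD; field.
rewrite RintegralZl//; last by apply: igB => //; exact: ig_cosk.
rewrite RintegralB//; [|exact: ig_cosk|exact: ig_cosk].
rewrite !int_cos0 ?subr0 ?mulr0// ?natr_sub_neq0//.
rewrite -natrD pnatr_eq0 addn_eq0; apply/negP => /andP[/eqP i0 /eqP j0].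
by rewrite i0 j0 eqxx in ij.
Qed.

Lemma norm_cos_sin (n : nat) : (0 < n)%N ->
  \int[leb]_(x in circ) (cos (n%:R * x) ^+ 2) = pi /\
  \int[leb]_(x in circ) (sin (n%:R * x) ^+ 2) = pi.
Proof.
move=> n0; have mc := @mcirc R; have [_ s2] := sin_period n n.
have n20 : n%:R + n%:R != 0 :> R by rewrite -natrD pnatr_eq0 addn_eq0 negb_and -lt0n n0.
have h : \int[leb]_(x in circ) (cos ((n%:R + n%:R) * x)) = 0 by exact: int_cos0.
have ih : ig leb circ (fun x => 2^-1 * cos ((n%:R + n%:R) * x)).
  by apply: igZ => //; exact: ig_cosk.
have ic : ig leb circ (fun=> 2^-1 : R) by apply: ig_cst => //; exact: circ_lty.
split.
- rewrite (_ : \int[leb]_(x in circ) _ = \int[leb]_(x in circ)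
    (2^-1 + 2^-1 * cos ((n%:R + n%:R) * x))); last first.
    apply: eq_Rintegral => x _; rewrite mulrDl cosD.
    have := cos2Dsin2 (n%:R * x); set a := cos _; set b := sin _ => e.
    have e2 : 2^-1 = 2^-1 * (a ^+ 2 + b ^+ 2) by rewrite e mulr1.
    by rewrite [X in _ = X + _]e2; field.
  rewrite RintegralD// RintegralZl ?h ?mulr0 ?addr0//; last exact: ig_cosk.
  by rewrite Rintegral_cst// circ_mass mulrA mulVf// mul1r.
- rewrite (_ : \int[leb]_(x in circ) _ = \int[leb]_(x in circ)
    (2^-1 - 2^-1 * cos ((n%:R + n%:R) * x))); last first.
    apply: eq_Rintegral => x _; rewrite mulrDl cosD.
    have := cos2Dsin2 (n%:R * x); set a := cos _; set b := sin _ => e.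
    have e2 : 2^-1 = 2^-1 * (a ^+ 2 + b ^+ 2) by rewrite e mulr1.
    by rewrite [X in _ = X + _]e2; field.
  rewrite RintegralB// RintegralZl ?h ?mulr0 ?subr0//; last exact: ig_cosk.
  by rewrite Rintegral_cst// circ_mass mulrA mulVf// mul1r.
Qed.

End Trigonometric.

(** * Fourier norms and interpolation *)

Section FourierSums.
Context {R : realType}.
Local Notation leb := (@lebesgue_measure R).
Implicit Types (u v : R -> R) (F : int -> R).

Lemma fourier_sqmod_ge0 u k : 0 <= fourier_sqmod u k.
Proof. by rewrite /fourier_sqmod addr_ge0// sqr_ge0. Qed.

Lemma fourier_cosN u k : fourier_cos u (- k) = fourier_cos u k.
Proof.
rewrite /fourier_cos; congr (_ * _); apply: eq_Rintegral => x _.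
by rewrite mulrNz mulNr cosN.
Qed.

Lemma fourier_sinN u k : sqi leb circ u ->
  fourier_sin u (- k) = - fourier_sin u k.
Proof.
move=> qu; rewrite /fourier_sin -mulrN; congr (_ * _).
rewrite /int_circ -RintN; [|exact: mcirc|]; last first.
  by apply: sqiM => //; [exact: mcirc|exact: sin_sqi].
by apply: eq_Rintegral => x _; rewrite mulrNz mulNr sinN mulrN.
Qed.

Lemma fourier_sqmodN u k : sqi leb circ u ->
  fourier_sqmod u (- k) = fourier_sqmod u k.
Proof. by move=> qu; rewrite /fourier_sqmod fourier_cosN fourier_sinN// sqrrN. Qed.

Lemma bessel_cos v K : sqi leb circ v ->
  \sum_(n < K) (\int[leb]_(x in circ) (v x * cos (n%:R * x))) ^+ 2 <=
  2 * pi * \int[leb]_(x in circ) (v x ^+ 2).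
Proof.
move=> qv; have p0 := pi_gt0 R.
have N n : 0 < \int[leb]_(x in circ) (cos (n%:R * x) ^+ 2) <= 2 * pi.
  case: n => [|n]; last by have [-> _] := @norm_cos_sin R n.+1 isT; rewrite p0 /= ler_peMl ?ler1n ?(ltW p0).
  rewrite (_ : \int[leb]_(x in circ) _ = \int[leb]_(x in circ) (cst 1 x)); last first.
    by apply: eq_Rintegral => x _; rewrite mul0r cos0 expr1n.
  by rewrite Rintegral_cst ?circ_mass ?mul1r ?lexx ?mulr_gt0//; exact: mcirc.
have := bessel (@mcirc R) (fun i => cos_sqi i%:R) (@orth_cos R) (fun i => (andP (N i)).1) qv K.
move=> /(ler_wpM2l (ltW (@pi2_gt0 R))); apply: le_trans.
rewrite mulr_sumr; apply: ler_sum => n _.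
have /andP[n0 n2] := N n; rewrite mulrCA ler_peMr ?sqr_ge0//.
by rewrite ler_pdivlMr// mul1r.
Qed.

Lemma bessel_sin v K : sqi leb circ v ->
  \sum_(n < K) (\int[leb]_(x in circ) (v x * sin (n%:R * x))) ^+ 2 <=
  2 * pi * \int[leb]_(x in circ) (v x ^+ 2).
Proof.
move=> qv; have p0 := pi_gt0 R.
case: K => [|K]; first by rewrite big_ord0 mulr_ge0 ?(ltW pi2_gt0)// Rint_sq_ge0.
rewrite big_ord_recl /= (_ : \int[leb]_(x in circ) _ = \int[leb]_(x in circ) (cst 0 x)); last first.
  by apply: eq_Rintegral => x _; rewrite mul0r sin0 mulr0.
rewrite Rintegral_cst ?mul0r ?expr0n ?add0r; last exact: mcirc.
have N n : \int[leb]_(x in circ) (sin (n.+1%:R * x) ^+ 2) = pi.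
  by have [_ ->] := @norm_cos_sin R n.+1 isT.
have N0 n : 0 < \int[leb]_(x in circ) (sin (n.+1%:R * x) ^+ 2) by rewrite N.
have ort i j : i != j ->
    \int[leb]_(x in circ) (sin (i.+1%:R * x) * sin (j.+1%:R * x)) = 0 :> R.
  by move=> ij; apply: orth_sin; rewrite eqSS.
have := bessel (@mcirc R) (fun i => sin_sqi i.+1%:R) ort N0 qv K.
move=> /(ler_wpM2l (ltW (@pi2_gt0 R))); apply: le_trans.
rewrite mulr_sumr; apply: ler_sum => n _; rewrite N mulrCA ler_peMr ?sqr_ge0//.
by rewrite mulfK ?ler1n// gt_eqF.
Qed.

Lemma bessel_fourier v K : sqi leb circ v ->
  \sum_(n < K) fourier_sqmod v (Posz n) <= \int[leb]_(x in circ) (v x ^+ 2).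
Proof.
move=> qv; have p0 := @pi2_gt0 R; have h1 := bessel_cos K qv; have h2 := bessel_sin K qv.
rewrite /fourier_sqmod big_split /=.
set I := \int[leb]_(x in circ) _ in h1 h2 *.
have I0 : 0 <= I by exact: Rint_sq_ge0.
rewrite (eq_bigr (fun n : 'I_K => (2 * pi)^-1 ^+ 2 *
  (\int[leb]_(x in circ) (v x * cos (n%:R * x))) ^+ 2)); last first.
  by move=> n _; rewrite /fourier_cos exprMn.
rewrite [X in _ + X](eq_bigr (fun n : 'I_K => (2 * pi)^-1 ^+ 2 *
  (\int[leb]_(x in circ) (v x * sin (n%:R * x))) ^+ 2)); last first.
  by move=> n _; rewrite /fourier_sin exprMn.
rewrite -!mulr_sumr -mulrDr.
apply: le_trans (ler_wpM2l (sqr_ge0 _) (lerD h1 h2)) _.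
have -> : (2 * pi)^-1 ^+ 2 * (2 * pi * I + 2 * pi * I) = I / pi :> R.
  have pn : pi != 0 :> R by rewrite gt_eqF ?pi_gt0.
  by move: (pi : R) pn => q q0; field.
rewrite ler_pdivrMr ?pi_gt0// ler_peMr//.
by apply: le_trans (pi_ge2 R); rewrite ler1n.
Qed.

Lemma sum_subset (X Y : seq int) F : uniq X -> {subset X <= Y} ->
  (forall k, 0 <= F k) -> \sum_(k <- X) F k <= \sum_(k <- Y) F k.
Proof.
move=> + + F0; elim: X Y => [|x X IH] Y /=.
  by move=> _ _; rewrite big_nil sumr_ge0.
move=> /andP[xX uX] XY; have xY : x \in Y by apply: XY; rewrite mem_head.
rewrite (perm_big _ (perm_to_rem xY)) /= !big_cons lerD2l; apply: IH => // k kX.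
have kx : k != x by apply: contraNneq xX => <-.
have : k \in Y by apply: XY; rewrite in_cons kX orbT.
by rewrite (perm_mem (perm_to_rem xY)) in_cons (negbTE kx).
Qed.

(** Sums over the integers are compared with sums over the naturals, the zero
    frequency being counted twice. *)
Lemma sum_int_le (X : seq int) F : uniq X -> (forall k, 0 <= F k) ->
  (forall k, F (- k) = F k) ->
  exists K, \sum_(k <- X) F k <= 2 * \sum_(n < K) F (Posz n).
Proof.
move=> uX F0 FN; pose K := (\max_(k <- X) absz k).+1; exists K.
pose Y := [seq Posz n | n <- iota 0 K] ++ [seq - Posz n | n <- iota 0 K].
have XY : {subset X <= Y}.
  move=> k kX; have kK : (absz k < K)%N.
    by rewrite ltnS; apply: (@leq_bigmax_seq _ _ _ (fun k => absz k)).
  rewrite mem_cat; case: k kX kK => n kX kK; apply/orP; [left|right].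
    by apply/mapP; exists n => //; rewrite mem_iota.
  by apply/mapP; exists n.+1 => //; rewrite mem_iota.
apply: le_trans (sum_subset uX XY F0) _.
have e : \sum_(n <- iota 0 K) F (Posz n) = \sum_(n < K) F (Posz n).
  by rewrite -(big_mkord xpredT (fun n => F (Posz n))) /index_iota subn0.
rewrite /Y big_cat !big_map -e mulr_natl mulr2n lerD// le_eqVlt.
by apply/orP; left; apply/eqP/eq_bigr => n _; rewrite FN.
Qed.

Lemma esum_int_le F (S : R) : (forall k, 0 <= F k) -> (forall k, F (- k) = F k) ->
  (forall K, \sum_(n < K) F (Posz n) <= S) ->
  (\esum_(k in [set: int]) (F k)%:E <= (2 * S)%:E)%E.
Proof.
move=> F0 FN FS; apply: ge_ereal_sup => _ [A [fA _] <-].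
rewrite fsbig_finite//= sumEFin lee_fin.
have [K HK] := sum_int_le (finmap.fset_uniq (fset_set A)) F0 FN.
by apply: le_trans HK _; rewrite ler_wpM2l.
Qed.

(** The factor 1/2 pays for the two signs of the frequency. *)
Lemma weighted_norm_le (w : int -> R) u (B : R) : sqi leb circ u -> 0 <= B ->
  (forall k, 0 <= w k) -> (forall k, w (- k) = w k) ->
  (forall K, \sum_(n < K) w (Posz n) * fourier_sqmod u (Posz n) <= B ^+ 2 / 2) ->
  (weighted_norm w u <= B%:E)%E.
Proof.
move=> qu B0 w0 wN H.
have h : (\esum_(k in [set: int]) (w k * fourier_sqmod u k)%:E <= (2 * (B ^+ 2 / 2))%:E)%E.
  apply: (@esum_int_le (fun k => w k * fourier_sqmod u k)) => // k.
    by rewrite mulr_ge0// fourier_sqmod_ge0.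
  by rewrite wN fourier_sqmodN.
have e : 2 * (B ^+ 2 / 2) = B ^+ 2 by field.
rewrite e in h; rewrite /weighted_norm.
have -> : B%:E = ((B ^+ 2)%:E `^ (2^-1))%E.
  by rewrite poweR_EFin powR12_sqrt ?sqr_ge0// sqrtr_sqr ger0_norm.
apply: gt0_ler_poweR => //; rewrite ?invr_ge0// in_itv/= leey andbT.
  by apply: esum_ge0 => k _; rewrite lee_fin mulr_ge0// fourier_sqmod_ge0.
by rewrite lee_fin sqr_ge0.
Qed.

Lemma hs_weight_ge0 s k : 0 <= hs_weight s k :> R.
Proof. exact: powR_ge0. Qed.

Lemma hs_weightN s k : hs_weight s (- k) = hs_weight s k :> R.
Proof. by rewrite /hs_weight mulrNz sqrrN. Qed.

Lemma homog_weightN k : homog_half_weight (- k) = homog_half_weight k :> R.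
Proof. by rewrite /homog_half_weight mulrNz normrN. Qed.

Lemma homog_le_hs k : homog_half_weight k <= hs_weight 2^-1 k :> R.
Proof.
rewrite /homog_half_weight /hs_weight powR12_sqrt ?addr_ge0 ?sqr_ge0//.
by rewrite -sqrtr_sqr ler_sqrt ?lerDr// addr_ge0// sqr_ge0.
Qed.

Let br (n : nat) : R := 1 + (Posz n)%:~R ^+ 2.
Let br1 n : 1 <= br n. Proof. by rewrite /br lerDl sqr_ge0. Qed.
Let br0 n : 0 < br n. Proof. exact: lt_le_trans ltr01 (br1 n). Qed.

Lemma powR_neg_le (x y r : R) : 0 < x -> x <= y -> r <= 0 -> y `^ r <= x `^ r.
Proof.
move=> x0 xy r0; have y0 : 0 < y by exact: lt_le_trans x0 xy.
have -> : r = - (- r) by rewrite opprK.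
rewrite (powRN y (- r)) (powRN x (- r)) lef_pV2 ?posrE ?powR_gt0//.
by apply: ge0_ler_powR; rewrite ?nnegrE ?oppr_ge0// ltW.
Qed.

(** Interpolation between two square sums by splitting the frequencies at the
    level [L]; the level is chosen later, growing exponentially in time. *)
Lemma interp_pos (al L : R) (s : nat -> R) K : 0 <= al <= 1 -> 1 <= L ->
  (forall n, 0 <= s n) ->
  \sum_(n < K) hs_weight al (Posz n) * s n <=
  L `^ al * \sum_(n < K) s n + L `^ (al - 1) * \sum_(n < K) br n * s n.
Proof.
move=> /andP[al0 al1] L1 s0; rewrite !mulr_sumr -big_split /=.
have L0 : 0 < L by exact: lt_le_trans ltr01 L1.
apply: ler_sum => n _; rewrite /hs_weight -/(br n).
have [bL|Lb] := leP (br n) L.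
  rewrite ler_wpDr ?mulr_ge0 ?powR_ge0 ?(ltW (br0 n))//.
  by rewrite ler_wpM2r//; apply: ge0_ler_powR; rewrite ?nnegrE// ltW.
rewrite ler_wpDl ?mulr_ge0 ?powR_ge0// mulrA ler_wpM2r//.
have -> : br n `^ al = br n `^ (al - 1) * br n.
  rewrite -[X in _ * X]powRr1 ?(ltW (br0 n))// -powRD ?subrK//.
  by apply/implyP => _; rewrite gt_eqF.
by rewrite ler_wpM2r ?(ltW (br0 n))// powR_neg_le ?(ltW Lb)// subr_le0.
Qed.

(** Below the level the weight is at most 1 and each term is small; the
    comparison with the summable sequence [(br n)^-1] costs a power of the level,
    harmless against exponential smallness. *)
Lemma interp_neg (ep L D : R) (s : nat -> R) K : 0 <= ep -> 1 <= L -> 0 <= D ->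
  (forall n, 0 <= s n) -> (forall n, s n <= D * br n) ->
  \sum_(n < K) hs_weight (- ep) (Posz n) * s n <=
  L `^ (- ep) * \sum_(n < K) s n + D * L ^+ 2 * \sum_(n < K) (br n)^-1.
Proof.
move=> ep0 L1 D0 s0 sD; rewrite !mulr_sumr -big_split /=.
have L0 : 0 < L by exact: lt_le_trans ltr01 L1.
apply: ler_sum => n _; rewrite /hs_weight -/(br n).
have [bL|Lb] := leP (br n) L; last first.
  apply: ler_wpDr; last by rewrite ler_wpM2r// powR_neg_le ?(ltW Lb)// oppr_le0.
  by apply: mulr_ge0; [apply: mulr_ge0 => //; exact: sqr_ge0|rewrite invr_ge0 ltW].
rewrite ler_wpDl ?mulr_ge0 ?powR_ge0//.
have w1 : br n `^ (- ep) <= 1.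
  by rewrite powRN invf_le1 ?powR_gt0// -(powRr0 (br n)) ler_powR.
apply: (@le_trans _ _ (s n)); first by rewrite ler_piMl.
apply: le_trans (sD n) _; rewrite -mulrA ler_wpM2l// ler_pdivlMr// -expr2.
by rewrite ler_sqr ?nnegrE// ltW.
Qed.

(** Telescoping against [2 / n - 2 / (n + 1)]. *)
Lemma sum_inv_br K : \sum_(n < K) (br n)^-1 <= 3.
Proof.
case: K => [|K]; first by rewrite big_ord0.
(* The remainder 2 / (K + 1) makes the bound inductive. *)
suff : \sum_(n < K.+1) (br n)^-1 <= 3 - 2 / K.+1%:R.
  by move=> /le_trans; apply; rewrite lerBlDr lerDl divr_ge0.
elim: K => [|K IH].
  rewrite big_ord_recl big_ord0 /br /= expr0n /= !addr0 invr1; lra.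
rewrite big_ord_recr /=; apply: le_trans (lerD IH (lexx _)) _.
set m : R := K.+1%:R; have m0 : 0 < m by rewrite ltr0n.
have -> : br K.+1 = 1 + m ^+ 2 by [].
have -> : K.+2%:R = m + 1 :> R by rewrite natr1.
have q0 : 0 < 1 + m ^+ 2 by rewrite ltr_pwDl// sqr_ge0.
have m1 : 0 < m + 1 by rewrite addr_gt0.
have h : (1 + m ^+ 2)^-1 <= 2 / m - 2 / (m + 1).
  have -> : 2 / m - 2 / (m + 1) = 2 / (m * (m + 1)) by field; rewrite !gt_eqF.
  rewrite -[leLHS]mul1r ler_pdivrMr// mulrAC ler_pdivlMr ?mulr_gt0// mul1r.
  have := sqr_ge0 (m - 1); rewrite sqrrB1; nra.
by rewrite -addrA lerD2l -lerBrDl opprK [leRHS]addrC.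
Qed.

Lemma sum_br_le u v K : (forall n : nat, fourier_sqmod v (Posz n) = n%:R ^+ 2 * fourier_sqmod u (Posz n)) ->
  sqi leb circ u -> sqi leb circ v ->
  \sum_(n < K) br n * fourier_sqmod u (Posz n) <=
  \int[leb]_(x in circ) (u x ^+ 2) + \int[leb]_(x in circ) (v x ^+ 2).
Proof.
move=> H qu qv; have h1 := bessel_fourier K qu; have h2 := bessel_fourier K qv.
rewrite (eq_bigr (fun n : 'I_K => fourier_sqmod u (Posz n) + fourier_sqmod v (Posz n))).
  by rewrite big_split /= lerD.
by move=> n _; rewrite H /br mulrDl mul1r.
Qed.

End FourierSums.

(** * Sliding averages *)

Section Primitive.
Context {R : realType}.
Local Notation leb := (@lebesgue_measure R).
Implicit Types (A h u v P : R -> R).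

Lemma Rint_split A (a b c : R) : continuous A -> a <= b -> b <= c ->
  \int[leb]_(x in `[a, c]%classic) A x =
  \int[leb]_(x in `[a, b]%classic) A x + \int[leb]_(x in `[b, c]%classic) A x.
Proof.
move=> cA ab bc; have i1 : ig leb `[a, c]%classic A by exact: continuous_ig.
have := Rintegral_itvB i1 (_ : (BLeft a <= BRight b)%O) (_ : (BRight b <= BRight c)%O).
rewrite !bnd_simp => /(_ ab bc) /eqP; rewrite subr_eq => /eqP ->.
rewrite addrC; congr (_ + _); apply: Rintegral_itv_obnd_cbnd.
apply: igS i1; [exact: mitv|exact: measurable_itv|].
by apply: subset_itvr; rewrite bnd_simp.
Qed.

(** Signed from the origin, so that one formula serves on the whole line. *)
Definition primitive A (x : R) : R :=
  \int[leb]_(t in `[0, x]%classic) A t - \int[leb]_(t in `[x, 0]%classic) A t.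

Lemma primitive_from A (a x : R) : continuous A -> a <= 0 -> a <= x ->
  primitive A x = \int[leb]_(t in `[a, x]%classic) A t -
                  \int[leb]_(t in `[a, 0]%classic) A t.
Proof.
move=> cA a0 ax; rewrite /primitive; have [x0|x0] := leP x 0.
  rewrite (Rint_split cA ax x0) opprD addrA subrr add0r.
  move: x0; rewrite le_eqVlt => /predU1P[->|x0].
    by rewrite set_itv1 Rintegral_set1 add0r.
  by rewrite set_itv_ge ?Rintegral_set0 ?add0r// bnd_simp -ltNge.
rewrite (Rint_split cA a0 (ltW x0)) addrAC subrr add0r.
rewrite [X in _ - X](_ : _ = 0) ?subr0//.
by rewrite set_itv_ge ?Rintegral_set0// bnd_simp -ltNge.
Qed.

Lemma primitiveP A (x : R) : continuous A ->
  is_derive x (1 : R) (primitive A) (A x).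
Proof.
move=> cA; pose a := Num.min x 0 - 1.
have ax : a < x by rewrite /a ltrBlDr (le_lt_trans (_ : _ <= x)) ?ge_min ?lexx// ltrDl.
have a0 : a <= 0 by rewrite /a lerBlDr (le_trans (_ : _ <= 0)) ?ge_min ?lexx ?orbT// addr_ge0.
have i1 : ig leb `[a, x + 1]%classic A by exact: continuous_ig.
have x1 : x < x + 1 by rewrite ltrDl.
have [d e] := continuous_FTC1_closed x1 i1 ax (cA x).
have ne : {near x, (fun z => \int[leb]_(t in `[a, z]%classic) A t -
    \int[leb]_(t in `[a, 0]%classic) A t) =1 primitive A}.
  near=> z; rewrite (primitive_from cA a0)//; apply: ltW; near: z.
  exact: lt_nbhsr.
have dF : is_derive x (1 : R) (fun z => \int[leb]_(t in `[a, z]%classic) A t -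
    \int[leb]_(t in `[a, 0]%classic) A t) (A x).
  have h1 : is_derive x (1 : R) (fun z => \int[leb]_(t in `[a, z]%classic) A t) (A x).
    by rewrite -e derive1E; exact: DeriveDef.
  have h2 : is_derive x (1 : R) (fun z => \int[leb]_(t in `[a, z]%classic) A t - cst (\int[leb]_(t in `[a, 0]%classic) A t) z) (A x - 0).
    exact: is_deriveB.
  by apply: (is_derive_eq h2); rewrite subr0.
apply: DeriveDef.
  have [dF1 _] := dF.
  have := @near_eq_derivable _ _ _ _ _ x 1 ne.
  by apply; exact: dF1.
have <- := @near_eq_derive _ _ _ _ _ x (1 : R) ne.
exact: (@derive_val _ _ _ _ _ _ _ dF).
Unshelve. all: by end_near. Qed.

Lemma is_derive_continuous (F f : R -> R) :
  (forall x : R, is_derive x (1 : R) F (f x)) -> continuous F.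
Proof.
move=> dF x; apply: differentiable_continuous.
by apply/derivable1_diffP; have [] := dF x.
Qed.

Lemma is_derive_shift (F : R -> R) (f c x : R) : is_derive (x + c) (1 : R) F f ->
  is_derive x (1 : R) (fun x => F (x + c)) f.
Proof.
move=> h; have h1 : is_derive x (1 : R) (fun x => x + c) 1.
  by apply: is_derive_eq; rewrite addr0.
have h2 := @is_derive1_comp R F (fun x => x + c) x _ _ h h1.
by apply: (is_derive_eq h2); rewrite mulr1.
Qed.

Lemma zero_derive_const (F : R -> R) (a b : R) :
  (forall x : R, is_derive x (1 : R) F 0) -> F a = F b.
Proof.
move=> dF; have h z : Num.min b a <= z <= Num.max b a -> `|(fun=> 0 : R) z| <= 0.
  by move=> _; rewrite normr0.
have := mvt_bound dF h; rewrite mul0r normr_le0 subr_eq0.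
by move/eqP.
Qed.

Lemma primitive_period A (x y : R) : continuous A -> periodic A ->
  primitive A (x + 2 * pi) - primitive A x =
  primitive A (y + 2 * pi) - primitive A y.
Proof.
move=> cA pA.
apply: (@zero_derive_const (fun z => primitive A (z + 2 * pi) - primitive A z)) => z.
have h1 := is_derive_shift (primitiveP (z + 2 * pi) cA).
have h := is_deriveB h1 (primitiveP z cA).
by apply: (is_derive_eq h); rewrite pA subrr.
Qed.

Lemma ftc_primitive A (a b : R) : continuous A -> a <= b ->
  \int[leb]_(x in `[a, b]%classic) A x = primitive A b - primitive A a.
Proof. by move=> cA ab; rewrite (ftc_C1 ab (fun x => primitiveP x cA) cA). Qed.

Lemma int_circ_primitive A x : continuous A -> periodic A ->
  int_circ A = primitive A (x + 2 * pi) - primitive A x.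
Proof.
move=> cA pA; rewrite (primitive_period x 0 cA pA) add0r.
by rewrite /int_circ ftc_primitive// ltW// pi2_gt0.
Qed.

Lemma int_circ_shift A c : continuous A -> periodic A ->
  int_circ (fun x => A (x + c)) = int_circ A.
Proof.
move=> cA pA; rewrite /int_circ.
have cs : continuous (fun x => A (x + c)).
  move=> x; apply: (@continuous_comp _ _ _ (fun x => x + c) A); last exact: cA.
  by apply: cvgD; [exact: cvg_id|exact: cvg_cst].
rewrite (ftc_C1 (ltW (@pi2_gt0 R)) (fun x => is_derive_shift (primitiveP (x + c) cA)) cs).
by rewrite -[RHS]/(int_circ A) (int_circ_primitive c cA pA) add0r (addrC (2 * pi) c).
Qed.

(** The primitive is monotone and does not grow over a period, so it is constant
    near [x], where its derivative is [h x]. *)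
Lemma periodic_zero h x : continuous h -> periodic h -> (forall y, 0 <= h y) ->
  int_circ h <= 0 -> h x = 0.
Proof.
move=> ch ph h0 I0; pose P := primitive h; have p0 := pi_gt0 R.
have mono a b : a <= b -> P a <= P b.
  by move=> ab; rewrite -subr_ge0 -ftc_primitive//; apply: Rintegral_ge0.
have cst y : x - pi <= y <= x + pi -> P y = P x.
  have e : P (x + pi) <= P (x - pi).
    rewrite -subr_le0; move: I0; rewrite (int_circ_primitive (x - pi) ch ph).
    by rewrite (_ : x - pi + 2 * pi = x + pi)//; ring.
  have h1 : x - pi <= x by lra.
  have h2 : x <= x + pi by lra.
  move=> /andP[y1 y2]; apply/eqP; rewrite eq_le; apply/andP; split.
    by apply: le_trans (mono _ _ y2) (le_trans e (mono _ _ h1)).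
  by apply: le_trans (mono _ _ h2) (le_trans e (mono _ _ y1)).
have d := primitiveP x ch.
rewrite -(@derive_val _ _ _ _ _ _ _ d) -derive1E.
have -> : derive1 (primitive h) x = derive1 (fun y => P y - P x) x.
  have dB : is_derive x (1 : R) (fun y => P y - (fun=> P x) y) (h x - 0).
    exact: is_deriveB.
  by rewrite !derive1E (@derive_val _ _ _ _ _ _ _ d) (@derive_val _ _ _ _ _ _ _ dB) subr0.
apply: near_zero_derive1; near=> y; rewrite cst ?subrr//.
apply/andP; split; apply: ltW; near: y.
  by apply: lt_nbhsr; rewrite ltrBlDr ltrDl.
by apply: lt_nbhsl; rewrite ltrDl.
Unshelve. all: by end_near. Qed.

(** Sliding averages: continuously differentiable test functions obtained from
    continuous ones, whose derivatives are difference quotients. *)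
Definition steklov (e : R) A (x : R) : R := (primitive A (x + e) - primitive A x) / e.

Lemma steklov_derive e A (x : R) : continuous A ->
  is_derive x (1 : R) (steklov e A) ((A (x + e) - A x) / e).
Proof.
move=> cA; have h1 := is_derive_shift (primitiveP (x + e) cA).
have h2 := is_deriveB h1 (primitiveP x cA).
have h : is_derive x (1 : R) (fun z => e^-1 *: (primitive A (z + e) - primitive A z))
    (e^-1 *: (A (x + e) - A x)) by exact: is_deriveZ.
have -> : steklov e A = (fun z => e^-1 *: (primitive A (z + e) - primitive A z)).
  by apply/funext => z; rewrite /steklov mulrC.
by apply: (is_derive_eq h); rewrite mulrC.
Qed.

Lemma derive1_steklov e A x : continuous A ->
  derive1 (steklov e A) x = (A (x + e) - A x) / e.
Proof.
by move=> cA; rewrite derive1E; exact: (@derive_val _ _ _ _ _ _ _ (steklov_derive e x cA)).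
Qed.

Lemma continuous_shift A c : continuous A -> continuous (fun x => A (x + c)).
Proof.
move=> cA x; apply: (@continuous_comp _ _ _ (fun x => x + c) A); last exact: cA.
by apply: cvgD; [exact: cvg_id|exact: cvg_cst].
Qed.

Lemma steklov_test e A : continuous A -> periodic A -> test_circ (steklov e A).
Proof.
move=> cA pA; split.
- move=> x; rewrite /steklov; congr (_ / _).
  have H := primitive_period (x + e) x cA pA; rewrite (addrAC x e) in H.
  by rewrite -(addrNK (primitive A (x + e)) (primitive A (x + 2 * pi + e))) H; ring.
- by move=> x; have [] := steklov_derive e x cA.
- rewrite (_ : derive1 _ = fun x => (A (x + e) - A x) / e); last first.
    by apply/funext => x; exact: derive1_steklov.
  move=> x; apply: cvgM; last exact: cvg_cst.
  by apply: cvgB; [exact: continuous_shift|exact: cA].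
Qed.

Lemma steklov_close e A x (w : R) : 0 < e -> continuous A ->
  (forall z, x <= z <= x + e -> `|A z - A x| <= w) -> `|steklov e A x - A x| <= w.
Proof.
move=> e0 cA H.
have d z : is_derive z (1 : R) (fun z => primitive A z - A x * z) (A z - A x).
  have h2 : is_derive z (1 : R) (fun z => A x * z) (A x) by exact: is_derive_mulx.
  exact: is_deriveB (primitiveP z cA) h2.
have xe : x <= x + e by rewrite lerDl ltW.
have := @mvt_bound R _ _ x (x + e) w d.
have -> : Num.min x (x + e) = x by apply/min_idPl.
have -> : Num.max x (x + e) = x + e by apply/max_idPr.
move=> /(_ H); have -> : x + e - x = e by ring.
rewrite (ger0_norm (ltW e0)) => h.
have -> : steklov e A x - A x =
    (primitive A (x + e) - A x * (x + e) - (primitive A x - A x * x)) / e.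
  by rewrite /steklov; field; rewrite gt_eqF.
by rewrite normrM normfV (ger0_norm (ltW e0)) ler_pdivrMr.
Qed.

Lemma steklov_ge0 e A x : 0 < e -> continuous A -> (forall z, 0 <= A z) ->
  0 <= steklov e A x.
Proof.
move=> e0 cA A0; rewrite /steklov divr_ge0 ?(ltW e0)// -ftc_primitive//.
  exact: Rintegral_ge0.
by rewrite lerDl ltW.
Qed.

Lemma int_steklov e A : 0 < e -> continuous A -> periodic A ->
  int_circ (steklov e A) = int_circ A.
Proof.
move=> e0 cA pA; have cP := is_derive_continuous (fun x => primitiveP x cA).
pose Q := primitive (primitive A); have p0 := ltW (@pi2_gt0 R).
have dQ x : is_derive x (1 : R) Q (primitive A x) by exact: primitiveP.
have dS x : is_derive x (1 : R) (fun x => e^-1 *: (Q (x + e) - Q x)) (steklov e A x).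
  have h1 := is_derive_shift (dQ (x + e)).
  have h2 := is_deriveB h1 (dQ x).
  have h : is_derive x (1 : R) (fun z => e^-1 *: (Q (z + e) - Q z))
    (e^-1 *: (primitive A (x + e) - primitive A x)) by exact: is_deriveZ.
  by apply: (is_derive_eq h); rewrite /steklov mulrC.
have cS : continuous (steklov e A).
  exact: is_derive_continuous (fun x => steklov_derive e x cA).
rewrite {1}/int_circ (ftc_C1 p0 dS cS) /GRing.scale /=.
have dH x : is_derive x (1 : R) (fun x => Q (x + 2 * pi) - Q x - int_circ A * x) 0.
  have h1 := is_derive_shift (dQ (x + 2 * pi)).
  have h2 := is_deriveB h1 (dQ x).
  have h := is_deriveB h2 (is_derive_mulx (int_circ A) x).
  by apply: (is_derive_eq h); rewrite (int_circ_primitive x cA pA) subrr.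
have H := zero_derive_const e 0 dH; rewrite /= mulr0 subr0 in H.
rewrite -mulrBr add0r; apply: (canLR (mulKf _)); first by rewrite gt_eqF.
rewrite (mulrC e) (addrC (2 * pi) e); rewrite (addrC e) in H.
move: H; rewrite (addrC (2 * pi) e) !add0r => H.
rewrite (_ : _ - (Q e - Q 0) = Q (e + 2 * pi) - Q e - (Q (2 * pi) - Q 0)); last by ring.
by rewrite -H; ring.
Qed.

End Primitive.

(** * Weak derivatives on the circle *)

Section WeakDerivative.
Context {R : realType}.
Local Notation leb := (@lebesgue_measure R).
Implicit Types (u v psi eta : R -> R).

Lemma test_cosk n : test_circ (fun x : R => cos (n%:R * x)).
Proof.
have [s c] := @sin_cos_2pin R n; split.
- by move=> x; rewrite mulrDr cosD s c mulr1 mulr0 subr0.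
- by move=> x; have [] := is_derive_cosk n%:R x.
- rewrite (_ : derive1 _ = fun x => - n%:R * sin (n%:R * x)); last first.
    by apply/funext => x; rewrite derive1E; exact: (@derive_val _ _ _ _ _ _ _ (is_derive_cosk n%:R x)).
  by move=> x; apply: cvgM; [exact: cvg_cst|exact: continuous_sink].
Qed.

Lemma test_sink n : test_circ (fun x : R => sin (n%:R * x)).
Proof.
have [s c] := @sin_cos_2pin R n; split.
- by move=> x; rewrite mulrDr sinD s c mulr1 mulr0 addr0.
- by move=> x; have [] := is_derive_sink n%:R x.
- rewrite (_ : derive1 _ = fun x => n%:R * cos (n%:R * x)); last first.
    by apply/funext => x; rewrite derive1E; exact: (@derive_val _ _ _ _ _ _ _ (is_derive_sink n%:R x)).
  by move=> x; apply: cvgM; [exact: cvg_cst|exact: continuous_cosk].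
Qed.

Lemma derive1_cosk (k x : R) : derive1 (fun x : R => cos (k * x)) x = - k * sin (k * x).
Proof. by rewrite derive1E; exact: (@derive_val _ _ _ _ _ _ _ (is_derive_cosk k x)). Qed.

Lemma derive1_sink (k x : R) : derive1 (fun x : R => sin (k * x)) x = k * cos (k * x).
Proof. by rewrite derive1E; exact: (@derive_val _ _ _ _ _ _ _ (is_derive_sink k x)). Qed.

(** Sines and cosines are admissible test functions. *)
Lemma weak_fourier u v (n : nat) : sqi leb circ u -> is_weak_deriv u v ->
  fourier_sqmod v (Posz n) = n%:R ^+ 2 * fourier_sqmod u (Posz n).
Proof.
move=> qu [_ H]; have mc := @mcirc R.
have Hc := H _ (test_cosk n); have Hs := H _ (test_sink n).
have ec : int_circ (fun x => v x * cos (n%:R * x)) =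
    n%:R * int_circ (fun x => u x * sin (n%:R * x)).
  rewrite -[LHS]opprK -Hc /int_circ -RintegralZl//; last by apply: sqiM => //; exact: sin_sqi.
  rewrite -RintN//; last first.
    have := igZ (- n%:R) mc (sqiM mc qu (sin_sqi n%:R)).
    by apply: eq_ig => // x _; rewrite derive1_cosk mulrCA.
  by apply: eq_Rintegral => x _; rewrite derive1_cosk; ring.
have es : int_circ (fun x => v x * sin (n%:R * x)) =
    - (n%:R * int_circ (fun x => u x * cos (n%:R * x))).
  rewrite -[LHS]opprK -Hs /int_circ -RintegralZl//; last by apply: sqiM => //; exact: cos_sqi.
  by congr (- _); apply: eq_Rintegral => x _; rewrite derive1_sink mulrCA.
rewrite /fourier_sqmod /fourier_cos /fourier_sin ec es.
by ring.
Qed.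

Lemma continuous_C1 psi : test_circ psi -> continuous psi.
Proof.
move=> [_ d _] x; apply: differentiable_continuous.
by apply/derivable1_diffP; exact: d.
Qed.

Lemma continuous_sqi u : continuous u -> sqi leb circ u.
Proof.
move=> cu; split; first exact: continuous_mfun1.
by apply: continuous_ig; exact: continuous_sq.
Qed.

Lemma continuous_L2 u : continuous u -> periodic u -> L2_circ u.
Proof.
move=> cu pu; split => //; first exact: continuous_mfun1.
by rewrite /L2sq_circ sqi_EFin ?ltry//; [exact: mcirc|exact: continuous_sqi].
Qed.

Lemma derive1_periodic psi : periodic psi -> periodic (derive1 psi).
Proof.
move=> per x; rewrite /derive1.
rewrite (_ : (fun h : R => h^-1 *: (psi (h + (x + 2 * pi)) - psi (x + 2 * pi))) =
  (fun h : R => h^-1 *: (psi (h + x) - psi x)))//.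
by apply/funext => h; rewrite addrA !per.
Qed.

Lemma is_derive_C1 psi x : test_circ psi -> is_derive x (1 : R) psi (derive1 psi x).
Proof. by move=> [_ d _]; rewrite derive1E; exact: DeriveDef. Qed.

Lemma C1_weak_deriv psi : test_circ psi -> is_weak_deriv psi (derive1 psi).
Proof.
move=> tp; have cp := continuous_C1 tp; have [pp _ dp] := tp; have mc := @mcirc R.
split.
  split; first exact: derive1_periodic.
  exact: continuous_ig.
move=> eta te; have ce := continuous_C1 te; have [pe _ de] := te.
have d x : is_derive x (1 : R) (psi * eta) (psi x * derive1 eta x + derive1 psi x * eta x).
  have h := is_deriveM (is_derive_C1 x tp) (is_derive_C1 x te).
  by apply: (is_derive_eq h); rewrite /GRing.scale /= (mulrC (eta x)).
have c1 : continuous (fun x => psi x * derive1 eta x) by exact: continuousM2.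
have c2 : continuous (fun x => derive1 psi x * eta x) by exact: continuousM2.
have c : continuous (fun x => psi x * derive1 eta x + derive1 psi x * eta x).
  by move=> x; apply: cvgD; [exact: c1|exact: c2].
have := ftc_C1 (ltW (@pi2_gt0 R)) d c.
have -> : (psi * eta) (2 * pi) - (psi * eta) 0 = 0.
  have e1 := pp 0; have e2 := pe 0; rewrite add0r in e1; rewrite add0r in e2.
  by rewrite [(psi * eta) _]/(psi _ * eta _) e1 e2 subrr.
rewrite RintegralD//; [|exact: continuous_ig|exact: continuous_ig].
by move=> /eqP; rewrite addr_eq0 => /eqP.
Qed.

(** The weight of order one half is dominated by the weight of order one, whose
    sum is controlled by the weak derivative. *)
Lemma weak_H_half u v : L2_circ u -> is_weak_deriv u v -> sqi leb circ v -> H_half u.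
Proof.
move=> L2u wv qv; split => //; have mc := @mcirc R.
have qu : sqi leb circ u by case: L2u => _ mu fu; exact: sqi_lty.
pose S := \int[leb]_(x in circ) (u x ^+ 2) + \int[leb]_(x in circ) (v x ^+ 2).
have S0 : 0 <= S by rewrite /S addr_ge0// Rint_sq_ge0.
have B2 : Num.sqrt (4 * S) ^+ 2 / 2 = 2 * S by rewrite sqr_sqrtr ?mulr_ge0//; field.
have : (hs_norm 2^-1 u <= (Num.sqrt (4 * S))%:E)%E.
  apply: weighted_norm_le => //.
  - exact: hs_weight_ge0.
  - exact: hs_weightN.
  - move=> K; rewrite B2.
    have a01 : 0 <= (2^-1 : R) <= 1 by rewrite invr_ge0 invf_le1 ?ler1n// ler0n.
    have s0 n : 0 <= fourier_sqmod u (Posz n) by exact: fourier_sqmod_ge0.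
    apply: le_trans (interp_pos K a01 (lexx 1) s0) _.
    rewrite !powR1 !mul1r mulr_natl mulr2n lerD//.
      by apply: le_trans (bessel_fourier K qu) _; rewrite lerDl Rint_sq_ge0.
    by apply: sum_br_le => // n; exact: weak_fourier.
by move=> /le_lt_trans; apply; rewrite ltry.
Qed.

Lemma test_H_half psi : test_circ psi -> H_half psi.
Proof.
move=> tp; have [pp _ dp] := tp; apply: (weak_H_half _ (C1_weak_deriv tp)).
  by apply: continuous_L2 => //; exact: continuous_C1.
exact: continuous_sqi.
Qed.

(** Testing the weak derivative against a sliding average moves the difference
    quotient onto [u]; choosing the positive part of the defect as density
    yields the Lipschitz bound. *)
Lemma weak_lipschitz_half u v (L e : R) (x : R) (sg : R) : sg ^+ 2 = 1 -> continuous u ->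
  periodic u -> is_weak_deriv u v -> {ae leb, forall x, `|v x| <= L} -> 0 < e ->
  sg * (u (x - e) - u x) <= L * e.
Proof.
move=> sg1 cu pu [[pv iv] H] vL e0; have mc := @mcirc R.
(* A = max(w, 0) vanishes exactly where the Lipschitz bound at distance e holds. *)
pose w x := sg * (u (x - e) - u x) - L * e.
pose A x := Num.max (w x) 0.
have cs : continuous (fun x => u (x - e)) by exact: continuous_shift.
have cw : continuous w.
  move=> y; apply: cvgB; last exact: cvg_cst.
  by apply: cvgM; [exact: cvg_cst|apply: cvgB; [exact: cs|exact: cu]].
have cA : continuous A.
  move=> y; apply: (@continuous_comp _ _ _ w (fun z => Num.max z 0)); first exact: cw.
  exact: continuous_max0.
have pw : periodic w by move=> y; rewrite /w pu (addrAC y) pu.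
have pA : periodic A by move=> y; rewrite /A pw.
have A0 y : 0 <= A y by rewrite /A le_max lexx orbT.
have ts := steklov_test e cA pA.
have := H _ ts.
have cAs : continuous (fun x => A (x + e)) by exact: continuous_shift.
have i1 : ig leb circ (fun x => u x * A (x + e)).
  by apply: continuous_ig; exact: continuousM2.
have i2 : ig leb circ (fun x => u x * A x).
  by apply: continuous_ig; exact: continuousM2.
have i3 : ig leb circ (fun x => u (x - e) * A x).
  by apply: continuous_ig; exact: continuousM2.
have -> : int_circ (fun x => u x * derive1 (steklov e A) x) =
    e^-1 * int_circ (fun x => (u (x - e) - u x) * A x).
  rewrite (_ : int_circ _ = int_circ (fun x => e^-1 * (u x * A (x + e) - u x * A x))); last first.
    by apply: eq_Rintegral => y _; rewrite derive1_steklov//; ring.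
  rewrite /int_circ RintegralZl//; last exact: igB.
  congr (_ * _); rewrite RintegralB//.
  rewrite (_ : \int[leb]_(x in circ) ((_ - _) * _) = \int[leb]_(x in circ)
     (u (x - e) * A x - u x * A x)); last by apply: eq_Rintegral => y _; rewrite mulrBl.
  rewrite RintegralB//; congr (_ - _).
  have := @int_circ_shift R (fun x => u (x - e) * A x) e _ _.
  rewrite /int_circ => <-.
  - by apply: eq_Rintegral => y _; rewrite addrK.
  - exact: continuousM2.
  - by move=> y; rewrite addrAC pu pA.
move=> HH.
have cS : continuous (steklov e A) by exact: continuous_C1 ts.
have S0 y : 0 <= steklov e A y by exact: steklov_ge0.
have iS : ig leb circ (steklov e A) by exact: continuous_ig.
have [BS HBS] := continuous_bnd (segment_compact (a := 0) (b := 2 * pi)) cS.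
have ivS : ig leb circ (fun x => v x * steklov e A x).
  have := igM_bounded mc (continuous_mfun1 cS) HBS iv.
  by apply: eq_ig => // y _; exact: mulrC.
have bound : `|int_circ (fun x => v x * steklov e A x)| <= L * int_circ A.
  rewrite -(int_steklov e0 cA pA) /int_circ -RintegralZl//.
  apply: le_trans (le_normr_Rintegral mc ivS) _.
  rewrite /Rintegral fine_le//.
  - by apply: integrable_fin_num => //; exact: integrable_norm.
  - by apply: integrable_fin_num => //; exact: igZ.
  apply: ae_ge0_le_integral.
  - exact: mc.
  - by move=> y _; rewrite lee_fin.
  - apply/measurable_EFinP; apply: measurableT_comp => //.
    exact: ig_meas ivS.
  - move=> y _; rewrite lee_fin mulr_ge0//.
    have [N [_ N0 sub]] := vL; apply: contrapT => /negP; rewrite -ltNge => L0.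
    have : N = setT.
      apply/seteqP; split => // z _; apply: sub => /= h.
      by have := le_lt_trans (le_trans (normr_ge0 _) h) L0; rewrite ltxx.
    move=> NT; move: N0; rewrite NT => N0.
    have : (leb `[0%R, 1%R]%classic <= leb setT)%E.
      by apply: le_measure; rewrite ?inE//.
    by rewrite N0 lebesgue_measure_itv/= lte_fin ltr01 -EFinB subr0 lee_fin ler10.
  - by apply/measurable_EFinP; exact: (ig_meas (igZ L mc iS)).
  - apply: ae_imp vL => y vy _; rewrite lee_fin normrM (ger0_norm (S0 y)).
    by rewrite ler_wpM2r.
have iA : ig leb circ A by exact: continuous_ig.
have cA2 : continuous (fun x => A x ^+ 2) by exact: continuous_sq.
(* A^2 = A w, and pairing w with A is what the weak derivative controls. *)
have AA : int_circ (fun x => A x ^+ 2) <= 0.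
  have -> : int_circ (fun x => A x ^+ 2) =
      sg * int_circ (fun x => (u (x - e) - u x) * A x) - L * e * int_circ A.
    have c3 : continuous (fun x => (u (x - e) - u x) * A x).
      apply: continuousM2 => // y; apply: cvgB; [exact: cs|exact: cu].
    rewrite /int_circ -!RintegralZl//; last exact: continuous_ig.
    rewrite -RintegralB//; [|by apply: igZ => //; exact: continuous_ig|exact: igZ].
    apply: eq_Rintegral => y _; rewrite /A /w; have [h|h] := leP _ 0.
      by rewrite expr0n !mulr0 subr0.
    by ring.
  have -> : int_circ (fun x => (u (x - e) - u x) * A x) =
      - (e * int_circ (fun x => v x * steklov e A x)).
    by rewrite -mulrN -HH mulrA divff ?mul1r// gt_eqF.
  have sgn : `|sg| = 1.
    by apply/eqP; rewrite -sqrp_eq1 ?normr_ge0// real_normK ?num_real// sg1.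
  rewrite subr_le0; apply: le_trans (ler_norm _) _.
  rewrite normrM sgn mul1r normrN normrM (ger0_norm (ltW e0)).
  by have := ler_wpM2l (ltW e0) bound; rewrite mulrA (mulrC e L).
have pA2 : periodic (fun x => A x ^+ 2) by move=> y; rewrite pA.
have := periodic_zero x cA2 pA2 (fun y => sqr_ge0 (A y)) AA.
move=> /eqP; rewrite sqrf_eq0 => /eqP Ax.
have : w x <= A x by rewrite /A le_max lexx.
by rewrite Ax /w subr_le0.
Qed.

(** Both signs of the difference are covered by the choice of [sg]. *)
Lemma weak_lipschitz u v (L : R) : continuous u -> periodic u ->
  is_weak_deriv u v -> {ae leb, forall x, `|v x| <= L} ->
  forall x y, `|u x - u y| <= L * `|x - y|.
Proof.
move=> cu pu wv vL.
have main x e : 0 < e -> `|u (x - e) - u x| <= L * e.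
  move=> e0; rewrite ler_norml; apply/andP; split.
    rewrite lerNl -mulN1r.
    by apply: (weak_lipschitz_half _ _ cu pu wv vL e0); rewrite sqrrN expr1n.
  rewrite -[leLHS]mul1r.
  by apply: (weak_lipschitz_half _ _ cu pu wv vL e0); rewrite expr1n.
move=> x y; have [xy|yx|->] := ltgtP x y; last by rewrite !subrr !normr0 mulr0.
  have := main y (y - x); rewrite subr_gt0 => /(_ xy); rewrite subKr.
  by rewrite (distrC x y) (ger0_norm (_ : 0 <= y - x))// subr_ge0 ltW.
have := main x (x - y); rewrite subr_gt0 => /(_ yx); rewrite subKr distrC.
by rewrite (ger0_norm (_ : 0 <= x - y))// subr_ge0 ltW.
Qed.

(** The set where the bound fails is open, so if nonempty it has positive
    measure. *)
Lemma ae_bound_continuous (h : R -> R) (a C : R) :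
  (forall t, a < t -> {for t, continuous h}) ->
  {ae leb, forall t, a < t -> h t <= C} -> forall t, a < t -> h t <= C.
Proof.
move=> ch [N [mN N0 sub]] t at_; rewrite leNgt; apply/negP => Ct.
have : \forall z \near t, a < z /\ C < h z.
  near=> z; split; near: z; first exact: lt_nbhsr.
  exact: (cvgr_gt (h t) (ch t at_)).
move=> /nbhs_ballP [e /= e0 H].
have sub2 : `]t - e, t + e[%classic `<=` N.
  move=> z /=; rewrite in_itv /= => /andP[z1 z2]; apply: sub => /= hz.
  have [az Cz] : a < z /\ C < h z.
    by apply: H; rewrite /ball /= ltr_norml; apply/andP; split; lra.
  by have := lt_le_trans Cz (hz az); rewrite ltxx.
pose I : set R := `]t - e, t + e[%classic.
have : (leb I <= leb N)%E.
  by apply: le_measure; rewrite ?inE//; exact: measurable_itv.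
have te : t - e < t + e by lra.
rewrite N0 /I lebesgue_measure_itv/= lte_fin te -EFinB lee_fin.
have -> : t + e - (t - e) = 2 * e by ring.
by rewrite leNgt mulr_gt0.
Unshelve. all: by end_near. Qed.

Lemma ess_bound (v : R -> R) (L : R) : (Linf_norm v <= L%:E)%E ->
  {ae leb, forall x, `|v x| <= L}.
Proof.
move=> vL; have := @ess_sup_ge _ _ _ leb (fun x => `|v x|%:E).
by apply: ae_imp => x /le_trans /(_ vL); rewrite lee_fin.
Qed.

Lemma ae_sqi (v : R -> R) (L : R) : ig leb circ v ->
  {ae leb, forall x, `|v x| <= L} -> sqi leb circ v /\
  \int[leb]_(x in circ) (v x ^+ 2) <= L ^+ 2 * (2 * pi).
Proof.
move=> iv vL; have mc := @mcirc R; have mv := ig_meas iv.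
have h : (\int[leb]_(x in circ) ((v x) ^+ 2)%:E <= (L ^+ 2 * (2 * pi))%:E)%E.
  apply: (@le_trans _ _ (\int[leb]_(x in circ) (cst (L ^+ 2)%:E) x)%E); last first.
    have f2 : (leb circ <= (2 * pi)%:E)%E.
      by rewrite -circ_mass fineK// ge0_fin_numE// circ_lty.
    rewrite integral_cst// (EFinM (L ^+ 2) (2 * pi)); apply: lee_wpmul2l; last exact: f2.
    by rewrite lee_fin sqr_ge0.
  apply: ae_ge0_le_integral.
  - exact: mc.
  - by move=> x _; rewrite lee_fin sqr_ge0.
  - by apply/measurable_EFinP; exact: measurable_funX.
  - by move=> x _; rewrite lee_fin sqr_ge0.
  - exact: measurable_cst.
  - apply: ae_imp vL => x vx _; rewrite lee_fin -[v x ^+ 2]real_normK ?num_real//.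
    by rewrite ler_sqr ?nnegrE// (le_trans _ vx).
have qv : sqi leb circ v by apply: sqi_lty => //; apply: le_lt_trans h _; rewrite ltry.
by split => //; rewrite -lee_fin -sqi_EFin.
Qed.

End WeakDerivative.

(** * From weak derivatives in time to increments *)

Section TimeCalculus.
Context {R : realType}.
Local Notation leb := (@lebesgue_measure R).
Local Notation leb2 := (@lebesgue_measure R \x @lebesgue_measure R)%E.

Lemma Rint_ae_le d (T : measurableType d) (mu : {measure set T -> \bar R})
    (D N : set T) (f g : T -> R) : measurable D -> ig mu D f -> ig mu D g ->
  measurable N -> mu N = 0%E -> (forall x, D x -> ~ N x -> f x <= g x) ->
  \int[mu]_(x in D) f x <= \int[mu]_(x in D) g x.
Proof.
move=> mD iF iG mN N0 fg.
have e h : ig mu D h -> \int[mu]_(x in D) h x = \int[mu]_(x in D `\` N) h x.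
  by move=> ih; rewrite /Rintegral (negligible_integral mN).
rewrite (e f iF) (e g iG).
have mDN : measurable (D `\` N) by exact: measurableD.
apply: le_Rintegral => //.
- by apply: igS iF => //; exact: subDsetl.
- by apply: igS iG => //; exact: subDsetl.
- by move=> x [Dx nN]; exact: fg.
Qed.

(** Dominated convergence: near a given time the integrand is bounded on the
    compact circle. *)
Lemma continuous_int_circ (k : R * R -> R) : continuous k ->
  continuous (fun t => int_circ (fun x => k (x, t))).
Proof.
move=> ck t; have [B HB] := continuous_bnd (@compact_box R 0 (2 * pi) (t - 1) (t + 1)) ck.
have tin : t \in `](t - 1), (t + 1)[%classic.
  by rewrite inE /= in_itv /=; apply/andP; split; lra.
have mc := @mcirc R.
apply: (@continuity_under_integral R _ _ leb (fun t x => k (x, t)) circ mc (t - 1) (t + 1)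
   _ _ (fun=> B) _ _ t tin).
- by move=> s _; apply: continuous_ig; exact: continuous_row.
- by apply: aeW => x _ s _; exact: continuous_col.
- by apply: ig_cst => //; exact: circ_lty.
- move=> s /=; rewrite in_itv /= => /andP[s1 s2]; apply: aeW => x cx.
  by apply: HB; split => //=; rewrite in_itv /= !ltW.
Qed.

(** Cutting the interval into [n] equal pieces bounds the total increment by
    [C (b - a)^2 / n]. This replaces differentiation almost everywhere of a
    Lipschitz function. *)
Lemma quadratic_increments (z : R -> R) (a b C : R) : a <= b ->
  (forall s t, a <= s -> s <= t -> t <= b -> z t - z s <= C * (t - s) ^+ 2) ->
  z b <= z a.
Proof.
move=> ab H; have ba0 : 0 <= b - a by rewrite subr_ge0.
have key (n : nat) : z b - z a <= C * (b - a) ^+ 2 / n.+1%:R.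
  pose h := (b - a) / n.+1%:R; have n0 : 0 < n.+1%:R :> R by rewrite ltr0n.
  have h0 : 0 <= h by rewrite divr_ge0// ltW.
  have hn : n.+1%:R * h = b - a by rewrite /h mulrC divfK// gt_eqF.
  have step j : (j <= n.+1)%N -> z (a + j%:R * h) - z a <= j%:R * (C * h ^+ 2).
    elim: j => [_|j IH jn]; first by rewrite !mul0r addr0 subrr.
    have H2 := IH (ltnW jn).
    have e : a + j.+1%:R * h - (a + j%:R * h) = h by rewrite -natr1; ring.
    have h1 : z (a + j.+1%:R * h) - z (a + j%:R * h) <= C * h ^+ 2.
      have := H (a + j%:R * h) (a + j.+1%:R * h); rewrite e; apply.
      - by rewrite lerDl mulr_ge0.
      - by rewrite -subr_ge0 e.
      - by rewrite -lerBrDl -hn ler_wpM2r// ler_nat.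
    rewrite -(subrKA (z (a + j%:R * h))) addrC -[X in X * (C * _)]natr1 mulrDl mul1r.
    exact: lerD.
  have := step n.+1 (leqnn _); rewrite hn subrKC => /le_trans; apply.
  rewrite /h le_eqVlt; apply/orP; left; apply/eqP; field.
  by rewrite gt_eqF.
rewrite -subr_le0; apply/ler_addgt0Pr => e e0; rewrite add0r.
set D := C * (b - a) ^+ 2 in key *.
have [D0|D0] := leP D 0.
  apply: le_trans (key 0%N) _; rewrite divr1 (le_trans D0)//; exact: ltW.
have [n Hn] : exists n : nat, D / e < n%:R.
  by exists (Num.truncn (D / e)).+1; exact: truncnS_gt.
apply: le_trans (key n) _; rewrite ler_pdivrMr ?ltr0n//.
move: Hn; rewrite ltr_pdivrMr// => /ltW /le_trans; apply.
by rewrite mulrC ler_wpM2l ?(ltW e0)// ler_nat.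
Qed.

(** A smooth indicator of the time interval, with slopes of width [dl] inside its
    ends; [ramp] is the derivative of one slope and has integral 1. *)
Definition trapezoid (s t dl tau : R) : R :=
  step ((tau - s) / dl) - step ((tau - (t - dl)) / dl).

Definition ramp (s dl tau : R) : R := tent ((tau - s) / dl) / dl.

Lemma step_shift_derive (s dl tau : R) :
  is_derive tau (1 : R) (fun tau => step ((tau - s) / dl)) (ramp s dl tau).
Proof.
have h1 : is_derive tau (1 : R) (fun tau => (tau - s) / dl) dl^-1.
  have -> : (fun tau => (tau - s) / dl) = (fun tau => dl^-1 * (tau + - s)).
    by apply/funext => z; rewrite mulrC.
  have h := is_derive_shift (is_derive_mulx dl^-1 (tau + - s)).
  exact: h.
have h3 := @is_derive1_comp R step (fun tau => (tau - s) / dl) tau _ _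
  (is_derive_step ((tau - s) / dl)) h1.
exact: (is_derive_eq h3).
Qed.

Lemma trapezoid_derive (s t dl tau : R) :
  is_derive tau (1 : R) (trapezoid s t dl) (ramp s dl tau - ramp (t - dl) dl tau).
Proof. exact: is_deriveB (step_shift_derive s dl tau) (step_shift_derive (t - dl) dl tau). Qed.

Lemma continuous_ramp (s dl : R) : continuous (ramp s dl).
Proof.
move=> tau; apply: cvgM; last exact: cvg_cst.
apply: (@continuous_comp _ _ _ (fun tau => (tau - s) / dl) tent); last exact: continuous_tent.
by apply: cvgM; [apply: cvgB; [exact: cvg_id|exact: cvg_cst]|exact: cvg_cst].
Qed.

Lemma ramp_ge0 (s dl tau : R) : 0 < dl -> 0 <= ramp s dl tau.
Proof. by move=> d0; rewrite divr_ge0 ?tent_ge0// ltW. Qed.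

Lemma ramp0 (s dl tau : R) : 0 < dl -> tau <= s \/ s + dl <= tau -> ramp s dl tau = 0.
Proof.
move=> d0 H; rewrite /ramp tent_eq0 ?mul0r//; case: H => h; [left|right].
  by rewrite ler_pdivrMr// mul0r; lra.
by rewrite ler_pdivlMr// mul1r; lra.
Qed.

Lemma trapezoid_itv (s t dl tau : R) : 0 < dl -> s + dl <= t - dl ->
  0 <= trapezoid s t dl tau <= 1.
Proof.
move=> d0 sd; rewrite /trapezoid.
have /andP[a1 a2] := step_itv ((tau - s) / dl).
have /andP[b1 b2] := step_itv ((tau - (t - dl)) / dl).
have [h|h] := leP tau (t - dl).
  rewrite [X in _ - X]step_le0 ?subr0 ?a1//.
  by rewrite ler_pdivrMr// mul0r; lra.
rewrite step_ge1; last by rewrite ler_pdivlMr// mul1r; lra.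
by apply/andP; split; lra.
Qed.

Lemma trapezoid0 (s t dl tau : R) : 0 < dl -> s + dl <= t - dl ->
  tau <= s \/ t <= tau -> trapezoid s t dl tau = 0.
Proof.
move=> d0 sd [h|h]; rewrite /trapezoid.
  rewrite !step_le0 ?subrr// ler_pdivrMr// mul0r; lra.
by rewrite !step_ge1 ?subrr// ler_pdivlMr// mul1r; lra.
Qed.

Lemma trapezoid1 (s t dl tau : R) : 0 < dl -> s + dl <= tau <= t - dl ->
  trapezoid s t dl tau = 1.
Proof.
move=> d0 /andP[h1 h2]; rewrite /trapezoid step_ge1 ?step_le0 ?subr0//.
  by rewrite ler_pdivrMr// mul0r; lra.
by rewrite ler_pdivlMr// mul1r; lra.
Qed.

Lemma continuous_trapezoid (s t dl : R) : continuous (trapezoid s t dl).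
Proof. exact: is_derive_continuous (fun x => trapezoid_derive s t dl x). Qed.

Lemma ramp_average (h : R -> R) (a b s dl w : R) : continuous h -> 0 < dl ->
  a <= s -> s + dl <= b ->
  (forall tau, s <= tau <= s + dl -> `|h tau - h s| <= w) ->
  `|\int[leb]_(tau in `[a, b]%classic) (ramp s dl tau * h tau) - h s| <= w.
Proof.
move=> ch d0 as_ sb H; have cr := @continuous_ramp s dl.
have ab : a <= b by lra.
have mass : \int[leb]_(tau in `[a, b]%classic) ramp s dl tau = 1.
  rewrite (ftc_C1 ab (fun x => step_shift_derive s dl x) cr).
  rewrite step_ge1 ?step_le0 ?subr0//.
    by rewrite ler_pdivrMr// mul0r; lra.
  by rewrite ler_pdivlMr// mul1r; lra.
have ir : ig leb `[a, b]%classic (ramp s dl) by exact: continuous_ig.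
have ih : ig leb `[a, b]%classic (fun tau => ramp s dl tau * h tau).
  by apply: continuous_ig; exact: continuousM2.
have mab := mitv a b.
have ihs := igZ (h s) mab ir; have iw := igZ w mab ir.
rewrite -[X in _ - X]mulr1 -mass -RintegralZl// -RintegralB//.
rewrite -[leRHS]mulr1 -mass -RintegralZl//.
apply: Rint_bound => //; first exact: igB.
move=> tau _; have [t1|t1] := leP tau s.
  by rewrite ramp0 ?mul0r ?mulr0 ?subrr ?normr0//; left.
have [t2|t2] := leP (s + dl) tau.
  by rewrite ramp0 ?mul0r ?mulr0 ?subrr ?normr0//; right.
rewrite mulrC -mulrBl normrM (ger0_norm (ramp_ge0 _ _ d0)).
by rewrite ler_wpM2r ?ramp_ge0// H// !ltW.
Qed.

Lemma trapezoid_defect (s t dl : R) : 0 < dl -> s + dl <= t - dl ->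
  \int[leb]_(tau in `[s, t]%classic) (1 - trapezoid s t dl tau) <= 2 * dl.
Proof.
move=> d0 sd; have c : continuous (fun tau => 1 - trapezoid s t dl tau).
  by move=> x; apply: cvgB; [exact: cvg_cst|exact: continuous_trapezoid].
have part a b : a <= b -> \int[leb]_(tau in `[a, b]%classic) (1 - trapezoid s t dl tau) <= b - a.
  move=> ab; rewrite -(leb_itv ab) -[leRHS]mul1r -Rintegral_cst; last exact: mitv.
  apply: le_Rintegral; [exact: mitv|exact: continuous_ig| |].
    by apply: ig_cst; [exact: mitv|exact: leb_itv_lty].
  by move=> tau _; have /andP[] := trapezoid_itv tau d0 sd; lra.
have s1 : s <= s + dl by lra.
have s2 : s + dl <= t by lra.
have s3 : t - dl <= t by lra.
rewrite (Rint_split c s1 s2) (Rint_split c sd s3).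
have mid : \int[leb]_(x in `[s + dl, t - dl]%classic) (1 - trapezoid s t dl x) = 0.
  rewrite (_ : \int[leb]_(x in _) _ = \int[leb]_(x in `[s + dl, t - dl]%classic) (cst 0 x)).
    by rewrite Rintegral_cst ?mul0r//; exact: mitv.
  by apply: eq_Rintegral => x; rewrite inE /= in_itv /= => h; rewrite trapezoid1 ?subrr.
rewrite mid add0r; apply: le_trans (lerD (part _ _ s1) (part _ _ s3)) _.
by rewrite le_eqVlt; apply/orP; left; apply/eqP; ring.
Qed.

(** The two slopes of the trapezoid average [h] near the two ends of the interval;
    as they steepen the averages become the values there. *)
Lemma weak_ftc (h k : R -> R) (s t Bk : R) (N : set R) : s < t -> continuous h ->
  ig leb `[s, t]%classic k -> meas1 N -> leb N = 0%E -> 0 <= Bk ->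
  (forall tau, s <= tau <= t -> ~ N tau -> `|k tau| <= Bk) ->
  (forall dl, 0 < dl -> s + dl <= t - dl ->
    \int[leb]_(tau in `[s, t]%classic) (h tau * (ramp s dl tau - ramp (t - dl) dl tau)) =
    - \int[leb]_(tau in `[s, t]%classic) (k tau * trapezoid s t dl tau)) ->
  h t - h s = \int[leb]_(tau in `[s, t]%classic) k tau.
Proof.
move=> st ch ik mN N0 Bk0 kB H; have mst := mitv s t.
apply/eqP; rewrite -subr_eq0 -normr_le0.
apply: (@le_eps _ _ _ (3 + 2 * Bk)); first by rewrite addr_ge0// mulr_ge0.
move=> e e0.
have /cvgrPdist_le /(_ e e0) /nbhs_ballP[r1 /= r10 h1] := ch s.
have /cvgrPdist_le /(_ (e / 2) (divr_gt0 e0 (ltr0n _ 2))) /nbhs_ballP[r2 /= r20 h2] := ch t.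
(* Slopes short enough for h to vary by at most e on them, and for the defect of k to be O(e). *)
pose dl := Num.min (Num.min (r1 / 2) (r2 / 2)) (Num.min ((t - s) / 2) e).
have d0 : 0 < dl by rewrite !lt_min !divr_gt0// subr_gt0.
have dr1 : dl <= r1 / 2 by rewrite /dl !ge_min lexx.
have dr2 : dl <= r2 / 2 by rewrite /dl !ge_min lexx orbT.
have dts : dl <= (t - s) / 2 by rewrite /dl !ge_min lexx !orbT.
have de : dl <= e by rewrite /dl !ge_min lexx !orbT.
have sd : s + dl <= t - dl by lra.
have st' := ltW st.
have R1 : `|\int[leb]_(tau in `[s, t]%classic) (ramp s dl tau * h tau) - h s| <= e.
  apply: ramp_average => //; first by lra.
  move=> tau /andP[t1 t2]; rewrite distrC; apply: h1.
  by rewrite /ball /= ltr_norml; apply/andP; split; lra.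
have R2 : `|\int[leb]_(tau in `[s, t]%classic) (ramp (t - dl) dl tau * h tau) - h (t - dl)| <= e.
  have hh tau : t - dl <= tau <= t -> `|h t - h tau| <= e / 2.
    move=> /andP[t1 t2]; apply: h2.
    by rewrite /ball /= ltr_norml; apply/andP; split; lra.
  apply: ramp_average => //; [by lra|by lra|].
  move=> tau; rewrite subrK => ht.
  have a1 := hh tau ht.
  have a2 : `|h t - h (t - dl)| <= e / 2 by apply: hh; apply/andP; split; lra.
  have := ler_normB (h t - h (t - dl)) (h t - h tau).
  have -> : h t - h (t - dl) - (h t - h tau) = h tau - h (t - dl) by ring.
  move: a1 a2; move: (`|_|) (`|_|) (`|_|) => x1 x2 x3; lra.
have R3 : `|h t - h (t - dl)| <= e.
  apply: (le_trans (h2 _ _)); last by move: e0; lra.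
  by rewrite /ball /= ltr_norml; apply/andP; split; lra.
have cr1 := @continuous_ramp s dl; have cr2 := @continuous_ramp (t - dl) dl.
have i1 : ig leb `[s, t]%classic (fun tau => ramp s dl tau * h tau).
  by apply: continuous_ig; exact: continuousM2.
have i2 : ig leb `[s, t]%classic (fun tau => ramp (t - dl) dl tau * h tau).
  by apply: continuous_ig; exact: continuousM2.
have := H dl d0 sd.
rewrite (_ : \int[leb]_(tau in _) (h tau * _) = \int[leb]_(tau in `[s, t]%classic)
    (ramp s dl tau * h tau - ramp (t - dl) dl tau * h tau)); last first.
  by apply: eq_Rintegral => tau _; ring.
rewrite RintegralB// => HH.
have ct := @continuous_trapezoid s t dl.
have ikt : ig leb `[s, t]%classic (fun tau => trapezoid s t dl tau * k tau).
  apply: (@igM_bounded _ _ _ _ _ _ _ 1) => //; first exact: continuous_mfun1.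
  by move=> tau _; have /andP[a1 a2] := trapezoid_itv tau d0 sd; rewrite ger0_norm.
have R4 : `|\int[leb]_(tau in `[s, t]%classic) k tau -
    \int[leb]_(tau in `[s, t]%classic) (k tau * trapezoid s t dl tau)| <= Bk * (2 * dl).
  rewrite [X in _ - X](_ : _ = \int[leb]_(tau in `[s, t]%classic) (trapezoid s t dl tau * k tau)); last first.
    by apply: eq_Rintegral => tau _; rewrite mulrC.
  have idef : ig leb `[s, t]%classic (fun tau => k tau - trapezoid s t dl tau * k tau) by exact: igB.
  rewrite -RintegralB//; apply: le_trans (le_normr_Rintegral mst idef) _.
  have c1 : continuous (fun tau => 1 - trapezoid s t dl tau).
    by move=> x; apply: cvgB; [exact: cvg_cst|exact: ct].
  have i1t : ig leb `[s, t]%classic (fun tau => 1 - trapezoid s t dl tau) by exact: continuous_ig.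
  apply: le_trans (ler_wpM2l Bk0 (trapezoid_defect d0 sd)).
  rewrite -RintegralZl//; apply: (Rint_ae_le mst _ _ mN N0).
  - exact: integrable_norm.
  - exact: igZ.
  - move=> tau; rewrite /= in_itv /= => ht nN.
    have /andP[a1 a2] := trapezoid_itv tau d0 sd.
    have -> : k tau - trapezoid s t dl tau * k tau = (1 - trapezoid s t dl tau) * k tau by ring.
    have a3 : 0 <= 1 - trapezoid s t dl tau by rewrite subr_ge0.
    by rewrite normrM (ger0_norm a3) mulrC ler_wpM2r// kB.
have R4' : Bk * (2 * dl) <= 2 * Bk * e by rewrite mulrA (mulrC Bk) ler_wpM2l// mulr_ge0.
move: R1 R2 R3 R4 R4' HH.
set I1 := \int[leb]_(tau in _) (ramp s dl tau * _).
set I2 := \int[leb]_(tau in _) (ramp (t - dl) dl tau * _).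
set I3 := \int[leb]_(tau in _) k tau; set I4 := \int[leb]_(tau in _) (k tau * _).
move=> R1 R2 R3 R4 R4' HH; rewrite add0r.
have -> : h t - h s - I3 =
    (h t - h (t - dl)) - (I2 - h (t - dl)) + (I1 - h s) - (I3 - I4).
  have -> : I4 = I2 - I1 by rewrite -[I4]opprK -HH opprB.
  by ring.
apply: le_trans (ler_normB _ _) _.
apply: le_trans (lerD (ler_normD _ _) (lexx _)) _.
apply: le_trans (lerD (lerD (ler_normB _ _) (lexx _)) (lexx _)) _.
apply: le_trans (lerD (lerD (lerD R3 R2) R1) (le_trans R4 R4')) _.
by rewrite le_eqVlt; apply/orP; left; apply/eqP; ring.
Qed.

End TimeCalculus.

(** * The solution at a single time *)

Section Solution.
Context {R : realType}.
Local Notation leb := (@lebesgue_measure R).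
Local Notation leb2 := (@lebesgue_measure R \x @lebesgue_measure R)%E.

Lemma lebT_gt0 : (0 < leb setT)%E.
Proof.
pose I : set R := `[0, 1]%classic.
apply: (@lt_le_trans _ _ (leb I)).
  by rewrite /I lebesgue_measure_itv/= lte_fin ltr01 -EFinB subr0 lte_fin.
by apply: le_measure; rewrite ?inE//; exact: mitv.
Qed.

Lemma Linf_ge0 (v : R -> R) : (0 <= Linf_norm v)%E.
Proof.
rewrite /Linf_norm; apply: ess_sup_gee; first exact: lebT_gt0.
by apply: aeW => x; rewrite lee_fin.
Qed.

Lemma Linf_fin (v : R -> R) : (Linf_norm v < +oo)%E ->
  Linf_norm v = (fine (Linf_norm v))%:E.
Proof. by move=> h; rewrite fineK// ge0_fin_numE// Linf_ge0. Qed.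

Lemma W1inf_fin (v : R -> R) : W1inf v ->
  (Linf_norm v < +oo)%E /\ (Linf_norm (weak_deriv v) < +oo)%E.
Proof.
move=> [_ _]; rewrite /W1inf_norm => h; split; apply: le_lt_trans h.
  by rewrite leeDl// Linf_ge0.
by rewrite leeDr// Linf_ge0.
Qed.

Lemma weak_derivP (v : R -> R) : W1inf v -> is_weak_deriv v (weak_deriv v).
Proof. by move=> [_ [w Hw] _]; rewrite /weak_deriv; apply: (@getPex _ [set z | is_weak_deriv v z]); exists w. Qed.

Variables (f0 : R -> R) (f ft : R * R -> R).
Hypothesis hf0 : W1inf f0.
Hypothesis hf : muskat_solution f0 f ft.

Definition sup_bound := fine (Linf_norm f0).
Definition lip_bound := fine (Linf_norm (weak_deriv f0)).
Definition mean_value := (2 * pi)^-1 * int_circ f0.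
Local Notation M := sup_bound.
Local Notation L := lip_bound.
Local Notation c := mean_value.

Lemma M_ge0 : 0 <= M. Proof. by rewrite fine_ge0// Linf_ge0. Qed.
Lemma L_ge0 : 0 <= L. Proof. by rewrite fine_ge0// Linf_ge0. Qed.

(** Continuity on the closed half space becomes continuity on the plane, so no
    domain has to be carried along. *)
Definition fext (p : R * R) : R := f (p.1, Num.max p.2 0).

Lemma fext_slice t : 0 <= t -> slice f t = (fun x => fext (x, t)).
Proof.
move=> t0; apply/funext => x; rewrite /slice /fext /=.
by have -> : Num.max t 0 = t by apply/max_idPl.
Qed.

Lemma fext_eq p : 0 <= p.2 -> fext p = f p.
Proof.
case: p => x t /= t0; rewrite /fext /=.
by have -> : Num.max t 0 = t by apply/max_idPl.
Qed.

Lemma continuous_fext : continuous fext.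
Proof.
move=> [x t]; have := ms_continuous hf; rewrite subspace_continuousP => wc.
pose q : R * R := (x, Num.max t 0).
have nq : nonneg_times q by rewrite /nonneg_times /= le_max lexx orbT.
have cl : (fun p : R * R => (p.1, Num.max p.2 0)) @ (x, t) --> q.
  have h1 : (fun p : R * R => p.1) @ (x, t) --> x by exact: cvg_fst.
  have h2 : (fun p : R * R => Num.max p.2 0) @ (x, t) --> Num.max t 0.
    apply: (@cvg_comp _ _ _ (fun p : R * R => p.2) (fun s => Num.max s 0) _ (nbhs t)).
      exact: cvg_snd.
    exact: continuous_max0.
  exact: (cvg_pair h1 h2).
move=> A nA; have := wc q nq A nA; rewrite /within /= => H.
have H' : \forall p \near (x, t),
    nonneg_times (p.1, Num.max p.2 0) -> A (f (p.1, Num.max p.2 0)).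
  exact: (cl _ H).
suff : \forall p \near (x, t), A (fext p) by [].
apply: filterS H' => p; apply.
by rewrite /nonneg_times /= le_max lexx orbT.
Qed.

Lemma continuous_slice t : continuous (fun x => fext (x, t)).
Proof. by apply: continuous_row; exact: continuous_fext. Qed.

Lemma periodic_slice t : periodic (fun x => fext (x, t)).
Proof.
move=> x; rewrite /fext /=; apply: (ms_periodic hf).
by rewrite /nonneg_times /= le_max lexx orbT.
Qed.

(** The maximum principle bounds an essential supremum, which for a continuous
    function is a supremum. *)
Lemma sup_le x t : 0 <= t -> `|fext (x, t)| <= M.
Proof.
move=> t0; have [f0fin _] := W1inf_fin hf0.
have H : (Linf_norm (slice f t) <= M%:E)%E.
  rewrite /sup_bound -(Linf_fin f0fin); move: t0; rewrite le_eqVlt => /predU1P[<-|t0].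
    by rewrite (ms_initial hf).
  exact: (ms_max_principle hf t0).
have := ess_bound H; rewrite fext_slice// => ae.
have cn : continuous (fun x => `|fext (x, t)|).
  by move=> z; apply: cvg_norm; exact: continuous_slice.
apply: (@ae_bound_continuous R (fun x => `|fext (x, t)|) (x - 1)).
- by move=> z _; exact: cn.
- by apply: ae_imp ae => z hz _.
- by rewrite ltrBlDr ltrDl.
Qed.

(** Gathers what is known only outside a null set of times. *)
Definition good_time (Bd t : R) :=
  [/\ W1inf (slice f t), (Linf_norm (weak_deriv (slice f t)) <= L%:E)%E,
      sqi leb circ (slice ft t), \int[leb]_(x in circ) (slice ft t x ^+ 2) <= Bd &
      is_DN (slice f t) (slice f t)
        (fun psi => int_circ (fun x => - slice ft t x * psi x))].

Lemma ae_good : exists Bd : R, 0 <= Bd /\ ae_time (good_time Bd).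
Proof.
have [M1 H1] := ms_W1inf hf; have [Bd H2] := ms_dt_L2 hf.
have H3 := ms_equation hf; have H4 := ms_slope hf.
have [_ f0fin] := W1inf_fin hf0.
exists (Num.max Bd 0); split; first by rewrite le_max lexx orbT.
have := ae_and (ae_and H1 H2) (ae_and H3 H4).
apply: ae_imp => t [[h1 h2] [h3 h4]] t0.
have [w1 _] := h1 t0; have [[_ mft fft] b] := h2 t0.
have qft : sqi leb circ (slice ft t) by apply: sqi_lty => //; exact: mcirc.
split => //.
- by rewrite /lip_bound -(Linf_fin f0fin); exact: h4.
- move: b; rewrite /L2sq_circ sqi_EFin//; last exact: mcirc.
  by rewrite lee_fin => b; rewrite le_max b.
- exact: h3.
Qed.

Section GoodTime.
Variables (Bd t : R).
Hypothesis t0 : 0 < t.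
Hypothesis gt : good_time Bd t.
Local Notation u := (slice f t).
Local Notation v := (weak_deriv (slice f t)).

Let eu : u = (fun x => fext (x, t)). Proof. by rewrite fext_slice// ltW. Qed.
Let cu : continuous u. Proof. by rewrite eu; exact: continuous_slice. Qed.
Let pu : periodic u. Proof. by rewrite eu; exact: periodic_slice. Qed.
Let uM x : `|u x| <= M. Proof. by rewrite eu; apply: sup_le; exact: ltW. Qed.
Let wv : is_weak_deriv u v. Proof. by case: gt => w *; exact: weak_derivP. Qed.
Let vL : {ae leb, forall x, `|v x| <= L}.
Proof. by case: gt => _ h *; exact: ess_bound. Qed.

Lemma good_lipschitz x y : `|u x - u y| <= L * `|x - y|.
Proof. exact: weak_lipschitz cu pu wv vL x y. Qed.

Let qv : sqi leb circ v /\ \int[leb]_(x in circ) (v x ^+ 2) <= L ^+ 2 * (2 * pi).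
Proof. by apply: ae_sqi => //; case: wv => -[]. Qed.

Lemma good_sobolev K :
  \sum_(n < K) (1 + (Posz n)%:~R ^+ 2) * fourier_sqmod u (Posz n) <=
  (M ^+ 2 + L ^+ 2) * (2 * pi).
Proof.
have [q1 q2] := qv; have qu := continuous_sqi cu.
apply: le_trans (sum_br_le K _ qu q1) _.
  by move=> n; exact: weak_fourier.
rewrite mulrDl lerD//; have mc := @mcirc R.
rewrite -circ_mass -Rintegral_cst//; apply: le_Rintegral => //.
- by case: qu.
- by apply: ig_cst => //; exact: circ_lty.
- move=> x _; rewrite -[u x ^+ 2]real_normK ?num_real//.
  by rewrite ler_sqr ?nnegrE ?uM// M_ge0.
Qed.

Lemma good_H_half : H_half u.
Proof. by apply: (weak_H_half _ wv); [exact: continuous_L2|case: qv]. Qed.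

Let qft : sqi leb circ (slice ft t). Proof. by case: gt. Qed.

Lemma good_neg psi : continuous psi ->
  int_circ (fun x => - slice ft t x * psi x) =
  - int_circ (fun x => slice ft t x * psi x).
Proof.
move=> cp; rewrite /int_circ -RintN; [|exact: mcirc|].
  by apply: eq_Rintegral => x _; rewrite mulNr.
by apply: sqiM; [exact: mcirc|by []|exact: continuous_sqi].
Qed.

Definition test_const := 4 * (2 * pi * (2 * M + 3)).

(** [E] is the Dirichlet energy of the harmonic extension of the solution. *)
Lemma good_dissipation : exists E : R, [/\ 0 <= E,
  \int[leb]_(x in circ) ((u x - c) ^+ 2) <= 4 * trace_const M * E,
  int_circ (fun x => slice ft t x * u x) <= - E,
  int_circ (slice ft t) = 0 &
  forall (n : nat) (k : R), 0 < k ->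
    `|int_circ (fun x => slice ft t x * cos (n%:R * x))| <=
      2 * k * E + k^-1 * (test_const * (1 + n%:R ^+ 2)) /\
    `|int_circ (fun x => slice ft t x * sin (n%:R * x))| <=
      2 * k * E + k^-1 * (test_const * (1 + n%:R ^+ 2))].
Proof.
have [_ _ _ _ [phi [d1 [d2 [[Hd Ht _ _] HG]]]]] := gt.
pose G psi := int_circ (fun x => - slice ft t x * psi x).
pose E := dirichlet u d1 d2; exists E.
have p0 := @pi2_gt0 R.
have E0 : 0 <= E by apply: Rintegral_ge0 => p _; rewrite addr_ge0// sqr_ge0.
have one : test_circ (cst 1 : R -> R).
  split => //; rewrite (_ : derive1 _ = cst 0); first exact: cst_continuous.
  by apply/funext => x; rewrite derive1_cst.
split => //.
- have -> : c = (2 * pi)^-1 * int_circ u by rewrite /mean_value -(ms_mean hf t0).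
  have := trace_poincare cu uM Hd Ht. exact: id.
- have := energy_le (G := G) cu uM pu good_H_half Hd Ht HG.
  rewrite /G -/E good_neg//; move: (int_circ _) => X h; rewrite -lerN2 opprK.
  exact: h.
- have := DN_one (G := G) cu uM pu Hd HG (test_H_half one).
  rewrite /G good_neg; last exact: cst_continuous.
  move=> /eqP; rewrite oppr_eq0 => /eqP <-.
  by apply: eq_Rintegral => x _; rewrite mulr1.
- move=> n k k0.
  have bound psi : test_circ psi -> (forall x, `|psi x| <= 1) ->
      (forall x, `|derive1 psi x| <= n%:R) ->
      `|int_circ (fun x => slice ft t x * psi x)| <=
        2 * k * E + k^-1 * (test_const * (1 + n%:R ^+ 2)).
    move=> tp b1 b2.
    have := DN_test_le (G := G) cu uM pu Hd HG tp (test_H_half tp) b1 b2 ltr01 k0.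
    rewrite /G good_neg ?normrN; last exact: continuous_C1.
    move=> /le_trans; apply; rewrite -/E lerD2l ler_wpM2l ?invr_ge0 ?(ltW k0)//.
    have -> : M + (M + 2 * 1 + 1) = 2 * M + 3 by ring.
    rewrite /test_const; set W := 2 * pi * (2 * M + 3).
    have W0 : 0 <= W by rewrite mulr_ge0 ?(ltW p0)// addr_ge0// mulr_ge0// M_ge0.
    have -> : 4 * W * (1 + n%:R ^+ 2) = 4 * (1 + n%:R ^+ 2) * W by ring.
    apply: ler_wpM2r => //.
    have -> : (1 * (2 / 1)) ^+ 2 = 4 :> R by rewrite divr1 mul1r; ring.
    rewrite mulrDr mulr1 addrC lerD2l ler_peMl ?sqr_ge0//.
    by rewrite ler1n.
  split; apply: bound.
  + exact: test_cosk.
  + by move=> x; exact: cos_max.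
  + move=> x; rewrite derive1_cosk normrM normrN (ger0_norm (ler0n _ _)).
    by rewrite ler_piMr// sin_max.
  + exact: test_sink.
  + by move=> x; exact: sin_max.
  + move=> x; rewrite derive1_sink normrM (ger0_norm (ler0n _ _)).
    by rewrite ler_piMr// cos_max.
Qed.

End GoodTime.

(** The slope bound holds for almost every time; by continuity in time it holds
    for all. *)
Lemma lipschitz t x y : 0 < t -> `|fext (x, t) - fext (y, t)| <= L * `|x - y|.
Proof.
move=> t0; have [Bd [_ ae]] := ae_good.
apply: (@ae_bound_continuous R (fun t => `|fext (x, t) - fext (y, t)|) 0) => //.
- move=> s _; apply: cvg_norm; apply: cvgB; apply: continuous_col;
    exact: continuous_fext.
- apply: ae_imp ae => s gs s0; have := good_lipschitz s0 (gs s0) x y.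
  by rewrite fext_slice// ltW.
Qed.

Lemma continuous_coef (h : R -> R) : continuous h ->
  continuous (fun t => int_circ (fun x => fext (x, t) * h x)).
Proof.
move=> ch; apply: (@continuous_int_circ R (fun p => fext p * h p.1)).
apply: continuousM2; first exact: continuous_fext.
move=> p; apply: (@continuous_comp _ _ _ fst h); last exact: ch.
exact: cvg_fst.
Qed.

Lemma continuous_sqmod n :
  continuous (fun t => fourier_sqmod (fun x => fext (x, t)) (Posz n)).
Proof.
have cc := continuous_coef (@continuous_cosk R n%:R).
have cs := continuous_coef (@continuous_sink R n%:R).
have sq (h : R -> R) : continuous h -> continuous (fun t => h t ^+ 2).
  exact: continuous_sq.
move=> t; apply: cvgD.
  apply: (sq (fun t => fourier_cos (fun x => fext (x, t)) (Posz n))) => s.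
  by apply: cvgM; [exact: cvg_cst|exact: cc].
apply: (sq (fun t => fourier_sin (fun x => fext (x, t)) (Posz n))) => s.
by apply: cvgM; [exact: cvg_cst|exact: cs].
Qed.

Lemma sobolev t K : 0 < t ->
  \sum_(n < K) (1 + (Posz n)%:~R ^+ 2) * fourier_sqmod (fun x => fext (x, t)) (Posz n) <=
  (M ^+ 2 + L ^+ 2) * (2 * pi).
Proof.
move=> t0; have [Bd [_ ae]] := ae_good.
apply: (@ae_bound_continuous R (fun t => \sum_(n < K) (1 + (Posz n)%:~R ^+ 2) *
   fourier_sqmod (fun x => fext (x, t)) (Posz n)) 0) => //.
- move=> s _; elim: K => [|K IH].
    rewrite (_ : (fun _ => _) = cst 0); first exact: cvg_cst.
    by apply/funext => z; rewrite big_ord0.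
  rewrite (_ : (fun _ => _) = (fun t => \sum_(n < K) (1 + (Posz n)%:~R ^+ 2) *
     fourier_sqmod (fun x => fext (x, t)) (Posz n) + (1 + (Posz K)%:~R ^+ 2) *
     fourier_sqmod (fun x => fext (x, t)) (Posz K))).
    apply: cvgD; first exact: IH.
    by apply: cvgM; [exact: cvg_cst|exact: continuous_sqmod].
  by apply/funext => z; rewrite big_ord_recr.
- apply: ae_imp ae => s gs s0; have := good_sobolev s0 (gs s0) K.
  by rewrite fext_slice// ltW.
Qed.

End Solution.

(** * Decay of the deviation from the mean *)

Section Evolution.
Context {R : realType}.
Local Notation leb := (@lebesgue_measure R).
Local Notation leb2 := (@lebesgue_measure R \x @lebesgue_measure R)%E.
Variables (f0 : R -> R) (f ft : R * R -> R).
Hypothesis hf0 : W1inf f0.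
Hypothesis hf : muskat_solution f0 f ft.
Local Notation u := (fext f).
Local Notation M := (sup_bound f0).
Local Notation L := (lip_bound f0).
Local Notation c := (mean_value f0).
Variables (Bd : R) (N : set R).
Hypothesis Bd0 : 0 <= Bd.
Hypothesis mN : meas1 N.
Hypothesis N0 : leb N = 0%E.
Hypothesis gN : forall t, 0 < t -> ~ N t -> good_time f0 f ft Bd t.

Definition dt_pairing (A : R -> R) (t : R) := int_circ (fun x => A x * ft (x, t)).

Lemma meas_positive : meas2 (@positive_times R).
Proof.
apply: open2_measurable.
have -> : @positive_times R = (fun p : R * R => p.2) @^-1` [set y | 0 < y] by [].
by apply: open_comp => [p _|]; [exact: cvg_snd|exact: open_gt].
Qed.

Lemma ft_meas : mfun2 (@positive_times R) ft.
Proof. exact: (ms_dt_measurable hf). Qed.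

Section Window.
Variables s t : R.
Hypothesis s0 : 0 < s.
Hypothesis st : s <= t.
Let I : set R := `[s, t]%classic.
Let mI : meas1 I. Proof. exact: mitv. Qed.
Let mC := @mcirc R.
Let box : set (R * R) := circ `*` I.
Let mbox : meas2 box. Proof. exact: measurableX. Qed.
Let Ipos tau : I tau -> 0 < tau.
Proof. by rewrite /I /= in_itv /= => /andP[h _]; exact: lt_le_trans h. Qed.

Let box_ft_meas : mfun2 box ft.
Proof.
apply: measurable_funS ft_meas; first exact: meas_positive.
by move=> [x tau] [_ /Ipos].
Qed.

(** The mean squares at almost every time share one bound, to be integrated over
    the window. *)
Lemma ft_sqi_box : sqi leb2 box ft.
Proof.
split => //; apply: (@tonelli_box R circ I (fun p => ft p ^+ 2) Bd) => //.
- exact: leb_itv_lty.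
- exact: measurable_funX.
- by move=> p _; exact: sqr_ge0.
- exists N; split => // tau /= H; apply: contrapT => nN; apply: H => It.
  have [_ _ q b _] := gN (Ipos It) nN.
  have := sqi_EFin mC q; rewrite /slice => e; rewrite e lee_fin; exact: b.
Qed.

Let box_lty : (leb2 box < +oo)%E.
Proof. by apply: compact_lty; exact: compact_box. Qed.

Lemma ft_ig_box (h : R * R -> R) : continuous h -> ig leb2 box (fun p => h p * ft p).
Proof.
move=> ch; apply: sqiM => //; last exact: ft_sqi_box.
split; first exact: continuous2_measD.
by apply: ig_compact; [exact: compact_box|exact: continuous_sq].
Qed.

Lemma dt_pairing_ig (A : R -> R) : continuous A -> ig leb I (dt_pairing A).
Proof.
move=> cA; have cA1 : continuous (fun p : R * R => A p.1).
  by move=> p; apply: (@continuous_comp _ _ _ fst A); [exact: cvg_fst|exact: cA].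
by have [h _] := fubini_box_y mC mI (ft_ig_box cA1).
Qed.

Lemma dt_pairing_fubini (A chi : R -> R) : continuous A -> continuous chi ->
  \int[leb2]_(p in box) (A p.1 * chi p.2 * ft p) =
  \int[leb]_(tau in I) (dt_pairing A tau * chi tau).
Proof.
move=> cA cchi; have cA1 : continuous (fun p : R * R => A p.1).
  by move=> p; apply: (@continuous_comp _ _ _ fst A); [exact: cvg_fst|exact: cA].
have cchi2 : continuous (fun p : R * R => chi p.2).
  by move=> p; apply: (@continuous_comp _ _ _ snd chi); [exact: cvg_snd|exact: cchi].
have [_ ->] := fubini_box_y mC mI (ft_ig_box (continuousM2 cA1 cchi2)).
have [nul _] := fubini_box_y mC mI (ft_ig_box cA1).
have i2 : ig leb I (fun tau => dt_pairing A tau * chi tau).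
  have [B HB] := continuous_bnd (@segment_compact R s t) cchi.
  have i3 : ig leb I (fun tau => chi tau * dt_pairing A tau).
    apply: (@igM_bounded _ _ _ _ _ _ _ B) => //; exact: continuous_mfun1.
  by apply: (eq_ig mI _ i3) => tau _; rewrite mulrC.
have [i1 _] := fubini_box_y mC mI (ft_ig_box (continuousM2 cA1 cchi2)).
have key tau : I tau -> ~ N tau ->
    \int[leb]_(x in circ) (A x * chi tau * ft (x, tau)) = dt_pairing A tau * chi tau.
  move=> It nN; have [_ _ q _ _] := gN (Ipos It) nN.
  rewrite /dt_pairing /int_circ -RintegralZr//; last by apply: sqiM => //; exact: continuous_sqi.
  by apply: eq_Rintegral => x _; rewrite mulrAC.
by apply/eqP; rewrite eq_le; apply/andP; split; apply: (Rint_ae_le mI _ _ mN N0) => // tau It nN;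
  rewrite key.
Qed.

End Window.

Lemma dt_pairing_le (A : R -> R) (k tau : R) : continuous A -> 0 < k -> 0 < tau -> ~ N tau ->
  `|dt_pairing A tau| <= k * \int[leb]_(x in circ) (A x ^+ 2) + k^-1 * Bd.
Proof.
move=> cA k0 t0 nN; have [_ _ q b _] := gN t0 nN.
apply: le_trans (Rint_young (@mcirc R) k0 (continuous_sqi cA) q) _.
by rewrite lerD2l ler_wpM2l// invr_ge0 ltW.
Qed.

(** Testing the weak time derivative against [a x * chi t], with [chi] a smooth
    approximation of the indicator of the time interval. *)
Lemma increment_test (a : R -> R) (s t : R) : 0 < s -> s < t -> test_circ a ->
  int_circ (fun x => u (x, t) * a x) - int_circ (fun x => u (x, s) * a x) =
  \int[leb]_(tau in `[s, t]%classic) dt_pairing a tau.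
Proof.
move=> s0 st ta; have ca := continuous_C1 ta.
pose I : set R := `[s, t]%classic.
pose B := \int[leb]_(x in circ) (a x ^+ 2) + Bd.
have B0 : 0 <= B by rewrite addr_ge0// Rint_sq_ge0.
pose H tau := int_circ (fun x => u (x, tau) * a x).
have ch : continuous H by exact: continuous_coef hf a ca.
have ik : ig leb I (dt_pairing a) by exact: dt_pairing_ig.
apply: (weak_ftc (h := H) st ch ik mN N0 B0).
  move=> tau /andP[s1 _] nN.
  have := dt_pairing_le ca ltr01 (lt_le_trans s0 s1) nN.
  by rewrite mul1r invr1 mul1r.
move=> dl d0 sd.
pose chi := trapezoid s t dl; pose dchi tau := ramp s dl tau - ramp (t - dl) dl tau.
have cchi : continuous chi by exact: continuous_trapezoid.
have cdchi : continuous dchi.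
  by move=> z; apply: cvgB; exact: continuous_ramp.
have Dchi : derive1 chi = dchi.
  by apply/funext => z; rewrite derive1E; have [_ ->] := trapezoid_derive s t dl z.
have Cchi : C1_cyl (fun p : R * R => chi p.2).
  apply: C1_snd; last by rewrite Dchi.
  by move=> z; have [h _] := trapezoid_derive s t dl z.
have Ca := C1_fst ta.
pose eta p := a p.1 * chi p.2.
have p2 p : partial2 eta p = a p.1 * dchi p.2.
  by rewrite /eta (partial2M Ca Cchi) partial2_snd Dchi partial2_fst mul0r addr0.
have sup p : eta p != 0 -> s <= p.2 <= t.
  move=> e0; rewrite leNgt (leNgt p.2) -negb_or; apply: contra e0 => h.
  rewrite /eta /chi trapezoid0 ?mulr0//.
  by case/orP: h => /ltW h; [left|right].
have te : test_on (@positive_times R) eta.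
  split; first exact: C1_mul.
  - move=> p cp; have : closure [set q : R * R | s <= q.2] p.
      by apply: closureS cp => q /sup /andP[].
    have cl : closed [set q : R * R | s <= q.2].
      rewrite (_ : [set q | _] = (fun q : R * R => q.2) @^-1` [set z | s <= z])//.
      by apply: closed_comp; [move=> q _; exact: cvg_snd|exact: closed_ge].
    by move=> /cl /= sp; exact: lt_le_trans sp.
  - exists t => p /sup /andP[h1 h2].
    by rewrite ger0_norm// (le_trans _ h1)// ltW.
have := ms_dt hf te; rewrite /int_on /H.
have mC := @mcirc R; have mI := mitv s t.
have sub p : (circ `*` I) p -> (@positive_times R `&` cell) p.
  move=> [p1]; rewrite /I /= in_itv /= => /andP[h _]; split => //.
  exact: lt_le_trans h.
have -> : \int[leb2]_(p in @positive_times R `&` cell) (f p * partial2 eta p) =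
    \int[leb]_(tau in I) (int_circ (fun x => u (x, tau) * a x) * dchi tau).
  have -> : \int[leb2]_(p in @positive_times R `&` cell) (f p * partial2 eta p) =
      \int[leb2]_(p in circ `*` I) (u p * a p.1 * dchi p.2).
    rewrite [LHS](_ : _ = \int[leb2]_(p in circ `*` I) (f p * partial2 eta p)).
      apply: eq_Rintegral => p /set_mem /sub [/ltW p0 _].
      by rewrite p2 mulrA fext_eq.
    apply: Rint_support; apply: patch_support => p; last by move=> /sub h /(_ h).
    move=> [_ cp] nI; rewrite p2 /dchi !ramp0 ?subrr ?mulr0//.
      by have [h|h] := leP p.2 s; [left; lra|right; rewrite subrK leNgt; apply/negP => ht;
        apply: nI; split => //; rewrite /I /= in_itv /= (ltW h) (ltW ht)].
    have [h|h] := leP p.2 s; [by left|right; rewrite leNgt; apply/negP => ht].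
    by apply: nI; split => //; rewrite /I /= in_itv /= (ltW h); lra.
  have cu := continuous_fext hf.
  have ca1 : continuous (fun p : R * R => a p.1).
    by move=> p; apply: (@continuous_comp _ _ _ fst a); [exact: cvg_fst|exact: ca].
  have cd2 : continuous (fun p : R * R => dchi p.2).
    by move=> p; apply: (@continuous_comp _ _ _ snd dchi); [exact: cvg_snd|exact: cdchi].
  have ib : ig leb2 (circ `*` I) (fun p => u p * a p.1 * dchi p.2).
    apply: ig_compact; first exact: compact_box.
    exact: continuousM2 (continuousM2 cu ca1) cd2.
  have [_ ->] := fubini_box_y mC mI ib; apply: eq_Rintegral => tau _.
  rewrite /int_circ -RintegralZr//.
  by apply: continuous_ig; apply: continuousM2 => //; exact: continuous_slice hf tau.
move=> ->; congr (- _).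
rewrite -(dt_pairing_fubini t s0 ca cchi).
apply: etrans (_ : \int[leb2]_(p in circ `*` I) (ft p * eta p) = _).
  apply: Rint_support; apply: patch_support => p; last by move=> /sub h /(_ h).
  move=> [_ cp] nI; rewrite (_ : eta p = 0) ?mulr0//; apply/eqP.
  by apply: contraT => /sup h; case: nI; split => //; rewrite /I /= in_itv.
by apply: eq_Rintegral => p _; rewrite mulrC.
Qed.

Lemma dt_pairingB (A A' : R -> R) (tau : R) : continuous A -> continuous A' ->
  0 < tau -> ~ N tau -> dt_pairing A tau - dt_pairing A' tau = dt_pairing (fun x => A x - A' x) tau.
Proof.
move=> cA cA' t0 nN; have [_ _ q _ _] := gN t0 nN; have mC := @mcirc R.
rewrite /dt_pairing /int_circ -RintegralB//; try by apply: sqiM => //; exact: continuous_sqi.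
by apply: eq_Rintegral => x _; rewrite mulrBl.
Qed.

Lemma dt_pairing_small (d : R -> R) (w tau : R) : continuous d -> 0 < w ->
  (forall x, `|d x| <= w) -> 0 < tau -> ~ N tau ->
  `|dt_pairing d tau| <= w * (2 * pi + Bd).
Proof.
move=> cd w0 dw t0 nN.
have iw : 0 < w^-1 by rewrite invr_gt0.
apply: le_trans (dt_pairing_le cd iw t0 nN) _.
rewrite invrK mulrDr lerD2r mulrC ler_pdivrMr// -mulrA [_ * w]mulrC mulrA -expr2.
rewrite -circ_mass -Rintegral_cst//; last exact: mcirc.
apply: le_Rintegral => //; first exact: mcirc.
- by apply: continuous_ig; exact: continuous_sq.
- by apply: ig_cst; [exact: mcirc|exact: circ_lty].
- move=> x _; rewrite -[d x ^+ 2]real_normK ?num_real//.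
  by rewrite ler_sqr ?nnegrE ?dw// ltW.
Qed.

Lemma pairing_small (d : R -> R) (w t : R) : continuous d -> (forall x, `|d x| <= w) ->
  0 <= t -> `|int_circ (fun x => u (x, t) * d x)| <= M * w * (2 * pi).
Proof.
move=> cd dw t0; have mC := @mcirc R.
rewrite -circ_mass -Rintegral_cst//; apply: Rint_bound => //.
- by apply: continuous_ig; apply: continuousM2 => //; exact: continuous_slice hf t.
- by apply: ig_cst => //; exact: circ_lty.
- by move=> x _; rewrite normrM; apply: ler_pM => //; exact: (sup_le hf0 hf).
Qed.

(** The functions to be paired with increments are the slices of the solution,
    merely Lipschitz in space; sliding averages make them test functions at a
    uniformly small cost. *)
Lemma increment_lip (A : R -> R) (l s t : R) : 0 < s -> s < t -> continuous A ->
  periodic A -> 0 <= l -> (forall x y, `|A x - A y| <= l * `|x - y|) ->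
  int_circ (fun x => u (x, t) * A x) - int_circ (fun x => u (x, s) * A x) =
  \int[leb]_(tau in `[s, t]%classic) dt_pairing A tau.
Proof.
move=> s0 st cA pA l0 lA; have t0 := lt_trans s0 st.
pose I : set R := `[s, t]%classic; have mI := mitv s t; have mC := @mcirc R.
have p0 := @pi2_gt0 R; have M0 := M_ge0 f0.
apply/eqP; rewrite -subr_eq0 -normr_le0.
pose C := (l + 1) * (M * (2 * pi)) + (l + 1) * (M * (2 * pi)) +
  (l + 1) * (2 * pi + Bd) * (t - s).
have C0 : 0 <= C.
  have l1 : 0 <= l + 1 by rewrite addr_ge0.
  have M2 : 0 <= M * (2 * pi) by rewrite mulr_ge0// ltW.
  have B2 : 0 <= 2 * pi + Bd by rewrite addr_ge0// ltW.
  by rewrite /C !addr_ge0// mulr_ge0// ?mulr_ge0// subr_ge0 ltW.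
apply: (@le_eps _ _ _ C) => // e e0; rewrite add0r.
pose Ae := steklov e A; have te : test_circ Ae by exact: steklov_test.
have cAe := continuous_C1 te; pose w := (l + 1) * e.
have w0 : 0 < w by rewrite mulr_gt0// ltr_wpDl.
have cd : continuous (fun x => A x - Ae x).
  by move=> x; apply: cvgB; [exact: cA|exact: cAe].
have dw x : `|A x - Ae x| <= w.
  rewrite distrC; apply: steklov_close => // z /andP[z1 z2].
  apply: le_trans (lA _ _) _; rewrite /w mulrDl mul1r.
  apply: (@le_trans _ _ (l * e)); last by rewrite lerDl ltW.
  by apply: ler_wpM2l => //; rewrite ger0_norm ?subr_ge0// lerBlDl.
have P tau : 0 <= tau -> `|int_circ (fun x => u (x, tau) * A x) -
    int_circ (fun x => u (x, tau) * Ae x)| <= M * w * (2 * pi).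
  move=> tau0; have := pairing_small cd dw tau0.
  suff -> : int_circ (fun x => u (x, tau) * (A x - Ae x)) =
    int_circ (fun x => u (x, tau) * A x) - int_circ (fun x => u (x, tau) * Ae x) by [].
  have cs : continuous (fun x => u (x, tau)) by exact: (@continuous_slice _ _ _ _ hf).
  rewrite /int_circ -RintegralB//; try by apply: continuous_ig; exact: continuousM2.
  by apply: eq_Rintegral => x _; rewrite mulrBr.
have i1 : ig leb I (dt_pairing A) by exact: dt_pairing_ig.
have i2 : ig leb I (dt_pairing Ae) by exact: dt_pairing_ig.
pose K := w * (2 * pi + Bd).
have iK : ig leb I (fun=> K) by apply: ig_cst => //; exact: leb_itv_lty.
have Q : `|\int[leb]_(tau in I) dt_pairing A tau - \int[leb]_(tau in I) dt_pairing Ae tau| <=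
    K * (t - s).
  have key tau : I tau -> ~ N tau -> `|dt_pairing A tau - dt_pairing Ae tau| <= K.
    rewrite /I /= in_itv /= => /andP[t1 _] nN.
    have tau0 := lt_le_trans s0 t1.
    by rewrite dt_pairingB//; exact: dt_pairing_small.
  have eK : \int[leb]_(tau in I) K = K * (t - s).
    by rewrite Rintegral_cst// /I leb_itv// ltW.
  have iB : ig leb I (fun tau => dt_pairing A tau - dt_pairing Ae tau) by exact: igB.
  rewrite -RintegralB// ler_norml -eK -RintN//; apply/andP; split.
    apply: (Rint_ae_le mI _ iB mN N0); first by have := igN mI iK.
    by move=> tau It nN; have := key tau It nN; rewrite ler_norml => /andP[].
  apply: (Rint_ae_le mI iB iK mN N0).
  by move=> tau It nN; have := key tau It nN; rewrite ler_norml => /andP[].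
have E := increment_test s0 st te.
have := P t (ltW t0); have := P s (ltW s0); move: Q E; rewrite -/I.
move: (int_circ _) (int_circ _) (int_circ _) (int_circ _) (\int[leb]_(tau in I) dt_pairing A tau)
  (\int[leb]_(tau in I) dt_pairing Ae tau) => a1 a2 a3 a4 b1 b2 Q E Ps Pt.
have -> : C * e = M * w * (2 * pi) + M * w * (2 * pi) + K * (t - s).
  by rewrite /C /K /w; ring.
move: Q Ps Pt; rewrite !ler_norml; move: (K * _) (M * w * _) => k m; move: E; clear.
move=> E /andP[? ?] /andP[? ?] /andP[? ?]; apply/andP; split; lra.
Qed.

Definition deviation (t : R) := int_circ (fun x => (u (x, t) - c) ^+ 2).

Let mC := @mcirc R.

Let cs tau : continuous (fun x => u (x, tau)).
Proof. exact: (@continuous_slice _ _ _ _ hf). Qed.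

Let ps tau : periodic (fun x => u (x, tau)).
Proof. exact: (@periodic_slice _ _ _ _ hf). Qed.

Lemma slice_comb_lip (a b k s t : R) : 0 < s -> 0 < t ->
  let A x := a * u (x, t) + b * u (x, s) + k in
  [/\ continuous A, periodic A, 0 <= (`|a| + `|b|) * L &
    forall x y, `|A x - A y| <= (`|a| + `|b|) * L * `|x - y|].
Proof.
move=> s0 t0 A; split.
- move=> x; apply: cvgD; last exact: cvg_cst.
  by apply: cvgD; apply: cvgM; [exact: cvg_cst|exact: cs|exact: cvg_cst|exact: cs].
- by move=> x; rewrite /A (ps t) (ps s).
- by rewrite mulr_ge0// ?addr_ge0//; exact: L_ge0.
- move=> x y.
  have -> : A x - A y = a * (u (x, t) - u (y, t)) + b * (u (x, s) - u (y, s)).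
    by rewrite /A; ring.
  apply: le_trans (ler_normD _ _) _; rewrite mulrDl mulrDl !normrM -!mulrA.
  by rewrite lerD// ler_wpM2l//; exact: (lipschitz hf0 hf).
Qed.

(** The increment is paired with itself: [D <= (t - s) (k D + Bd / k)], and
    [k = 1 / (2 (t - s))] absorbs [D]. *)
Lemma time_lip (s t : R) : 0 < s -> s < t ->
  \int[leb]_(x in circ) ((u (x, t) - u (x, s)) ^+ 2) <= 4 * Bd * (t - s) ^+ 2.
Proof.
move=> s0 st; have t0 := lt_trans s0 st; have d0 : 0 < t - s by rewrite subr_gt0.
have [cA pA l0 lA] := slice_comb_lip 1 (-1) 0 s0 t0.
set A := (fun x => _) in cA pA lA.
have AE x : A x = u (x, t) - u (x, s) by rewrite /A; ring.
set D := \int[leb]_(x in _) _.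
have eD : D = \int[leb]_(x in circ) (A x ^+ 2).
  by apply: eq_Rintegral => x _; rewrite AE.
have := increment_lip s0 st cA pA l0 lA.
rewrite /int_circ -RintegralB//; try by apply: continuous_ig; exact: continuousM2.
rewrite (_ : \int[leb]_(x in circ) _ = D); last first.
  by apply: eq_Rintegral => x _; rewrite -mulrBl AE expr2.
pose k := (2 * (t - s))^-1; have k0 : 0 < k by rewrite invr_gt0 mulr_gt0.
pose K := k * D + k^-1 * Bd; have mI := mitv s t => E.
have : D <= K * (t - s).
  rewrite {1}E -(leb_itv (ltW st)) -Rintegral_cst//.
  apply: (Rint_ae_le mI _ _ mN N0); first exact: dt_pairing_ig.
    by apply: ig_cst => //; exact: leb_itv_lty.
  move=> tau; rewrite /= in_itv /= => /andP[t1 _] nN.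
  apply: le_trans (ler_norm _) _; rewrite /K eD.
  by apply: dt_pairing_le => //; exact: lt_le_trans t1.
have -> : K * (t - s) = D / 2 + 2 * Bd * (t - s) ^+ 2.
  rewrite /K /k; move: (t - s) d0 => d d0; field; exact: lt0r_neq0.
by move: (_ ^+ 2) => q h; lra.
Qed.

Lemma time_lip_sym (s t d : R) : 0 < s -> 0 < t -> `|t - s| <= d ->
  \int[leb]_(x in circ) ((u (x, t) - u (x, s)) ^+ 2) <= 4 * Bd * d ^+ 2.
Proof.
move=> s0 t0 td; have q : (t - s) ^+ 2 <= d ^+ 2.
  by rewrite -[(t - s) ^+ 2]real_normK ?num_real// ler_sqr ?nnegrE// (le_trans _ td).
have B4 : 0 <= 4 * Bd by rewrite mulr_ge0.
apply: (@le_trans _ _ (4 * Bd * (t - s) ^+ 2)); last exact: ler_wpM2l.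
have [st|ts|<-] := ltgtP s t; first exact: time_lip.
  rewrite -(sqrrN (t - s)) opprB; apply: le_trans (time_lip t0 ts).
  rewrite le_eqVlt; apply/orP; left; apply/eqP.
  by apply: eq_Rintegral => x _; rewrite -sqrrN opprB.
rewrite [X in X <= _](_ : _ = \int[leb]_(x in circ) cst 0 x).
  by rewrite Rintegral_cst// mul0r mulr_ge0// sqr_ge0.
by apply: eq_Rintegral => x _; rewrite subrr expr0n.
Qed.

Definition spread := 2 * M + 2 * `|c|.
Definition poincare_rate := (4 * trace_const M)^-1.
Definition slack := 17 * Bd + 2 * poincare_rate * (4 * Bd + spread ^+ 2 * (2 * pi)).

Lemma poincare_rate_gt0 : 0 < poincare_rate.
Proof.
rewrite invr_gt0 mulr_gt0// /trace_const.
have q : 0 <= 2 * (2 * pi) ^+ 2 :> R by rewrite mulr_ge0// sqr_ge0.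
by rewrite ltr_wpDr// mulr_gt0// ltr_wpDl// mulr_ge0// M_ge0.
Qed.

Lemma slack_ge0 : 0 <= slack.
Proof.
have l0 := poincare_rate_gt0; have p0 := @pi2_gt0 R.
rewrite /slack addr_ge0// ?mulr_ge0// ?(ltW l0)//.
by rewrite addr_ge0// mulr_ge0// ?sqr_ge0// ltW.
Qed.

Lemma sum_le (s t x : R) : 0 < s -> 0 < t -> `|u (x, t) + u (x, s) - 2 * c| <= spread.
Proof.
move=> s0 t0; apply: le_trans (ler_normB _ _) _; rewrite normrM (ger0_norm (ler0n _ 2)).
rewrite lerD2r; apply: le_trans (ler_normD _ _) _.
have a1 := sup_le hf0 hf x (ltW t0); have a2 := sup_le hf0 hf x (ltW s0).
by have -> : 2 * M = M + M by [ring]; apply: lerD.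
Qed.

(** A difference of squares, so that the increment of the deviation is an
    increment of the solution paired with a fixed function of [x]. *)
Lemma deviation_diff (s t : R) : deviation t - deviation s =
  int_circ (fun x => u (x, t) * (u (x, t) + u (x, s) - 2 * c)) -
  int_circ (fun x => u (x, s) * (u (x, t) + u (x, s) - 2 * c)).
Proof.
have cc k tau : continuous (fun x => u (x, tau) + k).
  by move=> x; apply: cvgD; [exact: cs|exact: cvg_cst].
have csum : continuous (fun x => u (x, t) + u (x, s) - 2 * c).
  by move=> x; apply: cvgD; [apply: cvgD; exact: cs|exact: cvg_cst].
rewrite /deviation /int_circ -!RintegralB//; first last.
- by apply: continuous_ig; apply: continuous_sq; exact: cc.
- by apply: continuous_ig; apply: continuous_sq; exact: cc.
- by apply: continuous_ig; apply: continuousM2.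
- by apply: continuous_ig; apply: continuousM2.
by apply: eq_Rintegral => x _; ring.
Qed.

Lemma deviation_close (s t d : R) : 0 < s -> 0 < t -> 0 < d -> `|t - s| <= d ->
  `|deviation t - deviation s| <= (4 * Bd + spread ^+ 2 * (2 * pi)) * d.
Proof.
move=> s0 t0 d0 ts.
have csum : continuous (fun x => u (x, t) + u (x, s) - 2 * c).
  by move=> x; apply: cvgD; [apply: cvgD; exact: cs|exact: cvg_cst].
have cd : continuous (fun x => u (x, t) - u (x, s)).
  by move=> x; apply: cvgB; exact: cs.
rewrite deviation_diff /int_circ -RintegralB//;
  try by apply: continuous_ig; exact: continuousM2.
rewrite (_ : \int[leb]_(x in circ) _ = \int[leb]_(x in circ)
    ((u (x, t) - u (x, s)) * (u (x, t) + u (x, s) - 2 * c))); last first.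
  by apply: eq_Rintegral => x _; ring.
have iw : 0 < d^-1 by rewrite invr_gt0.
apply: le_trans (Rint_young mC iw (continuous_sqi cd) (continuous_sqi csum)) _.
have -> : (4 * Bd + spread ^+ 2 * (2 * pi)) * d =
  4 * Bd * d + d * (spread ^+ 2 * (2 * pi)) by ring.
rewrite invrK; apply: lerD.
  rewrite mulrC ler_pdivrMr//; apply: le_trans (time_lip_sym s0 t0 ts) _.
  by rewrite expr2 !mulrA.
apply: ler_wpM2l; first exact: ltW.
rewrite -circ_mass -Rintegral_cst//; apply: le_Rintegral => //.
- by case: (continuous_sqi csum).
- by apply: ig_cst => //; exact: circ_lty.
- move=> x _; rewrite -[_ ^+ 2]real_normK ?num_real//.
  have S0 : 0 <= spread by exact: le_trans (sum_le 0 s0 t0).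
  by rewrite ler_sqr ?nnegrE// sum_le.
Qed.

(** Replacing both end slices by the slice at time [tau] produces twice the
    energy dissipation; the error is the pairing of [ft] with a function that
    [time_lip] makes of size [t - s]. *)
Lemma dissipation (tau s t : R) : 0 < s -> s < t -> s <= tau <= t -> ~ N tau ->
  dt_pairing (fun x => u (x, t) + u (x, s) - 2 * c) tau <=
  - (2 * poincare_rate * deviation t) + slack * (t - s).
Proof.
move=> s0 st /andP[st1 tt1] nN; have t0 := lt_trans s0 st.
have d0 : 0 < t - s by rewrite subr_gt0.
have tau0 := lt_le_trans s0 st1; have g := gN tau0 nN.
have [E [E0 E1 E2 E3 _]] := good_dissipation hf0 hf tau0 g.
have [_ _ q b _] := g.
pose e x := u (x, t) + u (x, s) - 2 * u (x, tau).
have ce : continuous e.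
  move=> x; apply: cvgB; first by apply: cvgD; exact: cs.
  by apply: cvgM; [exact: cvg_cst|exact: cs].
have esl : slice f tau = (fun x => u (x, tau)) by rewrite fext_slice// ltW.
rewrite esl in E1 E2.
have split : dt_pairing (fun x => u (x, t) + u (x, s) - 2 * c) tau =
    dt_pairing e tau + 2 * int_circ (fun x => ft (x, tau) * u (x, tau)) -
    2 * c * int_circ (slice ft tau).
  have i1 : ig leb circ (fun x => e x * ft (x, tau)).
    by apply: sqiM => //; exact: continuous_sqi.
  have i2 : ig leb circ (fun x => ft (x, tau) * u (x, tau)).
    by apply: sqiM => //; exact: continuous_sqi.
  have i3 : ig leb circ (slice ft tau) by apply: sqi_ig => //; exact: circ_lty.
  have j2 := igZ 2 mC i2; have j3 := igZ (2 * c) mC i3.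
  rewrite /dt_pairing /int_circ -!RintegralZl// -RintegralD// -RintegralB//; last exact: igD.
  by apply: eq_Rintegral => x _; rewrite /e /slice; ring.
have Re : dt_pairing e tau <= 17 * Bd * (t - s).
  have iw : 0 < (t - s)^-1 by rewrite invr_gt0.
  apply: le_trans (ler_norm _) _; apply: le_trans (dt_pairing_le ce iw tau0 nN) _.
  rewrite invrK.
  have -> : 17 * Bd * (t - s) = 16 * Bd * (t - s) + (t - s) * Bd by ring.
  rewrite lerD2r mulrC ler_pdivrMr//.
  have -> : 16 * Bd * (t - s) * (t - s) = 16 * Bd * (t - s) ^+ 2 by ring.
  have c1 : continuous (fun x => u (x, t) - u (x, tau)).
    by move=> x; apply: cvgB; exact: cs.
  have c2 : continuous (fun x => u (x, s) - u (x, tau)).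
    by move=> x; apply: cvgB; exact: cs.
  have b1 : \int[leb]_(x in circ) ((u (x, t) - u (x, tau)) ^+ 2) <= 4 * Bd * (t - s) ^+ 2.
    by apply: time_lip_sym => //; rewrite ger0_norm ?subr_ge0// lerD2l lerN2.
  have b2 : \int[leb]_(x in circ) ((u (x, s) - u (x, tau)) ^+ 2) <= 4 * Bd * (t - s) ^+ 2.
    apply: time_lip_sym => //; rewrite distrC ger0_norm ?subr_ge0//.
    by rewrite lerD2r.
  have [_ i1] := continuous_sqi c1; have [_ i2] := continuous_sqi c2.
  apply: (@le_trans _ _ (2 * \int[leb]_(x in circ) ((u (x, t) - u (x, tau)) ^+ 2) +
      2 * \int[leb]_(x in circ) ((u (x, s) - u (x, tau)) ^+ 2))); last first.
    move: b1 b2; have -> : 16 * Bd * (t - s) ^+ 2 =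
      2 * (4 * Bd * (t - s) ^+ 2) + 2 * (4 * Bd * (t - s) ^+ 2) by ring.
    by move=> b1 b2; apply: lerD; apply: ler_wpM2l.
  have j1 := igZ 2 mC i1; have j2 := igZ 2 mC i2.
  rewrite -!RintegralZl// -RintegralD//; apply: le_Rintegral => //.
  - by case: (continuous_sqi ce).
  - exact: igD.
  - move=> x _; have -> : e x = (u (x, t) - u (x, tau)) + (u (x, s) - u (x, tau)).
      by rewrite /e; ring.
    exact: sqr_add_le.
have Y : poincare_rate * deviation tau <= E.
  rewrite /poincare_rate mulrC ler_pdivrMr; last by rewrite -invr_gt0; exact: poincare_rate_gt0.
  by rewrite [E * _]mulrC.
have Z : `|deviation t - deviation tau| <= (4 * Bd + spread ^+ 2 * (2 * pi)) * (t - s).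
  by apply: deviation_close => //; rewrite ger0_norm ?subr_ge0// lerD2l lerN2.
have l0 := poincare_rate_gt0.
have W : poincare_rate * deviation t <= poincare_rate * deviation tau +
    poincare_rate * ((4 * Bd + spread ^+ 2 * (2 * pi)) * (t - s)).
  rewrite -mulrDr; apply: ler_wpM2l; first exact: ltW.
  by rewrite addrC -lerBlDr; exact: le_trans (ler_norm _) Z.
rewrite split E3 mulr0 subr0 /slack.
have E2' : int_circ (fun x => ft (x, tau) * u (x, tau)) <= - E by exact: E2.
have -> : (17 * Bd + 2 * poincare_rate * (4 * Bd + spread ^+ 2 * (2 * pi))) * (t - s) =
  17 * Bd * (t - s) + 2 * (poincare_rate * ((4 * Bd + spread ^+ 2 * (2 * pi)) * (t - s))) by ring.
move: Re Y W E2'; rewrite -[2 * poincare_rate * _]mulrA.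
move: (dt_pairing _ _) (int_circ _) (poincare_rate * _) (poincare_rate * _) (poincare_rate * _) (17 * Bd * _) => x1 x2 x3 x4 x5 x6.
by lra.
Qed.

Lemma deviation_increment (s t : R) : 0 < s -> s < t ->
  deviation t - deviation s <=
  (t - s) * (- (2 * poincare_rate * deviation t) + slack * (t - s)).
Proof.
move=> s0 st; have t0 := lt_trans s0 st.
have [cA pA l0 lA] := slice_comb_lip 1 1 (- (2 * c)) s0 t0.
pose A x := u (x, t) + u (x, s) - 2 * c.
have eA : (fun x => 1 * u (x, t) + 1 * u (x, s) + - (2 * c)) = A.
  by apply/funext => x; rewrite !mul1r.
rewrite deviation_diff; rewrite /= eA in cA pA.
have {}lA x y : `|A x - A y| <= (`|1| + `|1|) * L * `|x - y|.
  by have := lA x y; rewrite /= !mul1r.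
rewrite (increment_lip s0 st cA pA l0 lA) mulrC.
set K := - _ + _; have mI := mitv s t.
rewrite -(leb_itv (ltW st)) -Rintegral_cst//; apply: (Rint_ae_le mI _ _ mN N0).
- exact: dt_pairing_ig.
- by apply: ig_cst => //; exact: leb_itv_lty.
- by move=> tau; rewrite /= in_itv /= => tI nN; exact: dissipation.
Qed.

Lemma deviation_ge0 t : 0 <= deviation t.
Proof. by apply: Rintegral_ge0 => x _; rewrite sqr_ge0. Qed.

Definition initial_spread := (M + `|c|) ^+ 2 * (2 * pi).

Lemma deviation_le t : 0 < t -> deviation t <= initial_spread.
Proof.
move=> t0; rewrite /initial_spread -circ_mass -Rintegral_cst//.
have cc : continuous (fun x => u (x, t) - c).
  by move=> x; apply: cvgB; [exact: cs|exact: cvg_cst].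
apply: le_Rintegral => //.
- by apply: continuous_ig; exact: continuous_sq.
- by apply: ig_cst => //; exact: circ_lty.
- move=> x _; rewrite -[_ ^+ 2]real_normK ?num_real//.
  have M0 := M_ge0 f0.
  rewrite ler_sqr ?nnegrE// ?addr_ge0//; apply: le_trans (ler_normB _ _) _.
  by rewrite lerD2r; exact: (sup_le hf0 hf x (ltW t0)).
Qed.

(** Gronwall's inequality for a differential inequality with coefficient [2 poincare_rate], in the
    form of increments since [deviation] is merely Lipschitz in time. *)
Lemma deviation_gronwall (a b : R) : 0 < a -> a <= b ->
  deviation b * expR (poincare_rate * b) <= deviation a * expR (poincare_rate * a).
Proof.
move=> a0 ab; have l0 := poincare_rate_gt0.
pose Y := initial_spread.
apply: (@quadratic_increments R (fun t => deviation t * expR (poincare_rate * t)) a b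
  (expR (poincare_rate * b) * (2 * poincare_rate ^+ 2 * Y + slack))) => // s t as_ st tb.
have s0 := lt_le_trans a0 as_; have t0 := lt_le_trans s0 st.
move: st; rewrite le_eqVlt => /predU1P[<-|st]; first by rewrite !subrr expr0n mulr0.
have d0 : 0 < t - s by rewrite subr_gt0.
have inc := deviation_increment s0 st; have yY := deviation_le t0.
have y0 := deviation_ge0 t; have y1 := deviation_ge0 s.
have sl := slack_ge0.
pose x := poincare_rate * (t - s); have x0 : 0 <= x by rewrite mulr_ge0// ltW.
have -> : expR (poincare_rate * s) = expR (poincare_rate * t) * expR (- x).
  by rewrite -expRD; congr expR; rewrite /x; ring.
have ex1 : expR (- x) <= 1 by rewrite -expR0 ler_expR oppr_le0.
have ex2 : 1 - x <= expR (- x) by exact: expR_ge1Dx.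
have e0 := expR_ge0 (poincare_rate * t).
have -> : deviation t * expR (poincare_rate * t) - deviation s * (expR (poincare_rate * t) * expR (- x)) =
  expR (poincare_rate * t) * (deviation t - deviation s * expR (- x)) by ring.
have eb : expR (poincare_rate * t) <= expR (poincare_rate * b) by rewrite ler_expR ler_wpM2l// ltW.
set W := (2 * poincare_rate ^+ 2 * Y + slack) * (t - s) ^+ 2.
have W0 : 0 <= W.
  rewrite mulr_ge0 ?sqr_ge0// addr_ge0// mulr_ge0//; last exact: le_trans y0 yY.
  by rewrite mulr_ge0// sqr_ge0.
rewrite -[X in _ <= X]mulrA -/W; apply: (@le_trans _ _ (expR (poincare_rate * t) * W)); last exact: ler_wpM2r.
apply: ler_wpM2l => //.
have I1 : (1 + 2 * x) * deviation t - slack * (t - s) ^+ 2 <= deviation s.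
  rewrite -subr_ge0; move: inc; rewrite -subr_ge0 => inc; apply: le_trans inc _.
  by rewrite le_eqVlt; apply/orP; left; apply/eqP; rewrite /x; ring.
have I2 := ler_wpM2r (expR_ge0 (- x)) I1.
have I3 : slack * (t - s) ^+ 2 * expR (- x) <= slack * (t - s) ^+ 2.
  by rewrite ler_piMr// mulr_ge0// sqr_ge0.
have I4 : (1 - x) * ((1 + 2 * x) * deviation t) <=
    expR (- x) * ((1 + 2 * x) * deviation t).
  by apply: ler_wpM2r => //; rewrite mulr_ge0// addr_ge0// mulr_ge0.
(* The gain 1 + 2 x over a step beats the loss exp(- x) up to a quadratic error. *)
have I5 : deviation t - 2 * x ^+ 2 * deviation t <= (1 - x) * ((1 + 2 * x) * deviation t).
  rewrite -subr_ge0; have -> : (1 - x) * ((1 + 2 * x) * deviation t) -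
    (deviation t - 2 * x ^+ 2 * deviation t) = x * deviation t by ring.
  exact: mulr_ge0.
have I6 : 2 * x ^+ 2 * deviation t <= 2 * x ^+ 2 * Y.
  by apply: ler_wpM2l => //; rewrite mulr_ge0// sqr_ge0.
have -> : W = 2 * x ^+ 2 * Y + slack * (t - s) ^+ 2 by rewrite /W /x; ring.
have e : ((1 + 2 * x) * deviation t - slack * (t - s) ^+ 2) * expR (- x) =
  expR (- x) * ((1 + 2 * x) * deviation t) - slack * (t - s) ^+ 2 * expR (- x) by ring.
rewrite e in I2.
have chain (z1 z2 z3 z4 z5 z6 z7 z8 : R) : z1 - z2 <= z7 -> z2 <= z3 -> z4 <= z1 ->
  z8 - z5 <= z4 -> z5 <= z6 -> z8 - z7 <= z6 + z3 by lra.
exact: chain I2 I3 I4 I5 I6.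
Qed.

Lemma deviation_decay t : 0 < t ->
  deviation t <= initial_spread * expR (- (poincare_rate / 2 * t)).
Proof.
move=> t0; have h0 : 0 < t / 2 by rewrite divr_gt0.
have ht : t / 2 <= t by rewrite ler_pdivrMr// mulr_natr mulr2n lerDl ltW.
have := deviation_gronwall h0 ht; rewrite -ler_pdivlMr ?expR_gt0// => /le_trans; apply.
have -> : deviation (t / 2) * expR (poincare_rate * (t / 2)) / expR (poincare_rate * t) =
  deviation (t / 2) * expR (- (poincare_rate / 2 * t)).
  rewrite -mulrA -expRN -expRD; congr (_ * expR _).
  by rewrite [X in _ = - (_ * X)](_ : t = t / 2 + t / 2); [field|exact: splitr].
by rewrite ler_wpM2r ?expR_ge0//; exact: deviation_le.
Qed.

End Evolution.

(** * From the mean square to the other norms *)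

Section Norms.
Context {R : realType}.
Local Notation leb := (@lebesgue_measure R).

Lemma int_sin0 (k : R) : k != 0 -> cos (k * (2 * pi)) = 1 ->
  \int[leb]_(x in circ) sin (k * x) = 0.
Proof.
move=> k0 ck; have p0 := ltW (@pi2_gt0 R).
have d x : is_derive x (1 : R) (fun x => - k^-1 * cos (k * x)) (sin (k * x)).
  have h2 : is_derive x (1 : R) (fun x => - k^-1 *: cos (k * x))
      (- k^-1 *: (- k * sin (k * x))).
    by apply: is_deriveZ; exact: is_derive_cosk.
  by apply: (is_derive_eq h2); rewrite /GRing.scale /= mulrA mulrNN mulVf// mul1r.
rewrite (ftc_C1 p0 d); last exact: (@continuous_sink R k).
by rewrite ck !(mulr0, cos0) subrr.
Qed.

(** Removing the mean only affects the zero frequency. *)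
Lemma fourier_sqmod_subc (v : R -> R) (k : R) (n : nat) : continuous v ->
  k = (2 * pi)^-1 * int_circ v ->
  fourier_sqmod (fun x => v x - k) (Posz n) =
  if n == 0%N then 0 else fourier_sqmod v (Posz n).
Proof.
move=> cv kE; have mC := @mcirc R; have p0 := @pi2_gt0 R.
have ik : ig leb circ (fun=> k) by apply: ig_cst => //; exact: circ_lty.
have iv : ig leb circ v by exact: continuous_ig.
have I h : continuous h -> \int[leb]_(x in circ) h x = 0 ->
    int_circ (fun x => (v x - k) * h x) = int_circ (fun x => v x * h x).
  move=> ch h0; rewrite -[RHS]subr0 -[in RHS](mulr0 k) -h0 /int_circ.
  have ih : ig leb circ h by exact: continuous_ig.
  have ivh : ig leb circ (fun x => v x * h x).
    by apply: continuous_ig; exact: continuousM2.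
  have ikh := igZ k mC ih; rewrite -RintegralZl// -RintegralB//.
  by apply: eq_Rintegral => x _; rewrite mulrBl.
case: ifPn => [/eqP ->|n0].
  rewrite /fourier_sqmod /fourier_cos /fourier_sin.
  rewrite (_ : int_circ _ = 0) ?mulr0 ?expr0n ?add0r.
    rewrite (_ : int_circ _ = 0) ?mulr0 ?expr0n//.
    rewrite /int_circ (_ : \int[leb]_(x in circ) _ = \int[leb]_(x in circ) cst 0 x).
      by rewrite Rintegral_cst// mul0r.
    by apply: eq_Rintegral => x _; rewrite mul0r sin0 mulr0.
  rewrite /int_circ (_ : \int[leb]_(x in circ) _ = \int[leb]_(x in circ) (v x - k)).
    rewrite RintegralB// Rintegral_cst// circ_mass kE /int_circ mulrC mulrA.
    by rewrite mulfV ?mul1r ?subrr// gt_eqF.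
  by apply: eq_Rintegral => x _; rewrite mul0r cos0 mulr1.
have nR : (n%:R : R) != 0 by rewrite pnatr_eq0.
have [s1 c1] := @sin_cos_2pin R n.
rewrite /fourier_sqmod /fourier_cos /fourier_sin !I//.
- exact: (@continuous_sink R n%:R).
- exact: int_sin0.
- exact: (@continuous_cosk R n%:R).
- exact: int_cos0.
Qed.

(** The Lipschitz bound keeps [h^2] at [x] close to its average over
    [[x, x + e]], which is at most the total mean square divided by [e]. *)
Lemma sup_of_L2 (h : R -> R) (H l e x : R) : continuous h -> periodic h ->
  (forall y, `|h y| <= H) -> 0 <= l -> (forall y z, `|h y - h z| <= l * `|y - z|) ->
  0 < e -> e <= 1 ->
  h x ^+ 2 <= e^-1 * \int[leb]_(y in circ) (h y ^+ 2) + 2 * H * l * e.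
Proof.
move=> ch ph hH l0 hl e0 e1; pose A y := h y ^+ 2.
have cA : continuous A by exact: continuous_sq.
have pA : periodic A by move=> y; rewrite /A ph.
have H0 : 0 <= H by exact: le_trans (normr_ge0 _) (hH 0).
have S1 : `|steklov e A x - A x| <= 2 * H * l * e.
  apply: steklov_close => // z /andP[z1 z2].
  have -> : A z - A x = (h z + h x) * (h z - h x) by rewrite /A; ring.
  rewrite normrM -(mulrA (2 * H)); apply: ler_pM => //.
    have -> : 2 * H = H + H by ring.
    by apply: le_trans (ler_normD _ _) _; apply: lerD.
  apply: le_trans (hl _ _) _; apply: ler_wpM2l => //.
  by rewrite ger0_norm ?subr_ge0// lerBlDl.
have S2 : steklov e A x <= e^-1 * int_circ A.
  rewrite /steklov mulrC ler_wpM2l ?invr_ge0 ?(ltW e0)//.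
  rewrite (int_circ_primitive x cA pA) lerD2r.
  pose r := 2 * pi - e.
  have r0 : 0 < r.
    by rewrite subr_gt0 (le_lt_trans e1)//; have := pi_ge2 R; move: pi => q; lra.
  have := steklov_ge0 (x + e) r0 cA (fun y => sqr_ge0 (h y)).
  have er : x + e + r = x + 2 * pi by rewrite /r; ring.
  by rewrite /steklov er pmulr_lge0 ?invr_gt0// subr_ge0.
rewrite -/(A x) -lerBlDr; apply: le_trans S2.
by move: S1; rewrite distrC => /(le_trans (ler_norm _)); rewrite lerBlDl lerBlDr.
Qed.

(** Points closer than [r] are compared through the Lipschitz bound, the others
    through the uniform bound. *)
Lemma holder_le (al l m r : R) (v : R -> R) : 0 < al < 1 -> 0 <= l -> 0 < r -> 0 <= m ->
  (forall x, `|v x| <= m * r) -> (forall x y, `|v x - v y| <= l * `|x - y|) ->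
  (holder_norm al v <= (m * r + (l + 2 * m) * r `^ (1 - al))%:E)%E.
Proof.
move=> /andP[al0 al1] l0 r0 m0 vm vl; rewrite EFinD; apply: leeD.
  by apply: ge_ereal_sup => _ [x _ <-]; rewrite lee_fin.
apply: ge_ereal_sup => _ [[x y] /= xy <-]; rewrite lee_fin.
have d0 : 0 < `|x - y| by rewrite normr_gt0 subr_eq0.
rewrite ler_pdivrMr ?powR_gt0//; set d := `|x - y| in d0 *.
have al1' : 0 <= 1 - al by rewrite subr_ge0 ltW.
have split z : 0 < z -> z = z `^ (1 - al) * z `^ al.
  move=> z0; rewrite -powRD; last by apply/implyP => _; rewrite gt_eqF.
  by rewrite subrK powRr1// ltW.
have [dr|rd] := leP d r.
  apply: le_trans (vl x y) _; rewrite -/d {1}(split d d0) !mulrA ler_wpM2r ?powR_ge0//.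
  apply: ler_pM => //; first exact: powR_ge0.
    by rewrite lerDl mulr_ge0.
  by apply: ge0_ler_powR; rewrite ?nnegrE// ltW.
apply: (@le_trans _ _ (2 * m * r)).
  apply: le_trans (ler_normB _ _) _.
  by have -> : 2 * m * r = m * r + m * r by [ring]; apply: lerD.
rewrite {1}(split r r0) !mulrA; apply: ler_pM; rewrite ?powR_ge0//.
- by rewrite mulr_ge0 ?powR_ge0// mulr_ge0.
- by rewrite ler_wpM2r ?powR_ge0// lerDr.
- by apply: ge0_ler_powR; rewrite ?nnegrE ?(ltW al0)// ltW.
Qed.

Lemma weighted_norm_decay (w : int -> R) (v : R -> R) (C rho t : R) : sqi leb circ v ->
  0 <= C -> (forall k, 0 <= w k) -> (forall k, w (- k) = w k) ->
  (forall K, \sum_(n < K) w (Posz n) * fourier_sqmod v (Posz n) <= C * expR (- (rho * t))) ->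
  (weighted_norm w v <= ((2 * C + 1) * expR (- (rho / 2 * t)))%:E)%E.
Proof.
move=> qv C0 w0 wN H; apply: weighted_norm_le => //.
  by rewrite mulr_ge0 ?expR_ge0// addr_ge0// mulr_ge0.
move=> K; apply: le_trans (H K) _.
rewrite exprMn -expRM_natl; have -> : 2%:R * - (rho / 2 * t) = - (rho * t) by field.
rewrite mulrAC ler_wpM2r ?expR_ge0// ler_pdivlMr//.
have -> : (2 * C + 1) ^+ 2 = 4 * C ^+ 2 + 4 * C + 1 by ring.
by have := sqr_ge0 C; move: (C ^+ 2) => q; lra.
Qed.

End Norms.

(** * Decay of the solution and of its time derivative *)

Section Decay.
Context {R : realType}.
Local Notation leb := (@lebesgue_measure R).
Variables (f0 : R -> R) (f ft : R * R -> R).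
Hypothesis hf0 : W1inf f0.
Hypothesis hf : muskat_solution f0 f ft.
Local Notation u := (fext f).
Local Notation M := (sup_bound f0).
Local Notation L := (lip_bound f0).
Local Notation c := (mean_value f0).
Variables (Bd : R) (N : set R).
Hypothesis Bd0 : 0 <= Bd.
Hypothesis mN : meas1 N.
Hypothesis N0 : leb N = 0%E.
Hypothesis gN : forall t, 0 < t -> ~ N t -> good_time f0 f ft Bd t.
Local Notation Y0 := (initial_spread f0).

Definition decay_rate := poincare_rate f0 / 2.
Local Notation m := decay_rate.

Lemma decay_rate_gt0 : 0 < m. Proof. by rewrite divr_gt0// poincare_rate_gt0. Qed.

Let scaled_rate_ge0 (k t : R) : 0 < k -> 0 < t -> 0 <= m / k * t.
Proof. by move=> k0 t0; apply: mulr_ge0; [apply: divr_ge0|]; apply: ltW => //; exact: decay_rate_gt0. Qed.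

Let v t x := u (x, t) - c.

Let dev t : 0 < t -> \int[leb]_(x in circ) (v t x ^+ 2) <= Y0 * expR (- (m * t)).
Proof. by move=> t0; have := deviation_decay hf0 hf Bd0 mN N0 gN t0. Qed.

Let Y0ge0 : 0 <= Y0.
Proof. by rewrite /initial_spread mulr_ge0 ?sqr_ge0// ltW// pi2_gt0. Qed.

Let cu t : continuous (fun x => u (x, t)).
Proof. exact: (@continuous_slice _ _ _ _ hf). Qed.

Let cv t : continuous (v t).
Proof. by move=> x; apply: cvgB; [exact: cu|exact: cvg_cst]. Qed.

Let pv t : periodic (v t).
Proof. by move=> x; rewrite /v (@periodic_slice _ _ _ _ hf). Qed.

Let vM t x : 0 < t -> `|v t x| <= M + `|c|.
Proof.
move=> t0; apply: le_trans (ler_normB _ _) _.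
by rewrite lerD2r; exact: (sup_le hf0 hf x (ltW t0)).
Qed.

Let vL t x y : 0 < t -> `|v t x - v t y| <= L * `|x - y|.
Proof.
move=> t0; have -> : v t x - v t y = u (x, t) - u (y, t) by rewrite /v; ring.
exact: (lipschitz hf0 hf).
Qed.

Lemma sqmod_fluct t (n : nat) : 0 < t -> fourier_sqmod (v t) (Posz n) =
  if n == 0%N then 0 else fourier_sqmod (slice f t) (Posz n).
Proof.
move=> t0; have cE : c = (2 * pi)^-1 * int_circ (slice f t).
  by rewrite /mean_value (ms_mean hf t0).
have e := fext_slice f (ltW t0); rewrite e in cE *.
have := fourier_sqmod_subc n (cu (t := t)) cE.
by [].
Qed.

Definition pos_const := Y0 + (M ^+ 2 + L ^+ 2) * (2 * pi).

Let S0 : 0 <= (M ^+ 2 + L ^+ 2) * (2 * pi).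
Proof. by rewrite mulr_ge0 ?addr_ge0 ?sqr_ge0// ltW// pi2_gt0. Qed.

Lemma pos_const_ge0 : 0 <= pos_const. Proof. exact: addr_ge0. Qed.

(** The modes with [1 + n^2] below a level growing like exp(m t / 2) are small in
    [L^2], the others are controlled by the bounded [H^1] norm. *)
Lemma sum_decay (al t : R) K : 0 < t -> 0 <= al <= 1 ->
  \sum_(n < K) hs_weight al (Posz n) * fourier_sqmod (v t) (Posz n) <=
  pos_const * expR (- ((1 - al) * (m / 2) * t)).
Proof.
move=> t0 /andP[al0 al1]; have m0 := decay_rate_gt0.
pose l := expR (m / 2 * t).
have l1 : 1 <= l by rewrite -expR0 ler_expR scaled_rate_ge0.
apply: le_trans (interp_pos K _ l1 (fun n => fourier_sqmod_ge0 (v t) (Posz n))) _.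
  by rewrite al0.
have pw k : l `^ k = expR (m / 2 * t * k) by rewrite /l -expRM.
rewrite !pw /pos_const mulrDl; apply: lerD.
  apply: (@le_trans _ _ (expR (m / 2 * t * al) * (Y0 * expR (- (m * t))))).
    apply: ler_wpM2l; first exact: expR_ge0.
    by apply: le_trans (dev t0); apply: bessel_fourier; exact: continuous_sqi.
  rewrite mulrCA ler_wpM2l// -expRD ler_expR.
  have -> : m / 2 * t * al - m * t = - ((2 - al) * (m / 2 * t)) by field.
  rewrite lerN2 -mulrA; apply: ler_wpM2r; first exact: scaled_rate_ge0.
  by rewrite lerD2r ler1n.
rewrite mulrC; apply: ler_pM => //.
- apply: sumr_ge0 => n _; apply: mulr_ge0; last exact: fourier_sqmod_ge0.
  by apply: addr_ge0 => //; exact: sqr_ge0.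
- apply: le_trans (sobolev hf0 hf K t0); apply: ler_sum => n _.
  apply: ler_wpM2l; first by apply: addr_ge0 => //; exact: sqr_ge0.
  rewrite sqmod_fluct//.
  by rewrite fext_slice ?(ltW t0)//; case: ifP => // _; exact: fourier_sqmod_ge0.
- by rewrite ler_expR le_eqVlt; apply/orP; left; apply/eqP; ring.
Qed.

Lemma slice_sqi t : 0 < t -> sqi leb circ (slice f t).
Proof. by move=> t0; rewrite fext_slice ?(ltW t0)//; exact: continuous_sqi. Qed.

Lemma homog_decay t : 0 < t ->
  (homog_half_norm (slice f t) <=
   ((2 * pos_const + 1) * expR (- ((1 - 2^-1) * (m / 2) / 2 * t)))%:E)%E.
Proof.
move=> t0; apply: weighted_norm_decay.
- exact: slice_sqi.
- exact: pos_const_ge0.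
- by move=> k; rewrite /homog_half_weight.
- exact: homog_weightN.
- move=> K; have h2 : 0 <= (2^-1 : R) <= 1 by rewrite invr_ge0 ler0n invf_le1// ler1n.
  apply: le_trans (sum_decay K t0 h2); apply: ler_sum => n _.
  rewrite sqmod_fluct//; case: ifPn => [/eqP ->|_].
    by rewrite /homog_half_weight normr0 mul0r mulr0.
  by rewrite ler_wpM2r ?fourier_sqmod_ge0// homog_le_hs.
Qed.

Lemma hs_decay (al t : R) : 0 < t -> 0 <= al <= 1 -> c = 0 ->
  (hs_norm al (slice f t) <=
   ((2 * pos_const + 1) * expR (- ((1 - al) * (m / 2) / 2 * t)))%:E)%E.
Proof.
move=> t0 al01 c0; apply: weighted_norm_decay.
- exact: slice_sqi.
- exact: pos_const_ge0.
- exact: hs_weight_ge0.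
- exact: hs_weightN.
- move=> K; rewrite (_ : slice f t = v t); first exact: sum_decay.
  by rewrite fext_slice ?(ltW t0)//; apply/funext => x; rewrite /v c0 subr0.
Qed.

Definition sup_const := 1 + Y0 + 2 * (M + `|c|) * L.

Lemma sup_const_ge1 : 1 <= sup_const.
Proof.
rewrite /sup_const -addrA lerDl addr_ge0// mulr_ge0 ?L_ge0//.
by rewrite mulr_ge0// addr_ge0// M_ge0.
Qed.

(** The averaging length in [sup_of_L2] is itself exponentially small in time. *)
Lemma sup_decay (t x : R) : 0 < t -> `|v t x| <= sup_const * expR (- (m / 4 * t)).
Proof.
move=> t0; have m0 := decay_rate_gt0; pose e := expR (- (m / 2 * t)).
have e0 : 0 < e by exact: expR_gt0.
have e1 : e <= 1 by rewrite -expR0 ler_expR oppr_le0 scaled_rate_ge0.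
have H := sup_of_L2 x (cv (t := t)) (@pv t) (fun y => vM y t0) (L_ge0 f0)
  (fun y z => vL y z t0) e0 e1.
have c1 := sup_const_ge1; have K0 : 0 <= sup_const by exact: le_trans c1.
have E2 : expR (- (m / 4 * t)) ^+ 2 = e.
  by rewrite -expRM_natl /e; congr expR; field.
rewrite -ler_sqr ?nnegrE ?mulr_ge0 ?expR_ge0// real_normK ?num_real//.
rewrite exprMn E2; apply: le_trans H _.
apply: (@le_trans _ _ (sup_const * e)); last first.
  by rewrite ler_wpM2r ?(ltW e0)// expr2 ler_peMl.
rewrite /sup_const [X in _ <= X]mulrDl lerD2r; apply: (@le_trans _ _ (Y0 * e)).
  rewrite mulrC ler_pdivrMr//; apply: le_trans (dev t0) _.
  rewrite -[Y0 * e * e]mulrA -expr2 ler_wpM2l// /e -expRM_natl ler_expR le_eqVlt; apply/orP; left; apply/eqP.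
  by field.
by rewrite ler_wpM2r ?(ltW e0)// lerDr.
Qed.

Lemma holder_decay (al t : R) : 0 < t -> 0 < al < 1 -> c = 0 ->
  (holder_norm al (slice f t) <=
   ((3 * sup_const + L) * expR (- ((1 - al) * (m / 4) * t)))%:E)%E.
Proof.
move=> t0 al01 c0; have /andP[al0 al1] := al01; have m0 := decay_rate_gt0.
have K0 : 0 <= sup_const by exact: le_trans sup_const_ge1.
have ev : slice f t = v t.
  by rewrite fext_slice ?(ltW t0)//; apply/funext => x; rewrite /v c0 subr0.
rewrite ev; pose r := expR (- (m / 4 * t)).
apply: le_trans (holder_le al01 (L_ge0 f0) (expR_gt0 _) K0
  (fun x => sup_decay x t0) (fun x y => vL x y t0)) _.
rewrite lee_fin -expRM; set z := expR (- ((1 - al) * _ * _)).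
have -> : expR (- (m / 4 * t) * (1 - al)) = z by congr expR; ring.
have h : expR (- (m / 4 * t)) <= z.
  rewrite ler_expR lerN2 -mulrA ler_piMl ?scaled_rate_ge0//.
  by rewrite gerBl ltW.
have := ler_wpM2l K0 h; move: (sup_const * expR _) => w hw.
have -> : (3 * sup_const + L) * z = sup_const * z + (L + 2 * sup_const) * z by ring.
by rewrite lerD2r.
Qed.

Definition coef_const := 2 * (Y0 + Bd) + test_const f0.

Let T0 : 0 <= test_const f0.
Proof.
have p0 := @pi2_gt0 R; have M0 := M_ge0 f0.
rewrite /test_const mulr_ge0// mulr_ge0 ?(ltW p0)//.
by rewrite addr_ge0// mulr_ge0.
Qed.

(** The energy is at most the pairing of [ft] with the deviation, so it decays
    exponentially. In the bound for the pairing of [ft] with a mode the weight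
    [k] is then taken exponentially large, and proportional to the square root of
    [1 + n^2] to balance the two terms in [n]. *)
Lemma dt_sqmod_le t (n : nat) : 0 < t -> ~ N t ->
  fourier_sqmod (slice ft t) (Posz n) <=
  2 * coef_const ^+ 2 * expR (- (m / 2 * t)) * (1 + (Posz n)%:~R ^+ 2).
Proof.
move=> t0 nN; have m0 := decay_rate_gt0; have g := gN t0 nN.
have mC := @mcirc R.
have [E [E0 E1 E2 E3 E4]] := good_dissipation hf0 hf t0 g.
have [_ _ q b _] := g.
(* Half the exponent of the decay of the deviation, so both terms of the bound below decay. *)
pose k := expR (m / 2 * t); have k0 : 0 < k by exact: expR_gt0.
have EE : E <= (Y0 + Bd) * expR (- (m / 2 * t)).
  have i1 : ig leb circ (fun x => slice ft t x * u (x, t)).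
    by apply: sqiM => //; exact: continuous_sqi.
  have i2 : ig leb circ (slice ft t) by apply: sqi_ig => //; exact: circ_lty.
  have i3 := igZ c mC i2.
  have eq : int_circ (fun x => v t x * slice ft t x) =
      int_circ (fun x => slice ft t x * slice f t x).
    rewrite (fext_slice f (ltW t0)) -[RHS]subr0 -[in RHS](mulr0 c) -E3 /int_circ.
    rewrite -RintegralZl// -RintegralB//.
    by apply: eq_Rintegral => x _; rewrite /v; ring.
  have Y : `|int_circ (fun x => v t x * slice ft t x)| <=
      k * \int[leb]_(x in circ) (v t x ^+ 2) +
      k^-1 * \int[leb]_(x in circ) (slice ft t x ^+ 2).
    by apply: Rint_young => //; exact: continuous_sqi.
  rewrite eq in Y.
  have E5 : E <= k * \int[leb]_(x in circ) (v t x ^+ 2) +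
      k^-1 * \int[leb]_(x in circ) (slice ft t x ^+ 2).
    by apply: le_trans Y; rewrite -normrN; apply: le_trans (ler_norm _); rewrite lerNr.
  apply: le_trans E5 _; rewrite mulrDl; apply: lerD.
    apply: (@le_trans _ _ (k * (Y0 * expR (- (m * t))))).
      by apply: ler_wpM2l; [exact: ltW|exact: dev].
    rewrite mulrCA ler_wpM2l// -expRD ler_expR le_eqVlt; apply/orP; left; apply/eqP.
    by field.
  by rewrite -expRN mulrC ler_wpM2r ?expR_ge0.
pose br : R := 1 + n%:R ^+ 2.
have br0 : 0 < br by rewrite ltr_wpDr// sqr_ge0.
pose s := Num.sqrt br; have s0 : 0 < s by rewrite sqrtr_gt0.
have ss : s ^+ 2 = br by rewrite sqr_sqrtr// ltW.
(* The exponential grows half as fast as the energy decays. *)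
pose ka := expR (m / 4 * t) * s; have ka0 : 0 < ka by rewrite mulr_gt0// expR_gt0.
pose W := coef_const * s * expR (- (m / 4 * t)).
have bound : 2 * ka * E + ka^-1 * (test_const f0 * br) <= W.
  have -> : W = 2 * (Y0 + Bd) * s * expR (- (m / 4 * t)) +
    test_const f0 * s * expR (- (m / 4 * t)) by rewrite /W /coef_const; ring.
  apply: lerD.
    apply: (@le_trans _ _ (2 * ka * ((Y0 + Bd) * expR (- (m / 2 * t))))).
      by apply: ler_wpM2l => //; rewrite mulr_ge0// ltW.
    rewrite le_eqVlt; apply/orP; left; apply/eqP.
    have -> : expR (- (m / 4 * t)) = expR (m / 4 * t) * expR (- (m / 2 * t)).
      by rewrite -expRD; congr expR; field.
    by rewrite /ka; ring.
  rewrite /ka invfM -expRN -ss le_eqVlt; apply/orP; left; apply/eqP.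
  by rewrite expr2; field; exact: lt0r_neq0.
have [c1 s1] := E4 n ka ka0.
have W2 : W ^+ 2 = coef_const ^+ 2 * expR (- (m / 2 * t)) * br.
  have -> : expR (- (m / 2 * t)) = expR (- (m / 4 * t)) ^+ 2.
    by rewrite -expRM_natl; congr expR; field.
  by rewrite /W -ss; ring.
have sq z : `|z| <= 2 * ka * E + ka^-1 * (test_const f0 * br) -> z ^+ 2 <= W ^+ 2.
  move=> h; have h2 := le_trans h bound.
  by rewrite -real_normK ?num_real// ler_sqr ?nnegrE ?h2// (le_trans _ h2).
have := sq _ c1; have := sq _ s1.
have p1 : (2 * pi : R)^-1 ^+ 2 <= 1.
  rewrite expr_le1// ?invr_ge0 ?(ltW (@pi2_gt0 R))// invf_le1 ?pi2_gt0//.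
  by have := pi_ge2 R; move: pi => z; lra.
have -> : 2 * coef_const ^+ 2 * expR (- (m / 2 * t)) * (1 + (Posz n)%:~R ^+ 2) =
    W ^+ 2 + W ^+ 2 by rewrite W2 /br; ring.
rewrite /fourier_sqmod /fourier_cos /fourier_sin !exprMn => h1 h2.
apply: lerD.
  by apply: le_trans h2; rewrite ler_piMl// sqr_ge0.
by apply: le_trans h1; rewrite ler_piMl// sqr_ge0.
Qed.

Definition neg_const := Bd + 6 * coef_const ^+ 2.

Lemma neg_const_ge0 : 0 <= neg_const.
Proof. by rewrite addr_ge0// mulr_ge0// sqr_ge0. Qed.

(** The level of frequencies grows slowly enough for the decay of each mode to
    win over its polynomial cost. *)
Lemma dt_decay (ep t : R) : 0 < ep -> 0 < t -> ~ N t ->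
  (hs_norm (- ep) (slice ft t) <=
   ((2 * neg_const + 1) * expR (- (Num.min ep 2 * (m / 8) / 2 * t)))%:E)%E.
Proof.
move=> ep0 t0 nN; have m0 := decay_rate_gt0; have [_ _ q b _] := gN t0 nN.
apply: weighted_norm_decay => //.
- exact: neg_const_ge0.
- exact: hs_weight_ge0.
- exact: hs_weightN.
(* The square of the level grows like exp(m t / 4), slower than the modes decay. *)
move=> K; pose l := expR (m / 8 * t).
have l1 : 1 <= l by rewrite -expR0 ler_expR scaled_rate_ge0.
pose D := 2 * coef_const ^+ 2 * expR (- (m / 2 * t)).
have D0 : 0 <= D by rewrite mulr_ge0 ?expR_ge0// mulr_ge0// sqr_ge0.
apply: le_trans (interp_neg K (ltW ep0) l1 D0
  (fun n => fourier_sqmod_ge0 (slice ft t) (Posz n)) (fun n => dt_sqmod_le n t0 nN)) _.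
set z := expR (- _).
have mt : 0 <= m / 8 * t by exact: scaled_rate_ge0.
have z1 : l `^ (- ep) <= z.
  rewrite /l -expRM ler_expR mulrN lerN2 [m / 8 * t * ep]mulrC -[Num.min _ _ * _ * _]mulrA; apply: ler_wpM2r => //.
  by rewrite ge_min lexx.
have z2 : expR (- (m / 4 * t)) <= z.
  rewrite ler_expR lerN2 -[Num.min _ _ * _ * _]mulrA.
  have -> : m / 4 * t = 2 * (m / 8 * t) by field.
  by apply: ler_wpM2r => //; rewrite ge_min lexx orbT.
rewrite /neg_const mulrDl; apply: lerD.
  rewrite mulrC; apply: ler_pM => //.
  - by apply: sumr_ge0 => n _; exact: fourier_sqmod_ge0.
  - exact: powR_ge0.
  - by apply: le_trans b; exact: bessel_fourier.
have Dl : D * l ^+ 2 = 2 * coef_const ^+ 2 * expR (- (m / 4 * t)).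
  have -> : expR (- (m / 4 * t)) = expR (- (m / 2 * t)) * l ^+ 2.
    by rewrite /l -expRM_natl -expRD; congr expR; field.
  by rewrite /D; ring.
rewrite Dl; apply: (@le_trans _ _ (2 * coef_const ^+ 2 * z * 3)).
  apply: ler_pM.
  - by rewrite mulr_ge0 ?expR_ge0// mulr_ge0// sqr_ge0.
  - apply: sumr_ge0 => n _; rewrite invr_ge0; apply: addr_ge0 => //; exact: sqr_ge0.
  - by apply: ler_wpM2l => //; rewrite mulr_ge0// sqr_ge0.
  - exact: sum_inv_br.
by rewrite le_eqVlt; apply/orP; left; apply/eqP; ring.
Qed.

End Decay.

(** * Square integrability in time *)

Section TimeNorms.
Context {R : realType}.
Local Notation leb := (@lebesgue_measure R).

(** The integral of a nonnegative function is the supremum of the integrals of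
    the simple functions below it, and this family grows with the function. *)
Lemma le_integral_any (D : set R) (F G : R -> \bar R) :
  (forall t, D t -> (0 <= F t)%E) -> (forall t, D t -> (F t <= G t)%E) ->
  (\int[leb]_(t in D) F t <= \int[leb]_(t in D) G t)%E.
Proof.
move=> F0 FG; rewrite integral_mkcond [leRHS]integral_mkcond.
rewrite !ge0_integralTE.
- apply: ereal_sup_le => _ [h hF <-]; exists h => // t; apply: le_trans (hF t) _.
  rewrite !patchE; case: ifPn => //; rewrite inE => Dt; exact: FG.
- move=> t; rewrite patchE; case: ifPn => //; rewrite inE => Dt.
  by apply: le_trans (FG t Dt); exact: F0.
- by move=> t; rewrite patchE; case: ifPn => //; rewrite inE => Dt; exact: F0.
Qed.

Lemma meas_time_axis : meas1 (@time_axis R). Proof. exact: measurable_itv. Qed.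

(** The integrand is a multiple of the density of an exponential law. *)
Lemma exp_integral_lty (A l : R) : 0 <= A -> 0 < l ->
  (\int[leb]_(t in time_axis) (A * expR (- (l * t)))%:E < +oo)%E.
Proof.
move=> A0 l0; have mE : measurable_fun (@time_axis R) (exponential_pdf l).
  by apply: measurable_funTS; exact: measurable_exponential_pdf.
have := integral_exponential_pdf l0; move=> I1.
rewrite (_ : (\int[leb]_(t in _) _)%E =
   (\int[leb]_(t in time_axis) ((A / l)%:E * (exponential_pdf l t)%:E))%E).
  rewrite ge0_integralZl//; last 4 first.
  - exact: meas_time_axis.
  - exact/measurable_EFinP.
  - by move=> t _; rewrite lee_fin exponential_pdf_ge0// ltW.
  - by rewrite lee_fin divr_ge0// ltW.
  apply: (@le_lt_trans _ _ ((A / l)%:E * 1%E)%E); last by rewrite mule1 ltry.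
  apply: lee_wpmul2l; first by rewrite lee_fin divr_ge0// ltW.
  rewrite -I1; apply: ge0_subset_integral => //; first exact: meas_time_axis.
  - by apply/measurable_EFinP; exact: measurable_exponential_pdf.
  - by move=> t _; rewrite lee_fin exponential_pdf_ge0// ltW.
apply: eq_integral => t; rewrite inE /time_axis /= in_itv /= andbT => t0.
rewrite exponential_pdfE// -EFinM mulrA divfK ?gt_eqF//.
by rewrite mulNr.
Qed.

(** The exceptional times, the initial time included, carry the value [+oo] of a
    measurable upper bound. *)
Lemma decay_L2 (F : R -> \bar R) (A l : R) (N : set R) : 0 <= A -> 0 < l ->
  meas1 N -> leb N = 0%E -> (forall t, (0 <= F t)%E) ->
  (forall t, 0 < t -> ~ N t -> (F t <= (A * expR (- (l * t)))%:E)%E) ->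
  (\int[leb]_(t in time_axis) (F t `^ 2) < +oo)%E.
Proof.
move=> A0 l0 mN N0 F0 FA; pose N1 := N `|` [set 0].
have mN1 : meas1 N1 by apply: measurableU => //; exact: measurable_set1.
have N10 : leb N1 = 0%E.
  have h : (leb N1 <= leb N + leb [set (0 : R)%R])%E.
    by apply: measureU2 => //; exact: measurable_set1.
  rewrite N0 lebesgue_measure_set1 adde0 in h.
  by apply/eqP; rewrite eq_le h/=; exact: measure_ge0.
pose G t := (((cst +oo%E) \_ N1) t + (A ^+ 2 * expR (- (2 * l * t)))%:E)%E.
have E0 t : (0 <= (A ^+ 2 * expR (- (2 * l * t)))%:E)%E.
  by rewrite lee_fin mulr_ge0 ?sqr_ge0 ?expR_ge0.
apply: (@le_lt_trans _ _ (\int[leb]_(t in time_axis) G t)%E).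
  apply: le_integral_any => t; first by rewrite poweR_ge0.
  rewrite /time_axis /= in_itv /= andbT /G patchE => t0; case: ifPn => [_|nN].
    by rewrite addye ?leey// gt_eqF// (lt_le_trans _ (E0 t))// ltNy0.
  rewrite add0e; have nN1 : ~ N1 t by move=> h; case/negP: nN; rewrite inE.
  have tp : 0 < t.
    by rewrite lt_neqAle t0 andbT; apply/eqP => e; apply: nN1; right; rewrite /= -e.
  have := FA t tp (fun h => nN1 (or_introl h)); have := F0 t.
  case: (F t) => [r| |] //; rewrite lee_fin => r0; rewrite lee_fin => rA.
  rewrite poweR_EFin lee_fin powR_mulrn// (_ : 2 * l * t = 2%:R * (l * t)); last by ring.
  rewrite -mulrN expRM_natl -exprMn ler_sqr ?nnegrE//.
  by rewrite mulr_ge0 ?expR_ge0.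
have mE : measurable_fun (@time_axis R) (fun t => A ^+ 2 * expR (- (2 * l * t))).
  apply: continuous_mfun1 => t; apply: cvgM; first exact: cvg_cst.
  apply: (@continuous_comp _ _ _ (fun t => - (2 * l * t)) expR); last exact: continuous_expR.
  by apply: cvgN; apply: cvgM; [exact: cvg_cst|exact: cvg_id].
rewrite /G ge0_integralD//; last 4 first.
- exact: meas_time_axis.
- by move=> t _; rewrite patchE; case: ifP => _; rewrite ?leey.
- apply: measurable_funTS; apply/(measurable_restrictT _ _).1 => //.
- exact/measurable_EFinP.
have mm : meas1 (@time_axis R `&` N1) by apply: measurableI => //; exact: meas_time_axis.
have m0 : leb (@time_axis R `&` N1) = 0%E.
  have h : (leb (@time_axis R `&` N1) <= leb N1)%E.
    by apply: le_measure; rewrite ?inE//; exact: subIsetr.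
  by rewrite N10 in h; apply/eqP; rewrite eq_le h/=; exact: measure_ge0.
have Z : (\int[leb]_(t in time_axis) ((cst +oo) \_ N1) t = 0)%E.
  by rewrite -integral_mkcondr; apply: null_set_integral => //; exact: measurable_cst.
have W := exp_integral_lty (sqr_ge0 A) (mulr_gt0 (ltr0n R 2) l0).
by rewrite Z add0e.
Qed.

(** Fubini's theorem gives measurability in time of the integrals of the positive
    and negative parts; the initial time is a single point. *)
Lemma pairing_meas (g : R * R -> R) (h : R -> R) :
  mfun2 (@positive_times R) g -> continuous h ->
  mfun1 (@time_axis R) (fun t => int_circ (fun x => g (x, t) * h x)).
Proof.
move=> mg ch; pose J : set R := `]0, +oo[%classic.
have mJ : meas1 J by exact: measurable_itv.
pose D : set (R * R) := circ `*` J.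
have mC := @mcirc R; have mD : meas2 D by exact: measurableX.
pose q (p : R * R) := g p * h p.1.
have mq : mfun2 D q.
  apply: measurable_funM.
    apply: measurable_funS mg; first exact: meas_positive.
    by move=> [x t] [_]; rewrite /J /= in_itv /= andbT.
  apply: continuous2_measD => p.
  by apply: (@continuous_comp _ _ _ fst h); [exact: cvg_fst|exact: ch].
pose Q : R * R -> \bar R := EFin \o (q \_ D).
have mQ : mfun2 setT Q by exact: patch_meas.
pose K t := fine ((\int[leb]_x (funepos Q (x, t))) - (\int[leb]_x (funeneg Q (x, t))))%E.
have mK : mfun1 setT K.
  apply: measurableT_comp; first exact: fine_measurable.
  apply: emeasurable_funB.
    have := @measurable_fun_fubini_tonelli_G _ _ (measurableTypeR R) (measurableTypeR R) R
      leb (funepos Q).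
    by apply => //; exact: measurable_funepos.
  have := @measurable_fun_fubini_tonelli_G _ _ (measurableTypeR R) (measurableTypeR R) R
    leb (funeneg Q).
  by apply => //; exact: measurable_funeneg.
have -> : @time_axis R = [set 0] `|` J.
  apply/seteqP; split => t; rewrite /time_axis /J /= !in_itv /= !andbT.
    by rewrite le_eqVlt => /predU1P[<-|]; [left|right].
  by case=> [->|/ltW].
apply: (measurable_funU _ (@measurable_set1 R 0) mJ).2.
split; first exact: measurable_fun_set1.
apply: (@eq_measurable_fun _ _ _ _ _ K); last exact: measurable_funTS.
move=> t /set_mem Jt; rewrite /K /int_circ /Rintegral; congr fine.
rewrite integral_mkcond [RHS]integralE.
have e x : ((fun x => (g (x, t) * h x)%:E) \_ circ) x = Q (x, t).
  rewrite /Q /= !patchE /D; have -> : ((x, t) \in circ `*` J) = (x \in circ).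
    by apply/idP/idP => [/set_mem[xC _]|/set_mem xC]; apply: mem_set.
  by case: ifP.
by congr (_ - _)%E; apply: eq_integral => x _; rewrite ?funeposE ?funenegE e.
Qed.

End TimeNorms.

Lemma coef_meas (R : realType) (f0 : R -> R) (f ft : R * R -> R) (h : R -> R) :
  muskat_solution f0 f ft -> continuous h ->
  mfun1 (@time_axis R) (fun t => int_circ (fun x => slice f t x * h x)).
Proof.
move=> hf ch; pose F t := int_circ (fun x => fext f (x, t) * h x).
apply: (@eq_measurable_fun _ _ _ _ _ F).
  move=> t; rewrite inE /time_axis /= in_itv /= andbT => t0.
  by rewrite /F fext_slice.
by apply: continuous_mfun1; exact: (continuous_coef hf ch).
Qed.

Theorem proposition3p2 (R : realType) (f0 : R -> R) (f ft : R * R -> R)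
    (hf0 : W1inf f0) (hf : muskat_solution f0 f ft) :
  (L2_time homog_half_weight f /\ L2_time (hs_weight (- 2^-1)) ft) /\
  (int_circ f0 = 0 ->
   forall alpha epsilon : R, 0 < alpha < 1 -> 0 < epsilon ->
   [/\ decays_exponentially (fun t => hs_norm alpha (slice f t)),
       decays_exponentially (fun t => holder_norm alpha (slice f t)) &
       ae_decays_exponentially (fun t => hs_norm (- epsilon) (slice ft t))]).
Proof.
have [Bd [Bd0 [N [mN N0 sub]]]] := ae_good hf0 hf.
have gN t : 0 < t -> ~ N t -> good_time f0 f ft Bd t.
  by move=> t0 nN; apply: contrapT => ng; apply: nN; apply: sub => /= h; exact/ng/h.
have m0 := @decay_rate_gt0 R f0.
have pc : 0 <= 2 * pos_const f0 + 1 :> R.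
  by rewrite addr_ge0// mulr_ge0//; exact: pos_const_ge0.
have nc : 0 <= 2 * neg_const f0 Bd + 1.
  by rewrite addr_ge0// mulr_ge0//; exact: neg_const_ge0.
have cosk (k : int) : continuous (fun x : R => cos (k%:~R * x)) by exact: (@continuous_cosk R k%:~R).
have sink (k : int) : continuous (fun x : R => sin (k%:~R * x)) by exact: (@continuous_sink R k%:~R).
have scale (g : R -> R) : mfun1 (@time_axis R) g ->
    mfun1 (@time_axis R) (fun t => (2 * pi)^-1 * g t).
  by move=> mg; apply: measurable_funM => //; exact: measurable_cst.
have mft : mfun2 (@positive_times R) ft by exact: ft_meas hf.
split; [split; split|].
- by move=> k; apply: scale; exact: coef_meas hf _.
- by move=> k; apply: scale; exact: coef_meas hf _.
- have h : 0 < (1 - 2^-1) * (decay_rate f0 / 2) / 2 :> R.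
    by apply: divr_gt0 => //; apply: mulr_gt0; [lra|exact: divr_gt0].
  apply: (decay_L2 (F := fun t => homog_half_norm (slice f t)) pc h mN N0).
  + by move=> t; exact: poweR_ge0.
  + by move=> t t0 nN; have := homog_decay hf0 hf Bd0 mN N0 gN t0.
- by move=> k; apply: scale; exact: pairing_meas.
- by move=> k; apply: scale; exact: pairing_meas.
- have h : 0 < Num.min 2^-1 2 * (decay_rate f0 / 8) / 2 :> R.
    apply: divr_gt0 => //; apply: mulr_gt0; last exact: divr_gt0.
    by rewrite lt_min invr_gt0 ltr0n.
  apply: (decay_L2 (F := fun t => hs_norm (- 2^-1) (slice ft t)) nc h mN N0).
  + by move=> t; exact: poweR_ge0.
  + move=> t t0 nN; apply: (dt_decay hf0 hf Bd0 mN N0 gN _ t0 nN).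
    by rewrite invr_gt0.
move=> f00 al ep al01 ep0; have /andP[al0 al1] := al01.
have c0 : mean_value f0 = 0 by rewrite /mean_value f00 mulr0.
have al1' : 0 < 1 - al by rewrite subr_gt0.
split.
- exists (2 * pos_const f0 + 1), ((1 - al) * (decay_rate f0 / 2) / 2); split.
  + by rewrite ltr_wpDl// mulr_ge0//; exact: pos_const_ge0.
  + by apply: divr_gt0 => //; apply: mulr_gt0 => //; exact: divr_gt0.
  + move=> t t0; apply: (hs_decay hf0 hf Bd0 mN N0 gN t0 _ c0).
    by rewrite (ltW al0) (ltW al1).
- exists (3 * sup_const f0 + lip_bound f0), ((1 - al) * (decay_rate f0 / 4)); split.
  + rewrite ltr_pwDl ?L_ge0// mulr_gt0//.
    exact: lt_le_trans (sup_const_ge1 f0).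
  + by apply: mulr_gt0 => //; exact: divr_gt0.
  + by move=> t t0; exact: (holder_decay hf0 hf Bd0 mN N0 gN t0 al01 c0).
- exists (2 * neg_const f0 Bd + 1), (Num.min ep 2 * (decay_rate f0 / 8) / 2); split.
  + by rewrite ltr_wpDl// mulr_ge0//; exact: neg_const_ge0.
  + apply: divr_gt0 => //; apply: mulr_gt0; last exact: divr_gt0.
    by rewrite lt_min ep0 ltr0n.
  + exists N; split => // t /= H; apply: contrapT => nN; apply: H => t0.
    exact: (dt_decay hf0 hf Bd0 mN N0 gN ep0 t0 nN).
Qed.
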